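(* Let $m\ge 0$ be an integer and let $\Phi=\{\varphi_j(x)=\lambda_j x+t_j\}_{j=0}^m$ be a self-similar iterated function system on $\mathbb{R}$, i.e. $\lambda_j\in(-1,1)\setminus\{0\}$ and $t_j\in\mathbb{R}$ for each $0\le j\le m$. Suppose that $\lambda_0,\dots,\lambda_m$ are all algebraic numbers and that $\Phi$ has no exact overlaps. Let $p=(p_j)_{j=0}^m$ be a probability vector with strictly positive coordinates and let $\mu$ be the self-similar measure corresponding to $\Phi$ and $p$. Then $$\dim\mu=\beta,\qquad\text{where }\ \beta=\min\{1,H(p)/\chi\},\quad H(p)=-\sum_{j=0}^m p_j\log p_j,\quad \chi=-\sum_{j=0}^m p_j\log|\lambda_j| .$$
   Context: Logarithms are to base $2$. Write $\Lambda=\{0,\dots,m\}$, and for $w=j_1\dots j_n\in\Lambda^n$ write $\varphi_w=\varphi_{j_1}\circ\dots\circ\varphi_{j_n}$. The system $\Phi$ has exact overlaps if there exist $n\ge1$ and distinct words $w_1,w_2\in\Lambda^n$ with $\varphi_{w_1}=\varphi_{w_2}$ (equivalently, the semigroup generated by the maps is not free on them). The self-similar measure corresponding to $\Phi$ and $p$ is the unique Borel probability measure $\mu$ on $\mathbb{R}$ with $\mu=\sum_{j=0}^m p_j\cdot\varphi_j\mu$, where $\varphi_j\mu$ denotes the push-forward of $\mu$ by $\varphi_j$. It is known (Feng–Hu) that $\mu$ is exact dimensional: there is a number $\dim\mu\in[0,1]$ with $\dim\mu=\lim_{\delta\downarrow0}\frac{\log\mu(x-\delta,x+\delta)}{\log\delta}$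 for $\mu$-a.e. $x\in\mathbb{R}$; this defines $\dim\mu$. *)

(* Defs.v *)
From HB Require Import structures.
From mathcomp Require Import all_boot all_order all_algebra.
From mathcomp Require Import all_classical all_reals all_analysis.

Set Implicit Arguments.
Unset Strict Implicit.
Unset Printing Implicit Defensive.

Import Order.TTheory GRing.Theory Num.Theory.
Import numFieldNormedType.Exports.

Local Open Scope classical_set_scope.
Local Open Scope ring_scope.

Definition log2 (R : realType) (x : R) : R := ln x / ln 2.

Definition ifs_map (R : realType) (m : nat) (lam t : 'I_m.+1 -> R)
    (j : 'I_m.+1) (x : R) : R :=
  lam j * x + t j.

Definition ifs_word (R : realType) (m : nat) (lam t : 'I_m.+1 -> R)
    (w : seq 'I_m.+1) : R -> R :=
  foldr (fun j f => ifs_map lam t j \o f) id w.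

Definition has_exact_overlaps (R : realType) (m : nat)
    (lam t : 'I_m.+1 -> R) : Prop :=
  exists n : nat, exists w1 w2 : n.-tuple 'I_m.+1,
    [/\ (0 < n)%N, w1 != w2 & ifs_word lam t w1 =1 ifs_word lam t w2].

(* For a probability vector p and contractions ifs_map lam t j, exactly one
   Borel probability measure satisfies this predicate. *)
Definition is_self_similar_measure (R : realType) (m : nat)
    (lam t p : 'I_m.+1 -> R) (mu : probability (measurableTypeR R) R) : Prop :=
  forall A : set (measurableTypeR R), measurable A ->
    mu A = (\sum_(j < m.+1) (p j)%:E *
              pushforward mu (ifs_map lam t j : measurableTypeR R -> measurableTypeR R) A)%E.

(* Exact dimensionality of mu together with the value d of its dimension; d is
   determined by mu, since mu is not the zero measure.  The points x at which
   mu `]x - delta, x + delta[ vanishes for some delta > 0 (where ln 0 = 0 would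
   matter) form the mu-null complement of the support. *)
Definition has_dimension (R : realType)
    (mu : probability (measurableTypeR R) R) (d : R) : Prop :=
  0 <= d <= 1 /\
  {ae mu, forall x : R,
    log2 (fine (mu `]x - delta, x + delta[%classic)) / log2 delta
      @[delta --> 0^'+] --> d}.

Definition entropy (R : realType) (m : nat) (p : 'I_m.+1 -> R) : R :=
  - \sum_(j < m.+1) p j * log2 (p j).

Definition lyapunov_exponent (R : realType) (m : nat)
    (lam p : 'I_m.+1 -> R) : R :=
  - \sum_(j < m.+1) p j * log2 `|lam j|.

(* Main.v *)
Require Import Defs.
From mathcomp Require Import all_boot all_order all_algebra.
From mathcomp Require Import all_classical all_reals all_analysis.
From mathcomp Require Import perm measurable_realfun ring lra zify.

Import Order.TTheory GRing.Theory Num.Theory.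
Import numFieldNormedType.Exports.

Local Open Scope classical_set_scope.
Local Open Scope ring_scope.

Set Implicit Arguments.
Unset Strict Implicit.
Unset Printing Implicit Defensive.

(* Let alpha be the entropy dimension of mu, i.e. the growth rate of the entropy of
   mu at scale e^-n; words are stopped when their contraction reaches the scale.

   Hochman: if alpha < 1 then convolving mu with any measure of positive entropy
   increases the entropy, since repeated self-convolution (Kaimanovich-Vershik) would
   otherwise spread the measure by a Littlewood-Offord estimate.  Hence the word
   measure at level n has no entropy between the scales e^-n and e^-(q n).

   Rapaport: the translation of a word w is c_w . t, with c_w a vector over Z[lambda].
   The differences c_w - c_w' that nearly annihilate t span subspaces W_n.  By Liouville's
   inequality and Cramer's rule, the elements of W_n + W_2n still nearly annihilate t, so
   modulo such sums the words keep entropy alpha n, while modulo W_n alone they have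
   no more than that.  Submodularity carries this over to the intersections of the W_n,
   with a loss only when the dimension drops.  The final intersection detects only
   exact overlaps, so alpha n is the entropy of the words, which is at least
   n H(p) / chi.

   The almost sure lower bound for the local dimension by alpha follows from the
   submultiplicativity of the power means of the cell masses; the upper bounds by 1
   and H(p) / chi follow from counting cells and from a Chernoff bound for the words. *)

(** * Entropy of finite distributions *)

(** Only the ratios are algebraic while the translations are arbitrary reals, and near coincidences
    at infinitely many levels have to be turned into exact ones. This is why words are compared as
    linear forms in t: their coefficients have controlled heights, and a decreasing sequence of
    subspaces of a space of dimension m + 1 drops in rank only boundedly often. Along doubling
    levels the losses stay proportional to the level.

    Unequal ratios force the use of stopped words. The ratio of a word is carried along as a second
    observable; it costs little, as there are only polynomially many ratios at a given level.

    Everything before the local dimension concerns finite distributions of words: replacing mu by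
    words and reals by integer parts changes entropies by bounded amounts. The almost sure
    statements come from exponential tail bounds and Borel-Cantelli. *)

Section FiniteDist.
Variable R : realType.

(** A value may be listed several times, so that mapping and binding never merge weights. Laws are
    compared through [Ex]. *)
Record fdist (T : eqType) := Fdist {
  fdl : seq (R * T);
  fdl_gt0 : all (fun z => 0 < z.1) fdl;
  fdl_sum : \sum_(z <- fdl) z.1 = 1 }.

Definition supp (T : eqType) (d : fdist T) (x : T) : bool := x \in unzip2 (fdl d).

Definition Ex (T : eqType) (d : fdist T) (f : T -> R) : R :=
  \sum_(z <- fdl d) z.1 * f z.2.

Section Expectation.
Variables (T : eqType) (d : fdist T).
Implicit Types f g : T -> R.

Lemma fdl_pos z : z \in fdl d -> 0 < z.1.
Proof. by move: (fdl_gt0 d) => /allP; apply. Qed.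

Lemma fdl_supp z : z \in fdl d -> supp d z.2.
Proof. by move=> zd; apply: map_f. Qed.

Lemma eq_Ex f g : (forall x, supp d x -> f x = g x) -> Ex d f = Ex d g.
Proof. by move=> fg; apply: eq_big_seq => z zd; rewrite fg // fdl_supp. Qed.

Lemma le_Ex f g : (forall x, supp d x -> f x <= g x) -> Ex d f <= Ex d g.
Proof.
move=> fg; rewrite /Ex big_seq [leRHS]big_seq; apply: ler_sum => z zd.
by rewrite ler_pM2l ?fg ?fdl_supp ?fdl_pos.
Qed.

Lemma Ex_cst c : Ex d (fun=> c) = c.
Proof. by rewrite /Ex -mulr_suml fdl_sum mul1r. Qed.

Lemma ExD f g : Ex d (fun x => f x + g x) = Ex d f + Ex d g.
Proof. by rewrite /Ex -big_split; apply: eq_bigr => z _; rewrite mulrDr. Qed.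

Lemma ExZ c f : Ex d (fun x => c * f x) = c * Ex d f.
Proof. by rewrite /Ex big_distrr; apply: eq_bigr => z _; rewrite /= mulrCA. Qed.

Lemma ExZr c f : Ex d (fun x => f x * c) = Ex d f * c.
Proof. by rewrite mulrC -ExZ; apply: eq_Ex => z _; rewrite mulrC. Qed.

Lemma ExN f : Ex d (fun x => - f x) = - Ex d f.
Proof. by rewrite -mulN1r -ExZ; apply: eq_Ex => z _; rewrite mulN1r. Qed.

Lemma ExB f g : Ex d (fun x => f x - g x) = Ex d f - Ex d g.
Proof. by rewrite ExD ExN. Qed.

Lemma Ex_sum (I : Type) (r : seq I) (F : I -> T -> R) :
  Ex d (fun x => \sum_(i <- r) F i x) = \sum_(i <- r) Ex d (F i).
Proof.
by rewrite /Ex exchange_big; apply: eq_bigr => z _; rewrite big_distrr.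
Qed.

Lemma Ex_ge0 f : (forall x, supp d x -> 0 <= f x) -> 0 <= Ex d f.
Proof. by move=> f0; rewrite -(Ex_cst 0); apply: le_Ex. Qed.

Lemma Ex_gt0 f x : (forall x, supp d x -> 0 <= f x) -> supp d x -> 0 < f x ->
  0 < Ex d f.
Proof.
move=> f0 /mapP[z zd ->] fz; rewrite /Ex (big_rem z) //=.
apply: ltr_pwDl; first by rewrite mulr_gt0 // fdl_pos.
rewrite big_seq; apply: sumr_ge0 => y /mem_rem yd.
by rewrite mulr_ge0 ?f0 ?fdl_supp // ltW // fdl_pos.
Qed.

Lemma Ex_le_cst f c : (forall x, supp d x -> f x <= c) -> Ex d f <= c.
Proof. by move=> fc; rewrite -(Ex_cst c); apply: le_Ex. Qed.

Lemma Ex_ge_cst f c : (forall x, supp d x -> c <= f x) -> c <= Ex d f.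
Proof. by move=> fc; rewrite -(Ex_cst c); apply: le_Ex. Qed.

Lemma Ex_exists f c : c <= Ex d f -> exists2 x, supp d x & c <= f x.
Proof.
move=> cE; apply: contrapT => h.
have lt x : supp d x -> f x < c.
  by move=> xd; rewrite ltNge; apply/negP => cf; apply: h; exists x.
have [z zd] : exists z, z \in fdl d.
  case E: (fdl d) => [|z s]; last by exists z; rewrite mem_head.
  by have := fdl_sum d; rewrite E big_nil => /eqP; rewrite eq_sym oner_eq0.
have : 0 < Ex d (fun x => c - f x).
  apply: (@Ex_gt0 _ z.2); last by rewrite subr_gt0 lt // fdl_supp.
    by move=> x xd; rewrite subr_ge0 ltW // lt.
  exact: fdl_supp.
by rewrite ExB Ex_cst subr_gt0 ltNge cE.
Qed.

Lemma supp_exists : exists x, supp d x.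
Proof.
have [|x xd _] := @Ex_exists (fun=> 0) 0; last by exists x.
by rewrite Ex_cst.
Qed.

End Expectation.

Lemma Ex_swap (T U : eqType) (d : fdist T) (e : fdist U) (F : T -> U -> R) :
  Ex d (fun x => Ex e (F x)) = Ex e (fun y => Ex d (F^~ y)).
Proof.
rewrite /Ex; under eq_bigr do rewrite big_distrr.
rewrite exchange_big /=; apply: eq_bigr => z _; rewrite big_distrr /=.
by apply: eq_bigr => y _; rewrite mulrCA.
Qed.

Section Monad.

Lemma fret_gt0 (T : eqType) (x : T) : all (fun z => 0 < z.1) [:: (1 : R, x)].
Proof. by rewrite /= ltr01. Qed.

Lemma fret_sum (T : eqType) (x : T) : \sum_(z <- [:: (1 : R, x)]) z.1 = 1.
Proof. by rewrite big_seq1. Qed.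

Definition fret (T : eqType) (x : T) : fdist T := Fdist (fret_gt0 x) (fret_sum x).

Definition bindl (T U : eqType) (d : fdist T) (f : T -> fdist U) : seq (R * U) :=
  flatten [seq [seq (z.1 * y.1, y.2) | y <- fdl (f z.2)] | z <- fdl d].

Lemma bindl_gt0 (T U : eqType) (d : fdist T) (f : T -> fdist U) :
  all (fun z => 0 < z.1) (bindl d f).
Proof.
apply/allP => y /flatten_mapP[z zd /mapP[x xf ->]] /=.
by rewrite mulr_gt0 ?(fdl_pos zd) ?(fdl_pos xf).
Qed.

Lemma bindl_sum (T U : eqType) (d : fdist T) (f : T -> fdist U) :
  \sum_(z <- bindl d f) z.1 = 1.
Proof.
rewrite /bindl big_flatten big_map -[RHS](fdl_sum d).
by apply: eq_bigr => z _; rewrite big_map /= -big_distrr /= fdl_sum mulr1.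
Qed.

Definition fbind (T U : eqType) (d : fdist T) (f : T -> fdist U) : fdist U :=
  Fdist (bindl_gt0 d f) (bindl_sum d f).

Definition fmap (T U : eqType) (g : T -> U) (d : fdist T) : fdist U :=
  fbind d (fun x => fret (g x)).

Definition fpair (T U : eqType) (d : fdist T) (f : T -> fdist U) :
    fdist (T * U)%type :=
  fbind d (fun x => fmap (pair x) (f x)).

Lemma Ex_ret (T : eqType) (x : T) f : Ex (fret x) f = f x.
Proof. by rewrite /Ex big_seq1 mul1r. Qed.

Lemma Ex_bind (T U : eqType) (d : fdist T) (f : T -> fdist U) g :
  Ex (fbind d f) g = Ex d (fun x => Ex (f x) g).
Proof.
rewrite /Ex /= /bindl big_flatten big_map; apply: eq_bigr => z _.
by rewrite big_map big_distrr /=; apply: eq_bigr => y _; rewrite mulrA.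
Qed.

Lemma Ex_map (T U : eqType) (g : T -> U) (d : fdist T) f :
  Ex (fmap g d) f = Ex d (f \o g).
Proof. by rewrite Ex_bind; apply: eq_Ex => x _; rewrite Ex_ret. Qed.

Lemma Ex_pair (T U : eqType) (d : fdist T) (f : T -> fdist U) g :
  Ex (fpair d f) g = Ex d (fun x => Ex (f x) (fun y => g (x, y))).
Proof. by rewrite Ex_bind; apply: eq_Ex => x _; rewrite Ex_map. Qed.

Lemma supp_ret (T : eqType) (x y : T) : supp (fret x) y = (y == x).
Proof. by rewrite /supp /= inE. Qed.

Lemma supp_bind (T U : eqType) (d : fdist T) (f : T -> fdist U) y :
  supp (fbind d f) y <-> exists2 x, supp d x & supp (f x) y.
Proof.
split.
  move=> /mapP[z /flatten_mapP[x xd /mapP[u uf ->]] -> /=].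
  by exists x.2; rewrite ?fdl_supp // /supp map_f.
move=> [_ /mapP[x xd ->] /mapP[u uf ->]].
apply/mapP; exists (x.1 * u.1, u.2) => //.
by apply/flatten_mapP; exists x => //; apply/mapP; exists u.
Qed.

Lemma supp_map (T U : eqType) (g : T -> U) (d : fdist T) y :
  supp (fmap g d) y <-> exists2 x, supp d x & y = g x.
Proof.
rewrite supp_bind; split=> [] [x xd]; first by rewrite supp_ret => /eqP; exists x.
by move=> ->; exists x => //; rewrite supp_ret.
Qed.

Lemma supp_pair (T U : eqType) (d : fdist T) (f : T -> fdist U) z :
  supp (fpair d f) z <-> supp d z.1 /\ supp (f z.1) z.2.
Proof.
rewrite supp_bind; split.
  by move=> [x xd /supp_map[y yf ->]].
by case: z => a b /= [h1 h2]; exists a => //; apply/supp_map; exists b.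
Qed.

End Monad.

Section Entropy.

Definition pm (T U : eqType) (d : fdist T) (X : T -> U) (u : U) : R :=
  Ex d (fun w => (X w == u)%:R).

(** Entropies are in nats; the base of the logarithm cancels in H(p) / chi. *)
Definition Hent (T U : eqType) (d : fdist T) (X : T -> U) : R :=
  Ex d (fun w => - ln (pm d X (X w))).

Section Basic.
Variables (T : eqType) (d : fdist T).

Lemma pm_ge0 (U : eqType) (X : T -> U) u : 0 <= pm d X u.
Proof. by apply: Ex_ge0 => x _; rewrite ler0n. Qed.

Lemma pm_le1 (U : eqType) (X : T -> U) u : pm d X u <= 1.
Proof. by apply: Ex_le_cst => x _; rewrite lern1 leq_b1. Qed.

Lemma pm_gt0 (U : eqType) (X : T -> U) w : supp d w -> 0 < pm d X (X w).
Proof.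
by move=> wd; apply: (@Ex_gt0 _ _ _ w) => //; rewrite eqxx ltr01.
Qed.

Lemma eq_pm (U : eqType) (X Y : T -> U) u :
  (forall x, supp d x -> X x = Y x) -> pm d X u = pm d Y u.
Proof. by move=> XY; apply: eq_Ex => x xd; rewrite XY. Qed.

Lemma eq_H (U : eqType) (X Y : T -> U) :
  (forall x, supp d x -> X x = Y x) -> Hent d X = Hent d Y.
Proof. by move=> XY; apply: eq_Ex => x xd; rewrite (eq_pm _ XY) XY. Qed.

Lemma H_ge0 (U : eqType) (X : T -> U) : 0 <= Hent d X.
Proof. by apply: Ex_ge0 => x xd; rewrite oppr_ge0 ln_le0 // pm_le1. Qed.

Lemma ln_le_sub1 (x : R) : 0 < x -> ln x <= x - 1.
Proof.
move=> x0; have h : 1 + (x - 1) = x by ring.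
by have := @le_ln1Dx R (x - 1); rewrite h; apply; lra.
Qed.

Lemma Jensen_ln (f : T -> R) : (forall x, supp d x -> 0 < f x) ->
  Ex d (fun x => ln (f x)) <= ln (Ex d f).
Proof.
move=> f0; have [x0 x0d] := supp_exists d.
have m0 : 0 < Ex d f by apply: (Ex_gt0 _ x0d (f0 _ x0d)) => x xd; rewrite ltW ?f0.
suff h : Ex d (fun x => ln (f x) - ln (Ex d f)) <= 0.
  by move: h; rewrite ExB Ex_cst subr_le0.
apply: (@le_trans _ _ (Ex d (fun x => f x * (Ex d f)^-1 - 1))).
  apply: le_Ex => x xd; rewrite -ln_div ?posrE ?f0 //.
  by apply: ln_le_sub1; rewrite divr_gt0 ?f0.
by rewrite ExB Ex_cst ExZr divff ?subrr // gt_eqF.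
Qed.

(** Jensen's inequality for ln (g / pm). The second hypothesis makes [g] a sub-probability: if [g]
    factors through [X], the expectation is the sum of [g] over the values of [X]. *)
Lemma Gibbs (U : eqType) (X : T -> U) (g : T -> R) :
  (forall x, supp d x -> 0 < g x) -> Ex d (fun w => g w / pm d X (X w)) <= 1 ->
  Hent d X <= Ex d (fun w => - ln (g w)).
Proof.
move=> g0 g1.
have : Ex d (fun w => ln (g w / pm d X (X w))) <= 0.
  apply: (le_trans (Jensen_ln _)); last by rewrite ln_le0.
  by move=> x xd; rewrite divr_gt0 ?g0 ?pm_gt0.
rewrite (@eq_Ex _ _ _ (fun w => ln (g w) - ln (pm d X (X w)))); last first.
  by move=> x xd; rewrite ln_div ?posrE ?g0 ?pm_gt0.
by rewrite ExB /Hent !ExN; lra.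
Qed.

Lemma Ex_pmV (U : eqType) (X : T -> U) u :
  Ex d (fun w => (X w == u)%:R / pm d X (X w)) <= 1.
Proof.
rewrite (@eq_Ex _ _ _ (fun w => (X w == u)%:R * (pm d X u)^-1)); last first.
  by move=> w _; case: eqP => [->|]; rewrite ?mul0r.
rewrite ExZr -/(pm d X u); have := pm_ge0 X u; rewrite le_eqVlt => /predU1P[<-|h].
  by rewrite mul0r ler01.
by rewrite divff // gt_eqF.
Qed.

(** Gibbs' inequality against A B / C, the law under which [X] and [Y] are independent given [Z]. *)
Lemma submodular (U V W : eqType) (X : T -> U) (Y : T -> V) (Z : T -> W) :
  Hent d (fun w => (X w, Y w, Z w)) + Hent d Z <=
  Hent d (fun w => (X w, Z w)) + Hent d (fun w => (Y w, Z w)).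
Proof.
pose A w := pm d (fun w => (X w, Z w)) (X w, Z w).
pose B w := pm d (fun w => (Y w, Z w)) (Y w, Z w).
pose C w := pm d Z (Z w).
have A0 w : supp d w -> 0 < A w by exact: (@pm_gt0 _ (fun w => (X w, Z w))).
have B0 w : supp d w -> 0 < B w by exact: (@pm_gt0 _ (fun w => (Y w, Z w))).
have C0 w : supp d w -> 0 < C w by exact: pm_gt0.
have := @Gibbs _ (fun w => (X w, Y w, Z w)) (fun w => A w * B w / C w).
have -> : Ex d (fun w => - ln (A w * B w / C w)) =
    Hent d (fun w => (X w, Z w)) + Hent d (fun w => (Y w, Z w)) - Hent d Z.
  rewrite /Hent -ExD -ExB; apply: eq_Ex => w wd.
  by rewrite ln_div ?posrE ?mulr_gt0 ?A0 ?B0 ?C0 // lnM ?posrE ?A0 ?B0 // /A /B /C; lra.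
suff h : Ex d (fun w => A w * B w / C w /
    pm d (fun w0 => (X w0, Y w0, Z w0)) (X w, Y w, Z w)) <= 1.
  move=> /(_ _ h) h2; rewrite -lerBrDr; apply: h2 => w wd.
  by rewrite divr_gt0 ?mulr_gt0 ?A0 ?B0 ?C0.
(* A and B are probabilities of agreeing with independent copies a and b of w. Averaging over w
   first leaves the single triple (X a, Y b, Z a), and only if Z a = Z b. *)
pose P w := pm d (fun w0 => (X w0, Y w0, Z w0)) (X w, Y w, Z w).
have -> : Ex d (fun w => A w * B w / C w / P w) =
   Ex d (fun a => Ex d (fun b => Ex d (fun w =>
     ((X a, Z a) == (X w, Z w))%:R * ((Y b, Z b) == (Y w, Z w))%:R / C w / P w))).
  under [RHS]eq_Ex => a _ do rewrite Ex_swap.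
  rewrite [RHS]Ex_swap; apply: eq_Ex => w _.
  rewrite /A /B /pm -!mulrA -ExZr; apply: eq_Ex => a _.
  by rewrite -ExZr -ExZ; apply: eq_Ex => b _; rewrite !mulrA.
have C1 a : supp d a -> Ex d (fun b => (Z b == Z a)%:R / C a) = 1.
  by move=> ad; rewrite ExZr divff // gt_eqF // C0.
apply: (@le_trans _ _ (Ex d (fun a => Ex d (fun b => (Z b == Z a)%:R / C a)))).
  apply: le_Ex => a ad; apply: le_Ex => b bd.
  case: (eqVneq (Z b) (Z a)) => [E|NE]; last first.
    rewrite mul0r; apply: Ex_le_cst => w wd.
    case: eqP => [[_ Ea]|]; last by rewrite !mul0r.
    case: eqP => [[_ Eb]|]; last by rewrite mulr0 !mul0r.
    by move: NE; rewrite Ea Eb eqxx.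
  rewrite (@eq_Ex _ _ _ (fun w =>
      ((X w, Y w, Z w) == (X a, Y b, Z a))%:R / P w * (C a)^-1)).
    rewrite ExZr ler_wpM2r ?invr_ge0 ?(ltW (C0 _ ad)) //.
    exact: (@Ex_pmV _ (fun w => (X w, Y w, Z w))).
  move=> w _; rewrite !xpair_eqE.
  rewrite E !(eq_sym (X w)) !(eq_sym (Y w)) !(eq_sym (Z w)).
  case: (eqVneq (X a) (X w)) => //=; rewrite ?mul0r //.
  case: (eqVneq (Y b) (Y w)) => //=; rewrite ?mulr0 ?mul0r //.
  case: (eqVneq (Z a) (Z w)) => //= [E2 _ _|]; rewrite ?mulr0 ?mul0r //.
  by rewrite /C E2 !mul1r mulrC.
by rewrite (@eq_Ex _ _ _ (fun=> 1)) ?Ex_cst.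
Qed.

End Basic.

Lemma H_law (T1 T2 U : eqType) (d : fdist T1) (e : fdist T2) (X : T1 -> U)
    (Y : T2 -> U) :
  (forall F : U -> R, Ex d (fun w => F (X w)) = Ex e (fun w => F (Y w))) ->
  Hent d X = Hent e Y.
Proof.
move=> h; have hp u : pm d X u = pm e Y u by rewrite /pm (h (fun v => (v == u)%:R)).
rewrite /Hent (h (fun v => - ln (pm d X v))).
by apply: eq_Ex => w _; rewrite hp.
Qed.

Section Tools.
Variables (T : eqType) (d : fdist T).

Lemma le_pm (U V : eqType) (X : T -> U) (Y : T -> V) u v :
  (forall w, supp d w -> X w = u -> Y w = v) -> pm d X u <= pm d Y v.
Proof.
move=> h; apply: le_Ex => w wd; rewrite ler_nat.
by case: (eqVneq (X w) u) => // /(h _ wd) ->; rewrite eqxx.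
Qed.

Lemma H_fun_le (U V : eqType) (X : T -> U) (Y : T -> V) :
  (forall w w', supp d w -> supp d w' -> X w = X w' -> Y w = Y w') ->
  Hent d Y <= Hent d X.
Proof.
move=> h; apply: le_Ex => w wd.
rewrite lerN2 ler_ln ?posrE ?pm_gt0 //.
by apply: le_pm => w' w'd E; apply: h.
Qed.

Lemma H_fun_eq (U V : eqType) (X : T -> U) (Y : T -> V) :
  (forall w w', supp d w -> supp d w' -> X w = X w' -> Y w = Y w') ->
  (forall w w', supp d w -> supp d w' -> Y w = Y w' -> X w = X w') ->
  Hent d Y = Hent d X.
Proof. by move=> h1 h2; apply/eqP; rewrite eq_le !H_fun_le. Qed.

Lemma H_cst (U : eqType) (u : U) : Hent d (fun=> u) = 0.
Proof.
rewrite /Hent (@eq_Ex _ _ _ (fun=> 0)) ?Ex_cst // => w _.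
by rewrite /pm eqxx Ex_cst ln1 oppr0.
Qed.

(** [k] is a code for [X] given [Y], normalised over the finite list [S (Y w)] of possible values.
    Gibbs' inequality with the product of [pm d Y] and [k] bounds the conditional entropy by the
    mean code length. *)
Lemma H_pair_kernel (U V : eqType) (X : T -> U) (Y : T -> V) (S : V -> seq U)
    (k : U -> V -> R) :
  (forall w, supp d w -> X w \in S (Y w)) -> (forall u v, 0 < k u v) ->
  (forall w, supp d w -> \sum_(u <- S (Y w)) k u (Y w) <= 1) ->
  Hent d (fun w => (X w, Y w)) <= Hent d Y + Ex d (fun w => - ln (k (X w) (Y w))).
Proof.
move=> hS k0 hk.
pose P w := pm d (fun w => (X w, Y w)) (X w, Y w).
have P0 w : supp d w -> 0 < P w by exact: (@pm_gt0 _ d _ (fun w => (X w, Y w))).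
have Q0 w : supp d w -> 0 < pm d Y (Y w) by exact: pm_gt0.
have -> : Hent d Y + Ex d (fun w => - ln (k (X w) (Y w))) =
    Ex d (fun w => - ln (pm d Y (Y w) * k (X w) (Y w))).
  rewrite /Hent -ExD; apply: eq_Ex => w wd.
  by rewrite lnM ?posrE ?Q0 // opprD.
apply: Gibbs => [w wd|]; first by rewrite mulr_gt0 ?Q0.
have -> : Ex d (fun w => pm d Y (Y w) * k (X w) (Y w) / P w) =
    Ex d (fun a => Ex d (fun w => (Y a == Y w)%:R * k (X w) (Y w) / P w)).
  rewrite Ex_swap; apply: eq_Ex => w _; rewrite -mulrA /pm -ExZr.
  by apply: eq_Ex => a _; rewrite mulrA.
apply: Ex_le_cst => a ad; apply: le_trans (hk a ad).
apply: (@le_trans _ _ (\sum_(x <- S (Y a)) k x (Y a) *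
    Ex d (fun w => ((X w, Y w) == (x, Y a))%:R / P w))); last first.
  apply: ler_sum => x _; rewrite ler_piMr ?(ltW (k0 _ _)) //.
  exact: (@Ex_pmV _ d _ (fun w => (X w, Y w))).
under [leRHS]eq_bigr do rewrite -ExZ.
rewrite -Ex_sum; apply: le_Ex => w wd.
have s0 x : 0 <= k x (Y a) * (((X w, Y w) == (x, Y a))%:R / P w).
  by rewrite mulr_ge0 ?(ltW (k0 _ _)) // divr_ge0 // ltW ?P0.
case: (eqVneq (Y a) (Y w)) => [E|_]; last by rewrite !mul0r sumr_ge0.
rewrite (big_rem (X w)) /=; last by rewrite E hS.
rewrite !E in s0 *; rewrite eqxx !mul1r lerDl.
by apply: sumr_ge0 => x _; exact: s0.
Qed.

Lemma H_pair_bounded (U V : eqType) (X : T -> U) (Y : T -> V) (S : V -> seq U)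
    (K : nat) :
  (forall w, supp d w -> X w \in S (Y w)) ->
  (forall w, supp d w -> (size (S (Y w)) <= K)%N) ->
  Hent d (fun w => (X w, Y w)) <= Hent d Y + ln K%:R.
Proof.
move=> hS hK.
have K0 : 0 < K%:R :> R.
  have [w wd] := supp_exists d; rewrite ltr0n; apply: leq_trans (hK _ wd).
  by case: (S _) (hS _ wd).
have := @H_pair_kernel _ _ X Y S (fun _ _ => K%:R^-1) hS.
rewrite Ex_cst lnV ?posrE // opprK; apply=> [u v|w wd]; first by rewrite invr_gt0.
rewrite big_const_seq count_predT iter_addr_0 -(mulr_natl _ (size _)) ler_pdivrMr // mul1r.
by rewrite ler_nat hK.
Qed.

Lemma H_le_bounded (U V : eqType) (X : T -> U) (Y : T -> V) (S : V -> seq U)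
    (K : nat) :
  (forall w, supp d w -> X w \in S (Y w)) ->
  (forall w, supp d w -> (size (S (Y w)) <= K)%N) ->
  Hent d X <= Hent d Y + ln K%:R.
Proof.
move=> hS hK; apply: le_trans (H_pair_bounded hS hK).
by apply: H_fun_le => w w' _ _ [].
Qed.

Lemma H_le_ln (U : eqType) (X : T -> U) (S : seq U) (K : nat) :
  (forall w, supp d w -> X w \in S) -> (size S <= K)%N -> Hent d X <= ln K%:R.
Proof.
move=> hS hK; rewrite -[leRHS]add0r -(H_cst tt).
by apply: (@H_le_bounded _ _ X (fun=> tt) (fun=> S)).
Qed.

Lemma H_pair_ge1 (U V : eqType) (X : T -> U) (Y : T -> V) :
  Hent d X <= Hent d (fun w => (X w, Y w)).
Proof. by apply: H_fun_le => w w' _ _ []. Qed.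

Lemma H_pairC (U V : eqType) (X : T -> U) (Y : T -> V) :
  Hent d (fun w => (X w, Y w)) = Hent d (fun w => (Y w, X w)).
Proof. by apply: H_fun_eq => w w' _ _ [-> ->]. Qed.

Lemma H_pair_le (U V : eqType) (X : T -> U) (Y : T -> V) :
  Hent d (fun w => (X w, Y w)) <= Hent d X + Hent d Y.
Proof.
have := @submodular _ d _ _ _ X Y (fun=> tt); rewrite H_cst addr0 => h.
apply: (le_trans (le_trans _ h)); first by apply: H_fun_le => w w' _ _ [-> ->].
by apply: lerD; apply: H_fun_le => w w' _ _ ->.
Qed.

Lemma H_cond_le (U V W : eqType) (X : T -> U) (Y : T -> V) (Z : T -> W) :
  (forall w w', supp d w -> supp d w' -> Y w = Y w' -> Z w = Z w') ->
  Hent d (fun w => (X w, Y w)) - Hent d Y <= Hent d (fun w => (X w, Z w)) - Hent d Z.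
Proof.
move=> h; have := @submodular _ d _ _ _ X Y Z.
have -> : Hent d (fun w => (X w, Y w, Z w)) = Hent d (fun w => (X w, Y w)).
  by apply: H_fun_eq => w w' wd w'd [-> ] // E; rewrite E (h w w' wd w'd E).
have -> : Hent d (fun w => (Y w, Z w)) = Hent d Y.
  by apply: H_fun_eq => [w w' wd w'd E|w w' wd w'd []//]; rewrite E (h w w').
lra.
Qed.

End Tools.

(** Chain rule for a two-step experiment. The hypothesis says that the conditional law of [X]
    depends on the first step only through [g]. *)
Lemma H_pair_chain (T U A B : eqType) (d : fdist T) (f : T -> fdist U)
    (g : T -> A) (X : T * U -> B) :
  (forall a a' F, supp d a -> supp d a' -> g a = g a' ->
    Ex (f a) (fun b => F (X (a, b))) = Ex (f a') (fun b => F (X (a', b)))) ->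
  Hent (fpair d f) (fun z => (g z.1, X z)) =
  Hent d g + Ex d (fun a => Hent (f a) (fun b => X (a, b))).
Proof.
move=> h; rewrite /Hent -ExD Ex_pair; apply: eq_Ex => a ad.
rewrite -[X in X + _](Ex_cst (f a)) -ExD; apply: eq_Ex => b bf /=.
have p0 : 0 < pm (f a) (fun b0 => X (a, b0)) (X (a, b)).
  exact: (@pm_gt0 _ (f a) _ (fun b0 => X (a, b0)) b).
rewrite -opprD -lnM ?posrE ?p0 ?pm_gt0 //; congr (- ln _); rewrite /pm Ex_pair -ExZr; apply: eq_Ex => a' a'd /=.
case: (eqVneq (g a') (g a)) => [E|NE]; last first.
  rewrite mul0r (@eq_Ex _ _ _ (fun=> 0)) ?Ex_cst // => b' _.
  by rewrite xpair_eqE (negbTE NE).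
rewrite mul1r -(h a' a (fun x => (x == X (a, b))%:R)) //.
by apply: eq_Ex => b' _; rewrite xpair_eqE E eqxx.
Qed.

Definition fprod (T U : eqType) (d : fdist T) (e : fdist U) : fdist (T * U)%type :=
  fpair d (fun=> e).

Lemma Ex_prod (T U : eqType) (d : fdist T) (e : fdist U) g :
  Ex (fprod d e) g = Ex d (fun x => Ex e (fun y => g (x, y))).
Proof. exact: Ex_pair. Qed.

Lemma supp_prod (T U : eqType) (d : fdist T) (e : fdist U) z :
  supp (fprod d e) z <-> supp d z.1 /\ supp e z.2.
Proof. exact: supp_pair. Qed.

Lemma H_prod (T U A B : eqType) (d : fdist T) (e : fdist U) (X : T -> A) (Y : U -> B) :
  Hent (fprod d e) (fun z => (X z.1, Y z.2)) = Hent d X + Hent e Y.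
Proof.
by rewrite (@H_pair_chain _ _ _ _ d (fun=> e) X (fun z => Y z.2)) //= Ex_cst.
Qed.

(** Submodularity for Y and (Y + W, Z) given Y + Z + W: each joint variable that occurs is a
    bijective image of independent ones, so its entropy splits into a sum. *)
Lemma Kaimanovich_Vershik (T1 T2 T3 : eqType) (V : zmodType) (d1 : fdist T1)
    (d2 : fdist T2) (d3 : fdist T3) (Y : T1 -> V) (Z : T2 -> V) (W : T3 -> V) :
  Hent (fprod (fprod d1 d2) d3) (fun z => Y z.1.1 + Z z.1.2 + W z.2) + Hent d3 W <=
  Hent (fprod d1 d3) (fun z => Y z.1 + W z.2) +
  Hent (fprod d2 d3) (fun z => Z z.1 + W z.2).
Proof.
set D := fprod _ _.
have := @submodular _ D _ _ _ (fun z => Y z.1.1)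
   (fun z => (Y z.1.1 + W z.2, Z z.1.2)) (fun z => Y z.1.1 + Z z.1.2 + W z.2).
have -> : Hent D (fun w => (Y w.1.1, (Y w.1.1 + W w.2, Z w.1.2),
    Y w.1.1 + Z w.1.2 + W w.2)) = Hent d1 Y + Hent d2 Z + Hent d3 W.
  rewrite -H_prod -H_prod; apply: H_fun_eq => w w' _ _.
    by case=> -> -> ->.
  by case=> -> /addrI -> ->.
have -> : Hent D (fun w => (Y w.1.1, Y w.1.1 + Z w.1.2 + W w.2)) =
    Hent d1 Y + Hent (fprod d2 d3) (fun z => Z z.1 + W z.2).
  rewrite -H_prod; transitivity (Hent D (fun w => (Y w.1.1, Z w.1.2 + W w.2))).
    apply: H_fun_eq => w w' _ _; rewrite -?addrA; first by case=> -> ->.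
    by case=> -> /addrI ->.
  by apply: H_law => F; rewrite !Ex_prod; apply: eq_Ex => x _; rewrite Ex_prod.
have -> : Hent D (fun w => (Y w.1.1 + W w.2, Z w.1.2, Y w.1.1 + Z w.1.2 + W w.2)) =
    Hent (fprod d1 d3) (fun z => Y z.1 + W z.2) + Hent d2 Z.
  rewrite -H_prod; transitivity (Hent D (fun w => (Y w.1.1 + W w.2, Z w.1.2))).
    apply: H_fun_eq => w w' _ _; last by case=> -> ->.
    by rewrite ![_ + Z _ + _]addrAC; case=> -> ->.
  apply: H_law => F; rewrite !Ex_prod; apply: eq_Ex => x _.
  by rewrite Ex_swap.
lra.
Qed.

Section Conditioning.
Variables (T V : eqType) (d : fdist T) (A : T -> V) (v : V).

(** On a null value the original list is kept, so that conditioning is total. *)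
Definition condl : seq (R * T) :=
  if 0 < pm d A v then [seq (z.1 / pm d A v, z.2) | z <- fdl d & A z.2 == v]
  else fdl d.

Lemma condl_gt0 : all (fun z => 0 < z.1) condl.
Proof.
rewrite /condl; case: ifPn => [h|_]; last exact: fdl_gt0.
apply/allP => z /mapP[y]; rewrite mem_filter => /andP[_ yd] -> /=.
by rewrite divr_gt0 // (fdl_pos yd).
Qed.

Lemma condl_sum : \sum_(z <- condl) z.1 = 1.
Proof.
rewrite /condl; case: ifPn => [h|_]; last exact: fdl_sum.
rewrite big_map /= -mulr_suml big_filter.
have -> : \sum_(z <- fdl d | A z.2 == v) z.1 = pm d A v.
  by rewrite big_mkcond; apply: eq_bigr => z _; case: eqP; rewrite ?mulr1 ?mulr0.
by rewrite divff // gt_eqF.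
Qed.

Definition fcond : fdist T := Fdist condl_gt0 condl_sum.

Hypothesis v0 : 0 < pm d A v.

Lemma Ex_cond f : Ex fcond f = Ex d (fun w => (A w == v)%:R * f w) / pm d A v.
Proof.
rewrite /Ex /= /condl v0 big_map big_filter mulr_suml big_mkcond.
apply: eq_bigr => z _; case: eqP => _; rewrite ?mul1r ?mul0r ?mulr0 ?mul0r //=.
by rewrite mulrAC.
Qed.

Lemma supp_cond w : supp fcond w <-> supp d w /\ A w = v.
Proof.
rewrite /supp /= /condl v0; split.
  by move=> /mapP[z /mapP[y]]; rewrite mem_filter => /andP[/eqP <- yd] -> -> /=; rewrite map_f.
move=> [/mapP[y yd ->] E]; apply/mapP; exists (y.1 / pm d A v, y.2) => //.
by apply/mapP; exists y => //; rewrite mem_filter E eqxx.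
Qed.

End Conditioning.

Lemma Ex_total (T V : eqType) (d : fdist T) (A : T -> V) F :
  Ex d F = Ex d (fun a => Ex (fcond d A (A a)) F).
Proof.
rewrite [RHS](@eq_Ex _ _ _ (fun a => Ex d (fun w => (A w == A a)%:R * F w / pm d A (A a)))); last first.
  by move=> a ad; rewrite Ex_cond ?pm_gt0 // -ExZr.
rewrite Ex_swap; apply: eq_Ex => w wd.
rewrite (@eq_Ex _ _ _ (fun a => (A a == A w)%:R * (F w / pm d A (A w)))).
  by rewrite ExZr -/(pm d A (A w)) mulrCA divff ?mulr1 // gt_eqF // pm_gt0.
by move=> a _; rewrite eq_sym; case: eqP => [->|]; rewrite ?mul0r ?mul1r.
Qed.

Lemma H_cond_chain (T U V : eqType) (d : fdist T) (A : T -> V) (X : T -> U) :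
  Hent d (fun w => (A w, X w)) =
  Hent d A + Ex d (fun a => Hent (fcond d A (A a)) X).
Proof.
have -> : Ex d (fun a => Hent (fcond d A (A a)) X) =
   Ex d (fun w => - ln (pm (fcond d A (A w)) X (X w))).
  rewrite [RHS](Ex_total d A); apply: eq_Ex => a ad; apply: eq_Ex => w.
  by rewrite supp_cond ?pm_gt0 // => -[_ ->].
rewrite /Hent -ExD; apply: eq_Ex => w wd.
have pc : 0 < pm (fcond d A (A w)) X (X w).
  by apply: pm_gt0; rewrite supp_cond ?pm_gt0.
rewrite -opprD -lnM ?posrE ?pc ?pm_gt0 //; congr (- ln _).
rewrite /pm Ex_cond ?pm_gt0 // -/(pm d A (A w)) mulrC divfK ?gt_eqF ?pm_gt0 //.
by apply: eq_Ex => x _; rewrite xpair_eqE; case: eqP; case: eqP; rewrite ?mulr1 ?mulr0 ?mul0r.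
Qed.

End Entropy.
End FiniteDist.

(** * Words stopped at a scale *)

Section Quantization.
Variable R : realType.

Definition Q (s x : R) : int := Num.floor (s * x).

Lemma Q_near (s x : R) : `|(Q s x)%:~R - s * x| <= 1.
Proof.
have /andP[h1 h2] := floor_itv (s * x); rewrite /Q.
by rewrite ler_norml; move: h2; rewrite intrD /=; lra.
Qed.

Lemma Q_bound (s x : R) : s * x - 1 <= (Q s x)%:~R <= s * x.
Proof.
have /andP[h1 h2] := floor_itv (s * x); rewrite /Q.
by move: h2; rewrite intrD /=; lra.
Qed.

(** Bounds the logarithm of the number of integers within [K] of a real. *)
Definition lnb (K : R) : R := ln (2 * K + 4).

Lemma lnb_ge0 (K : R) : 0 <= K -> 0 <= lnb K.
Proof. by move=> K0; apply: ln_ge0; lra. Qed.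

Definition near_ints (x K : R) : seq int :=
  [seq Num.floor x - (Num.truncn K).+1%:Z + i%:Z | i <- iota 0 (2 * (Num.truncn K).+1 + 2)].

Lemma mem_near_ints (z : int) (x K : R) : 0 <= K -> `|z%:~R - x| <= K ->
  z \in near_ints x K.
Proof.
move=> K0 h; rewrite /near_ints; set n := (Num.truncn K).+1.
have nK : K < n%:R by rewrite /n truncnS_gt.
have /andP[f1 f2] := floor_itv x; move: h; rewrite ler_norml => /andP[h1 h2].
have l1 : 0 <= z - Num.floor x + n%:Z.
  by rewrite -(ler0z R) !intrD rmorphN /= -pmulrn; lra.
apply/mapP; exists (absz (z - Num.floor x + n%:Z)); last first.
  by rewrite gez0_abs //; ring.
rewrite mem_iota /= add0n.
suff : z - Num.floor x + n%:Z < (2 * n + 2)%N%:Z by lia.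
rewrite -(ltr_int R) !intrD rmorphN /= -!pmulrn natrD natrM.
by move: f2; rewrite intrD /=; lra.
Qed.

Lemma size_near_ints (x K : R) :
  size (near_ints x K) = (2 * (Num.truncn K).+1 + 2)%N.
Proof. by rewrite size_map size_iota. Qed.

(** The tool that turns discretisation errors into additive constants: once [Y] is known, only the
    integers within [K] of [g (Y w)] remain for [X]. *)
Lemma H_near (T V : eqType) (d : fdist R T) (X : T -> int) (Y : T -> V)
    (g : V -> R) (K : R) : 0 <= K ->
  (forall w, supp d w -> `|(X w)%:~R - g (Y w)| <= K) ->
  Hent d (fun w => (X w, Y w)) <= Hent d Y + lnb K.
Proof.
move=> K0 h.
have := @H_pair_bounded _ _ _ _ _ X Y (fun y => near_ints (g y) K)
  (2 * (Num.truncn K).+1 + 2) (fun w wd => mem_near_ints K0 (h w wd))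
  (fun w _ => eq_leq (size_near_ints _ _)).
move=> h2; apply: (le_trans h2); have /andP[k1 _] := truncn_itv K0.
rewrite lerD2l ler_ln ?posrE ?ltr0n ?addn2 //; last by lra.
by rewrite -addn2 natrD natrM -natr1; lra.
Qed.

Lemma H_near_le (T V : eqType) (d : fdist R T) (X : T -> int) (Y : T -> V)
    (g : V -> R) (K : R) : 0 <= K ->
  (forall w, supp d w -> `|(X w)%:~R - g (Y w)| <= K) ->
  Hent d X <= Hent d Y + lnb K.
Proof.
move=> K0 h; apply: le_trans (H_near K0 h).
by apply: H_fun_le => w w' _ _ [].
Qed.

End Quantization.

(** * Fekete's lemma for almost superadditive sequences *)

Section Fekete.
Variable R : realType.
Variables (u : nat -> R) (C : R).
Hypothesis C0 : 0 <= C.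
Hypothesis u0 : forall n, 0 <= u n.
Hypothesis u_le : forall n, u n <= n%:R + C.
Hypothesis u_super : forall n k, u n + u k - C <= u (n + k)%N.

Lemma Fekete : exists al : R, [/\ 0 <= al <= 1, (forall n, u n <= al * n%:R + C) &
  forall e, 0 < e -> exists n0, forall n, (n0 <= n)%N -> (al - e) * n%:R <= u n].
Proof.
(* The element 0 makes the set nonempty and the limit nonnegative. *)
pose E := [set x | x = 0 \/ exists n, x = (u n.+1 - C) / n.+1%:R]%classic.
have hub : has_ubound E.
  exists 1 => x [->|[n ->]]; first exact: ler01.
  by rewrite ler_pdivrMr ?ltr0n // mul1r; have := u_le n.+1; lra.
have hs : has_sup E by split=> //; exists 0; left.
have ge n : (u n.+1 - C) / n.+1%:R <= sup E.
  by apply: ub_le_sup => //; right; exists n.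
have ge0 : 0 <= sup E by apply: ub_le_sup => //; left.
exists (sup E); split.
- rewrite ge0 /=; apply: ge_sup; first by exists 0; left.
  move=> x [->|[n ->]]; first exact: ler01.
  by rewrite ler_pdivrMr ?ltr0n // mul1r; have := u_le n.+1; lra.
- case=> [|n]; first by have := u_le 0; rewrite mulr0.
  by have := ge n; rewrite ler_pdivrMr ?ltr0n //; lra.
move=> e e0.
have [||x Ex hx] := @sup_adherent _ E (e / 2); [lra|done|].
case: Ex hx => [->|[k ->]] hx.
  exists 0 => n _; apply: le_trans (u0 n).
  by rewrite mulr_le0_ge0 //; lra.
set a := u k.+1 - C in hx.
(* Superadditivity over q blocks of length k + 1. The remainder of n modulo k + 1 then costs only
   [C], as [u] is nonnegative. *)
have step q : q%:R * a <= u (q * k.+1)%N.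
  elim: q => [|q IH]; first by rewrite mul0r mul0n u0.
  rewrite mulSn; have := u_super k.+1 (q * k.+1).
  by rewrite -natr1 mulrDl mul1r /a in IH *; lra.
have gen q r : q%:R * a <= u (q * k.+1 + r)%N + C.
  by have := u_super (q * k.+1) r; have := step q; have := u0 r; lra.
pose B := (`|a| + C) / (e / 2).
exists (Num.truncn B).+1 => n hn.
have Bn : B <= n%:R.
  apply: (@le_trans _ _ (Num.truncn B).+1%:R); first by rewrite ltW // truncnS_gt.
  by rewrite ler_nat.
have hB : `|a| + C <= n%:R * (e / 2) by rewrite -ler_pdivrMr //; lra.
have := gen (n %/ k.+1)%N (n %% k.+1)%N; rewrite -divn_eq => h.
have kp : (0 : R) < k.+1%:R by rewrite ltr0n.
have q1 : (n %/ k.+1)%:R * k.+1%:R <= n%:R :> R.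
  by rewrite -natrM ler_nat leq_divM.
have q2 : n%:R <= ((n %/ k.+1)%:R + 1) * k.+1%:R :> R.
  by rewrite natr1 -natrM ler_nat ltnW // ltn_ceil.
have hk : n%:R / k.+1%:R * a - `|a| <= (n %/ k.+1)%:R * a.
  have : `|(n%:R / k.+1%:R - (n %/ k.+1)%:R) * a| <= 1 * `|a|.
    rewrite normrM ler_wpM2r // ler_norml.
    have : n%:R / k.+1%:R <= (n %/ k.+1)%:R + 1 :> R by rewrite ler_pdivrMr.
    have : (n %/ k.+1)%:R <= n%:R / k.+1%:R :> R by rewrite ler_pdivlMr.
    by move: (n%:R / _) => z h1 h2; apply/andP; split; lra.
  rewrite ler_norml mulrBl mul1r.
  by move: (_ / _ * a) (_ * a) => y z /andP[]; lra.
have h3 : (sup E - e / 2) * n%:R <= n%:R / k.+1%:R * a.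
  rewrite [leLHS]mulrC -mulrA; apply: ler_wpM2l; first by rewrite ler0n.
  by rewrite [leRHS]mulrC ltW.
have n0 : (0:R) <= n%:R by rewrite ler0n.
move: h hk h3 hB; move: (_ / _ * a) (_ * a) => y z; lra.
Qed.
End Fekete.

(** * Weighted iterated function systems and their stopped words *)

Record wifs (R : realType) := Wifs {
  wm : nat;
  wlam : 'I_wm.+1 -> R;
  wt : 'I_wm.+1 -> R;
  wp : 'I_wm.+1 -> R;
  wlam_neq0 : forall j, wlam j != 0;
  wlam_contr : forall j, -1 < wlam j < 1;
  wp_gt0 : forall j, 0 < wp j;
  wp_sum : \sum_(j < wm.+1) wp j = 1 }.

Section Words.
Variables (R : realType) (S : wifs R).
Local Notation m := (wm S).
Local Notation lam := (@wlam R S).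
Local Notation t := (@wt R S).
Local Notation p := (@wp R S).
Let lam_neq0 := @wlam_neq0 R S.
Let lam_contr := @wlam_contr R S.
Let p_gt0 := @wp_gt0 R S.
Let p_sum := @wp_sum R S.

Local Notation A := ('I_m.+1).

Definition lamw (w : seq A) : R := \prod_(j <- w) lam j.
Definition trw (w : seq A) : R := ifs_word lam t w 0.

Lemma lamw_nil : lamw [::] = 1. Proof. by rewrite /lamw big_nil. Qed.
Lemma lamw_cons j w : lamw (j :: w) = lam j * lamw w.
Proof. by rewrite /lamw big_cons. Qed.
Lemma lamw_cat u v : lamw (u ++ v) = lamw u * lamw v.
Proof. by rewrite /lamw big_cat. Qed.

Lemma ifs_wordE w x : ifs_word lam t w x = lamw w * x + trw w.
Proof.
elim: w x => [|j w IH] x; first by rewrite lamw_nil /trw /= mul1r addr0.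
rewrite lamw_cons /trw /= /ifs_map IH -/(ifs_word lam t w) (IH 0) mulr0 add0r.
by ring.
Qed.

Lemma ifs_word_cat u v x : ifs_word lam t (u ++ v) x = ifs_word lam t u (ifs_word lam t v x).
Proof. by elim: u => //= j u IH; rewrite IH. Qed.

Lemma trw_cat u v : trw (u ++ v) = trw u + lamw u * trw v.
Proof. by rewrite {1}/trw ifs_word_cat ifs_wordE addrC. Qed.

Lemma trw_nil : trw [::] = 0. Proof. by []. Qed.

Lemma letters_gt0 : all (fun z => 0 < z.1) [seq (p j, j) | j <- enum A].
Proof. by apply/allP => z /mapP[j _ ->] /=. Qed.
Lemma letters_sum : \sum_(z <- [seq (p j, j) | j <- enum A]) z.1 = 1.
Proof. by rewrite big_map /= big_enum. Qed.
Definition letters : fdist R A := Fdist letters_gt0 letters_sum.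

Lemma Ex_letters f : Ex letters f = \sum_j p j * f j.
Proof. by rewrite /Ex /= big_map big_enum. Qed.

Lemma supp_letters j : supp letters j.
Proof. by apply/mapP; exists (p j, j) => //; apply/mapP; exists j; rewrite ?mem_enum. Qed.

(** Any initial value in (0, 1) would do, here and in [cmin]. *)
Definition rmax : R := \big[Num.max/2^-1]_j `|lam j|.
Definition cmin : R := \big[Num.min/2^-1]_j `|lam j|.

Lemma lam_norm_lt1 j : `|lam j| < 1.
Proof. by have := lam_contr j; rewrite ltr_norml. Qed.

Lemma lam_norm_gt0 j : 0 < `|lam j|.
Proof. by rewrite normr_gt0. Qed.

Lemma rmax_ge j : `|lam j| <= rmax.
Proof. exact: (@le_bigmax _ _ _ 2^-1 (fun j => `|lam j|)). Qed.

Lemma rmax_lt1 : rmax < 1.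
Proof. by apply/bigmax_ltP; split=> [|j _]; [lra|exact: lam_norm_lt1]. Qed.

Lemma rmax_gt0 : 0 < rmax.
Proof. exact: lt_le_trans (lam_norm_gt0 ord0) (rmax_ge _). Qed.

Lemma cmin_le j : cmin <= `|lam j|.
Proof. exact: (@bigmin_le _ _ _ 2^-1 _ (fun j => `|lam j|)). Qed.

Lemma cmin_gt0 : 0 < cmin.
Proof. by apply/bigmin_gtP; split=> [|j _]; [lra|exact: lam_norm_gt0]. Qed.

Lemma cmin_lt1 : cmin < 1.
Proof. exact: le_lt_trans (cmin_le ord0) (lam_norm_lt1 _). Qed.

Definition tmax : R := \big[Num.max/1]_j `|t j|.
(** Radius of an interval around 0 that every map sends into itself, see [Ctr_fix]. *)
Definition Ctr : R := tmax / (1 - rmax).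

Lemma Ctr_ge1 : 1 <= Ctr.
Proof.
have := rmax_lt1; have := rmax_gt0 => h1 h2.
have : 1 <= tmax by rewrite /tmax; elim/big_rec: _ => // j x _ h; rewrite le_max h orbT.
by rewrite /Ctr ler_pdivlMr; lra.
Qed.

Lemma Ctr_fix j : `|lam j| * Ctr + `|t j| <= Ctr.
Proof.
have := rmax_lt1 => h2.
have ht : `|t j| <= tmax by exact: (@le_bigmax _ _ _ 1 (fun j => `|t j|)).
have hC := Ctr_ge1.
have : `|lam j| * Ctr <= rmax * Ctr by rewrite ler_wpM2r ?rmax_ge //; lra.
have : tmax = (1 - rmax) * Ctr by rewrite /Ctr mulrC divfK // gt_eqF //; lra.
by rewrite mulrBl mul1r; move: (rmax * Ctr) (`|lam j| * Ctr) => x y; lra.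
Qed.

Lemma trw_le w : `|trw w| <= Ctr.
Proof.
elim: w => [|j w IH]; first by rewrite trw_nil normr0; have := Ctr_ge1; lra.
rewrite /trw /= /ifs_map -/(trw w); apply: le_trans (Ctr_fix j).
by apply: le_trans (ler_normD _ _) _; rewrite lerD2r normrM ler_wpM2l.
Qed.

Lemma lamw_neq0 w : lamw w != 0.
Proof. by elim: w => [|j w IH]; rewrite ?lamw_nil ?oner_eq0 // lamw_cons mulf_neq0. Qed.

Lemma lamw_gt0 w : 0 < `|lamw w|.
Proof. by rewrite normr_gt0 lamw_neq0. Qed.

Lemma lamw_le w : `|lamw w| <= rmax ^+ size w.
Proof.
elim: w => [|j w IH]; first by rewrite lamw_nil normr1.
by rewrite lamw_cons normrM exprS ler_pM ?rmax_ge.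
Qed.

(* Random word stopped as soon as s * |lam_w| <= 1; n is recursion fuel. *)
Fixpoint stopf (n : nat) (s : R) : fdist R (seq A) :=
  if n is k.+1 then
    if s <= 1 then fret R [::]
    else fbind letters (fun j => fmap (cons j) (stopf k (s * `|lam j|)))
  else fret R [::].

Lemma fuel_ex s : exists N, rmax ^+ N * s <= 1.
Proof.
have [s1|s1] := lerP s 1; first by exists 0; rewrite expr0 mul1r.
have r1 := rmax_lt1; have r0 := rmax_gt0.
have l0 : 0 < - ln rmax by rewrite oppr_gt0 ln_lt0 // r0 r1.
exists (Num.truncn (ln s / - ln rmax)).+1.
set N := _.+1.
have hN : ln s <= N%:R * - ln rmax by rewrite -ler_pdivrMr // ltW // truncnS_gt.
rewrite -[rmax]lnK ?posrE // -[s in X in X <= _]lnK ?posrE; last by lra.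
rewrite -expRM_natl -expRD -[leRHS]expR0 ler_expR.
by move: hN; rewrite mulrN; lra.
Qed.

Lemma fuel_step N s j : 0 <= s -> rmax ^+ N * (s * `|lam j|) <= rmax ^+ N.+1 * s.
Proof.
move=> s0; rewrite exprSr -mulrA ler_wpM2l ?exprn_ge0 ?(ltW rmax_gt0) //.
by rewrite mulrC ler_wpM2r ?rmax_ge.
Qed.

Definition fuel (s : R) : nat := ex_minn (fuel_ex s).
Definition Stop (s : R) : fdist R (seq A) := stopf (fuel s) s.

Lemma stopf_indep N N' s : rmax ^+ N * s <= 1 -> rmax ^+ N' * s <= 1 ->
  stopf N s = stopf N' s.
Proof.
elim: N N' s => [|N IH] [|N'] s //=.
- by rewrite expr0 mul1r => ->.
- by rewrite expr0 mul1r => _ ->.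
case: (lerP s 1) => // s1 h h'; congr fbind; apply/funext => j; congr fmap.
have s0 : 0 <= s by lra.
by apply: IH; [apply: le_trans h|apply: le_trans h']; exact: fuel_step.
Qed.

Lemma fuelP s : rmax ^+ fuel s * s <= 1.
Proof. by rewrite /fuel; case: ex_minnP. Qed.

Lemma StopE s : Stop s = if s <= 1 then fret R [::]
  else fbind letters (fun j => fmap (cons j) (Stop (s * `|lam j|))).
Proof.
rewrite {1}/Stop (@stopf_indep _ (fuel s).+1) ?fuelP //=; last first.
  have [s0|s0] := lerP 0 s; last first.
    apply: (@le_trans _ _ 0) => //; apply: mulr_ge0_le0; last exact: ltW.
    by rewrite exprn_ge0 // ltW // rmax_gt0.
  apply: le_trans (fuelP s); rewrite exprS -mulrA ler_piMl ?(ltW rmax_lt1) //.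
  by rewrite mulr_ge0 // exprn_ge0 // ltW // rmax_gt0.
case: lerP => // s1; congr fbind; apply/funext => j; congr fmap.
apply: stopf_indep; last exact: fuelP.
apply: le_trans (fuelP s).
rewrite ler_wpM2l ?exprn_ge0 ?(ltW rmax_gt0) //.
by rewrite ler_piMr ?(ltW (lam_norm_lt1 _)) //; lra.
Qed.

Lemma Stop_le1 s : s <= 1 -> Stop s = fret R [::].
Proof. by move=> s1; rewrite StopE s1. Qed.

Lemma Stop_gt1 s : 1 < s ->
  Stop s = fbind letters (fun j => fmap (cons j) (Stop (s * `|lam j|))).
Proof. by move=> s1; rewrite StopE leNgt s1. Qed.

(** Induction on the scale is well founded because a letter multiplies it by at most [rmax] < 1. *)
Lemma Stop_ind (P : R -> Prop) : (forall s, s <= 1 -> P s) ->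
  (forall s, 1 < s -> (forall j, P (s * `|lam j|)) -> P s) -> forall s, P s.
Proof.
move=> h0 h1 s; move: (fuel s) (fuelP s) => N; elim: N s => [|N IH] s.
  by rewrite expr0 mul1r => /h0.
have [s1 _|s1 hs] := lerP s 1; first exact: h0.
apply: h1 => // j; apply: IH; apply: le_trans hs.
by apply: fuel_step; lra.
Qed.

Lemma Ex_Stop_gt1 s F : 1 < s ->
  Ex (Stop s) F = \sum_j p j * Ex (Stop (s * `|lam j|)) (fun w => F (j :: w)).
Proof.
move=> s1; rewrite Stop_gt1 // Ex_bind Ex_letters; apply: eq_bigr => j _.
by rewrite Ex_map.
Qed.

Lemma supp_Stop_gt1 s w : 1 < s -> supp (Stop s) w <->
  exists j v, w = j :: v /\ supp (Stop (s * `|lam j|)) v.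
Proof.
move=> s1; rewrite Stop_gt1 // supp_bind; split.
  by move=> [j _ /supp_map[v vS ->]]; exists j, v.
by move=> [j [v [-> vS]]]; exists j; rewrite ?supp_letters // supp_map; exists v.
Qed.

Lemma Stop_upper s w : supp (Stop s) w -> s * `|lamw w| <= 1.
Proof.
elim/Stop_ind: s w => s s1.
  by move=> w; rewrite Stop_le1 // supp_ret => /eqP ->; rewrite lamw_nil normr1 mulr1.
move=> h w /(supp_Stop_gt1 _ s1)[j [v [-> vS]]].
by rewrite lamw_cons normrM mulrA h.
Qed.

Lemma Stop_lower s w : cmin <= s -> supp (Stop s) w -> cmin <= s * `|lamw w|.
Proof.
elim/Stop_ind: s w => s s1.
  by move=> w cs; rewrite Stop_le1 // supp_ret => /eqP ->; rewrite lamw_nil normr1 mulr1.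
move=> h w cs /(supp_Stop_gt1 _ s1)[j [v [-> vS]]].
rewrite lamw_cons normrM mulrA h //.
by rewrite -[leLHS]mul1r ler_pM ?cmin_le ?(ltW cmin_gt0) ?ltW.
Qed.

(** Strong Markov property: after stopping at the coarser scale [a], the word restarts afresh with
    the remaining scale. *)
Lemma Stop_cat a s F : a <= s ->
  Ex (Stop s) F = Ex (Stop a) (fun w => Ex (Stop (s * `|lamw w|)) (fun v => F (w ++ v))).
Proof.
elim/Stop_ind: a s F => a a1.
  by move=> s F _; rewrite (Stop_le1 a1) Ex_ret lamw_nil normr1 mulr1.
move=> h s F as_; rewrite (Ex_Stop_gt1 _ a1) Ex_Stop_gt1 ?(lt_le_trans a1) //.
apply: eq_bigr => j _; congr (_ * _); rewrite (h j (s * `|lam j|)); last first.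
  by rewrite ler_wpM2r.
by apply: eq_Ex => w _; rewrite lamw_cons normrM mulrA.
Qed.

(** Stopping is decided by the letters already read, so stopped words form a prefix code. *)
Lemma Stop_prefix s w v : supp (Stop s) w -> supp (Stop s) (w ++ v) -> v = [::].
Proof.
elim/Stop_ind: s w v => s s1.
  by move=> w v; rewrite Stop_le1 // !supp_ret => /eqP -> /eqP.
move=> h w v /(supp_Stop_gt1 _ s1)[j [u [-> uS]]] /(supp_Stop_gt1 _ s1)[j' [u' [[<- <-] uS']]].
exact: h uS uS'.
Qed.

(** Optional stopping for the martingale of letter sums. *)
Lemma Stop_mart s (f : A -> R) : \sum_j p j * f j = 0 ->
  Ex (Stop s) (fun w => \sum_(j <- w) f j) = 0.
Proof.
move=> f0; elim/Stop_ind: s => s s1; first by rewrite Stop_le1 // Ex_ret big_nil.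
move=> h; rewrite Ex_Stop_gt1 //.
rewrite (eq_bigr (fun j => p j * f j)) // => j _; congr (_ * _).
under eq_Ex do rewrite big_cons.
by rewrite ExD Ex_cst h addr0.
Qed.

(** Optional stopping for a product supermartingale; it serves the Chernoff bound. *)
Lemma Stop_expmart s (g : A -> R) : (forall j, 0 <= g j) -> \sum_j p j * g j <= 1 ->
  Ex (Stop s) (fun w => \prod_(j <- w) g j) <= 1.
Proof.
move=> g0 g1; elim/Stop_ind: s => s s1; first by rewrite Stop_le1 // Ex_ret big_nil.
move=> h; rewrite Ex_Stop_gt1 //; apply: le_trans g1; apply: ler_sum => j _.
rewrite ler_wpM2l ?(ltW (p_gt0 _)) //; under eq_Ex do rewrite big_cons.
by rewrite ExZ -[leRHS]mulr1 ler_wpM2l.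
Qed.

Lemma pm_Stop s w : supp (Stop s) w -> pm (Stop s) id w = \prod_(j <- w) p j.
Proof.
elim/Stop_ind: s w => s s1.
  by move=> w; rewrite Stop_le1 // supp_ret => /eqP ->; rewrite /pm Ex_ret eqxx big_nil.
move=> h w /(supp_Stop_gt1 _ s1)[j [v [-> vS]]].
rewrite /pm Ex_Stop_gt1 // big_cons (bigD1 j) //= big1 ?addr0.
  by rewrite -(h j v vS); congr (_ * _); apply: eq_Ex => u _; rewrite eqseq_cons eqxx.
move=> i ij; rewrite (@eq_Ex _ _ _ _ (fun=> 0)) ?Ex_cst ?mulr0 // => u _.
by rewrite eqseq_cons (negbTE ij).
Qed.

Lemma Stop_size s w : 1 <= s -> supp (Stop s) w ->
  (size w)%:R * - ln rmax <= ln s - ln cmin.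
Proof.
move=> s1 wS.
have c0 := cmin_gt0; have r0 := rmax_gt0.
have := Stop_lower (le_trans (ltW cmin_lt1) s1) wS => h1.
have h : cmin <= s * rmax ^+ size w.
  by apply: le_trans h1 _; rewrite ler_wpM2l ?lamw_le //; lra.
have : ln cmin <= ln (s * rmax ^+ size w).
  by rewrite ler_ln ?posrE // (lt_le_trans c0).
rewrite lnM ?posrE ?exprn_gt0 //; last by lra.
by rewrite lnXn // -mulr_natl; lra.
Qed.

End Words.

Arguments lamw {R} S w.
Arguments trw {R} S w.

Ltac ifs_bounds S :=
  have C0_1 := Ctr_ge1 S; have c0 := cmin_gt0 S; have c1 := cmin_lt1 S.

(** * Entropy of mu at a scale *)

Section EntropyScale.
Variable R : realType.

Lemma H_fst (T U V : eqType) (d : fdist R T) (f : T -> fdist R U) (X : T -> V) :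
  Hent (fpair d f) (fun z => X z.1) = Hent d X.
Proof. by apply: H_law => F; rewrite Ex_pair; apply: eq_Ex => x _; rewrite /= Ex_cst. Qed.

Lemma H_affine_near (s a g : R) (x : R) :
  `|(Q s (a + g * x))%:~R - (s * a + Num.sg g * (Q (s * `|g|) x)%:~R)| <= 2.
Proof.
have := Q_near s (a + g * x); have := Q_near (s * `|g|) x.
move: (Q s _) (Q _ _) => z z'; rewrite !ler_norml.
have E : g = Num.sg g * `|g| by exact: numEsg.
case: (ltrgt0P g) => [g0|g0|->].
- by rewrite gtr0_sg //; lra.
- by rewrite ltr0_sg //; lra.
- by rewrite sgr0; lra.
Qed.

(** An affine map of ratio [g] turns scale [s] into s |g|; for g < 0 it also reverses the order of
    the cells, at bounded cost. *)
Lemma H_affine_ge (T : eqType) (d : fdist R T) (s a g : R) (X : T -> R) : g != 0 ->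
  Hent d (fun w => Q (s * `|g|) (X w)) <= Hent d (fun w => Q s (a + g * X w)) + lnb 2.
Proof.
move=> g0.
apply: (@H_near_le _ _ _ d _ _ (fun z : int => Num.sg g * (z%:~R - s * a))) => // w _.
have := H_affine_near s a g (X w); move: (Q s (_ + _)) (Q (s * _) _) => z z'.
rewrite !ler_norml; case: (ltrgt0P g) g0 => [h|h|//] _.
- by rewrite gtr0_sg //; lra.
- by rewrite ltr0_sg //; lra.
Qed.

Variable S : wifs R.
Local Notation m := (wm S).
Local Notation A := ('I_m.+1).

Lemma H_Stop_cat (U : eqType) (X : seq A -> U) a s : a <= s ->
  Hent (Stop S s) X =
  Hent (fpair (Stop S a) (fun w => Stop S (s * `|lamw S w|))) (fun z => X (z.1 ++ z.2)).
Proof. by move=> as_; apply: H_law => F; rewrite Ex_pair (Stop_cat _ as_). Qed.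

(** Plays the role of the entropy of mu at scale 1 / s: after a stopped word only a contraction by
    at most 1 / s remains, so the translation part gives the point up to O(1 / s). *)
Definition hS (s : R) : R := Hent (Stop S s) (fun w => Q s (trw S w)).

Lemma hS_ge0 s : 0 <= hS s. Proof. exact: H_ge0. Qed.

Local Notation C0 := (Ctr S).
Local Notation c := (cmin S).
Lemma trw_cat_near s w v : 0 <= s -> s * `|lamw S w| <= 1 ->
  `|s * trw S (w ++ v) - s * trw S w| <= C0.
Proof.
move=> s0 h; rewrite trw_cat -mulrBr addrAC subrr add0r !normrM (ger0_norm s0) mulrA.
apply: le_trans (trw_le v); rewrite -[leRHS]mul1r ler_wpM2r //.
Qed.

Definition KS1 : R := lnb (C0 + 2).

Lemma hS_le_later r r' : 0 <= r -> r <= r' ->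
  hS r <= Hent (Stop S r') (fun w => Q r (trw S w)) + KS1.
Proof.
ifs_bounds S.
move=> r0 rr; rewrite (H_Stop_cat _ rr) /hS -(H_fst _ (fun w => Stop S (r' * `|lamw S w|))).
apply: (@H_near_le _ _ _ _ _ _ (fun z : int => z%:~R) (C0 + 2)) => [|[w v]]; first by lra.
move=> /supp_pair[/= wS _].
have := trw_cat_near v r0 (Stop_upper wS).
have := Q_near r (trw S (w ++ v)); have := Q_near r (trw S w).
by rewrite !ler_norml; lra.
Qed.

Definition KS2 : R := lnb (1 + (C0 + 1) / c).

(** The stopping time overshoots the scale by at most the factor [cmin]; this bound absorbs the
    overshoot. *)
Lemma hS_comparable s s' : 0 < s -> s <= s' -> c * s' <= s -> hS s' <= hS s + KS2.
Proof.
ifs_bounds S.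
move=> s0 ss cs; rewrite {1}/hS (H_Stop_cat _ ss) /hS.
rewrite -(H_fst _ (fun w => Stop S (s' * `|lamw S w|))).
apply: (@H_near_le _ _ _ _ _ _ (fun z : int => s' / s * z%:~R) (1 + (C0 + 1) / c)) => [|[w v]].
  by rewrite addr_ge0 // divr_ge0 //; lra.
move=> /supp_pair[/= wS _].
have h1 := trw_cat_near v (ltW s0) (Stop_upper wS).
have h2 := Q_near s' (trw S (w ++ v)); have h3 := Q_near s (trw S w).
have q0 : 0 <= s' / s by rewrite divr_ge0 //; lra.
have q1 : s' / s <= c^-1 by rewrite ler_pdivrMr // mulrC ler_pdivlMr // mulrC.
apply: le_trans (_ : 1 + s' / s * (C0 + 1) <= _); last first.
  by rewrite lerD2l [leRHS]mulrC ler_wpM2r //; lra.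
have -> : (Q s' (trw S (w ++ v)))%:~R - s' / s * (Q s (trw S w))%:~R =
  ((Q s' (trw S (w ++ v)))%:~R - s' * trw S (w ++ v)) +
   s' / s * ((s * trw S (w ++ v) - s * trw S w) +
             (s * trw S w - (Q s (trw S w))%:~R)).
  by field; rewrite gt_eqF.
apply: le_trans (ler_normD _ _) _; rewrite lerD //.
rewrite normrM (ger0_norm q0) ler_wpM2l //.
by apply: le_trans (ler_normD _ _) _; rewrite lerD // distrC.
Qed.

Definition KS3 : R := lnb (C0 + 2) + lnb 2 + KS2.

(** Conditioning on the whole first word instead of its cell lowers the entropy of what follows, and
    what follows is then an affine copy of mu seen at a scale comparable to s'. *)
Lemma hS_super s s' : 1 <= s -> 1 <= s' -> hS s + hS s' - KS3 <= hS (s * s').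
Proof.
ifs_bounds S.
move=> s1 s1'; have s0 : 0 < s by lra.
have ss : s <= s * s' by rewrite ler_peMr //; lra.
rewrite {3}/hS (H_Stop_cat _ ss).
set D := fpair _ _; pose Z (z : seq A * seq A) := Q (s * s') (trw S (z.1 ++ z.2)).
pose Y (z : seq A * seq A) := Q s (trw S z.1).
have e1 : Hent D (fun z => (Y z, Z z)) <= Hent D Z + lnb (C0 + 2).
  apply: (@H_near _ _ _ _ _ _ (fun z : int => z%:~R / s') (C0 + 2)) => [|[w v]]; first by lra.
  move=> /supp_pair[/= wS _].
  have h1 := trw_cat_near v (ltW s0) (Stop_upper wS).
  have h2 := Q_near s (trw S w); have h3 := Q_near (s * s') (trw S (w ++ v)).
  rewrite /Y /Z /=.
  have -> : (Q s (trw S w))%:~R - (Q (s * s') (trw S (w ++ v)))%:~R / s' =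
    ((Q s (trw S w))%:~R - s * trw S w) + - (s * trw S (w ++ v) - s * trw S w)
    + - (((Q (s * s') (trw S (w ++ v)))%:~R - (s * s') * trw S (w ++ v)) / s').
    by field; rewrite gt_eqF //; lra.
  apply: le_trans (ler_normD _ _) _; rewrite normrN normrM normfV (ger0_norm (_ : 0 <= s')); last by lra.
  have : `|(Q (s * s') (trw S (w ++ v)))%:~R - s * s' * trw S (w ++ v)| / s' <= 1.
    by rewrite ler_pdivrMr ?mul1r; lra.
  have := ler_normD ((Q s (trw S w))%:~R - s * trw S w) (- (s * trw S (w ++ v) - s * trw S w)).
  by rewrite normrN; lra.
have e2 : Hent D (fun z => (Z z, z.1)) - Hent D (fun z => z.1) <=
          Hent D (fun z => (Z z, Y z)) - Hent D Y.
  by apply: H_cond_le => w w' _ _ E; rewrite /Y E.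
have e3 : Hent D (fun z => (z.1, Z z)) = Hent (Stop S s) id +
   Ex (Stop S s) (fun w => Hent (Stop S (s * s' * `|lamw S w|))
      (fun v => Q (s * s') (trw S (w ++ v)))).
  by apply: H_pair_chain => a a' F _ _ ->.
have e4 : hS s' - KS2 - lnb 2 <= Ex (Stop S s) (fun w => Hent (Stop S (s * s' * `|lamw S w|))
      (fun v => Q (s * s') (trw S (w ++ v)))).
  apply: Ex_ge_cst => w wS.
  under eq_H do rewrite trw_cat.
  have := @H_affine_ge _ (Stop S (s * s' * `|lamw S w|)) (s * s') (trw S w) (lamw S w)
     (trw S) (lamw_neq0 w).
  have u := Stop_upper wS; have l := Stop_lower (le_trans (ltW c1) s1) wS.
  suff : hS s' - KS2 <= hS (s * s' * `|lamw S w|) by rewrite /hS; lra.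
  rewrite lerBlDr mulrAC; apply: hS_comparable.
  - by rewrite !mulr_gt0 ?lamw_gt0 //; lra.
  - by rewrite -[leRHS]mul1r ler_wpM2r //; lra.
  - by rewrite ler_wpM2r //; lra.
have h1 : Hent D Y = hS s.
  exact: (@H_fst _ _ _ _ _ (fun w => Q s (trw S w))).
have h2 : Hent D fst = Hent (Stop S s) id by exact: (@H_fst _ _ _ _ _ id).
have h3 := H_pairC D Z Y; have h4 := H_pairC D Z fst.
by rewrite /KS3 -[leRHS]/(Hent D Z); lra.
Qed.

Definition KS4 : R := ln (2 * C0 + 6).

Lemma hS_le_ln s : 1 <= s -> hS s <= ln s + KS4.
Proof.
ifs_bounds S.
move=> s1; rewrite /hS.
have : Hent (Stop S s) (fun w => Q s (trw S w)) <=
    Hent (Stop S s) (fun=> tt) + lnb (s * C0 + 1).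
  apply: (@H_near_le _ _ _ _ _ _ (fun=> 0)) => [|w _].
    by rewrite addr_ge0 // mulr_ge0 //; lra.
  rewrite subr0; have := Q_near s (trw S w).
  have : `|s * trw S w| <= s * C0 by rewrite normrM ger0_norm ?ler_wpM2l ?trw_le //; lra.
  by rewrite !ler_norml; lra.
rewrite H_cst add0r => h; apply: le_trans h _.
rewrite /KS4 -lnM ?posrE; try lra.
have : 0 <= s * C0 by rewrite mulr_ge0 //; lra.
rewrite /lnb => h; rewrite ler_ln ?posrE; first by lra.
  by lra.
by rewrite mulr_gt0 //; lra.
Qed.

Lemma entropy_dim_exists : exists al C : R, [/\ 0 <= al <= 1, 0 <= C,
  (forall n, hS (expR n%:R) <= al * n%:R + C) &
  forall e, 0 < e -> exists n0, forall n, (n0 <= n)%N ->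
    (al - e) * n%:R <= hS (expR n%:R)].
Proof.
pose C := `|KS3| + `|KS4|.
have C_0 : 0 <= C by rewrite addr_ge0.
have ge1 n : 1 <= expR n%:R :> R by rewrite -expR0 ler_expR.
have [n|n|n k|al [h1 h2 h3]] := @Fekete R (fun n => hS (expR n%:R)) C.
- exact: hS_ge0.
- have := hS_le_ln (ge1 n); rewrite expRK; have := ler_norm KS4; have := normr_ge0 KS3.
  by move=> x1 x2 x3; apply: le_trans x3 _; rewrite lerD2l /C; lra.
- have := hS_super (ge1 n) (ge1 k); rewrite -expRD natrD.
  have := ler_norm KS3; have := normr_ge0 KS4.
  by move=> x1 x2; apply: le_trans; rewrite lerD2l lerN2 /C; lra.
by exists al, C.
Qed.

End EntropyScale.

(** * Sums of independent variables *)

Section LazyWalk.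
Variable R : realType.
Variable th : R.
Hypothesis th_ge0 : 0 < th.
Hypothesis th_half : th <= 2^-1.

(* Survival probability up to time k of the lazy simple random walk started
   at r and killed at 0. *)
Fixpoint survive (k r : nat) {struct k} : R :=
  if k is j.+1 then
    if r is i.+1 then
      (1 - 2 * th) * survive j i.+1 + th * (survive j i.+2 + survive j i)
    else 0
  else (0 < r)%:R.

(** Probability that the same walk stays strictly between 0 and [K] up to time [k]. *)
Fixpoint stay (K k r : nat) {struct k} : R :=
  if (0 < r < K)%N then
    if k is j.+1 then
      (1 - 2 * th) * stay K j r + th * (stay K j r.+1 + stay K j r.-1)
    else 1
  else 0.

Lemma lazy_mono a a' b b' c c' : a <= a' -> b <= b' -> c <= c' ->
  (1 - 2 * th) * a + th * (b + c) <= (1 - 2 * th) * a' + th * (b' + c').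
Proof.
move=> ha hb hc; rewrite lerD // ler_wpM2l ?lerD //; last exact: ltW.
by move: th_half; lra.
Qed.

Lemma survive0 k : survive k 0 = 0. Proof. by case: k. Qed.

Lemma stay_out K k r : ~~ (0 < r < K)%N -> stay K k r = 0.
Proof. by move=> h; case: k => [|k] /=; rewrite (negbTE h). Qed.

Lemma survive_le1 k r : survive k r <= 1.
Proof.
elim: k r => [|k IH] [|r] //=; try by rewrite lern1.
apply: le_trans (lazy_mono (IH _) (IH _) (IH _)) _.
by rewrite le_eqVlt; apply/orP; left; apply/eqP; ring.
Qed.

Lemma stay_ge0 K k r : 0 <= stay K k r.
Proof.
elim: k r => [|k IH] r /=; case: ifP => // _.
apply: le_trans (lazy_mono (IH r) (IH r.+1) (IH r.-1)).
by rewrite addr0 !mulr0 addr0.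
Qed.

Lemma stay_decr K k r : stay K k.+1 r <= stay K k r.
Proof.
elim: k r => [|k IH] r.
  rewrite /=; case: (boolP (0 < r < K)%N) => // h.
  have h1 : (if (r.+1 < K)%N then 1 else 0) <= 1 :> R by case: ifP.
  have h2 : (if (0 < r.-1 < K)%N then 1 else 0) <= 1 :> R by case: ifP.
  apply: le_trans (lazy_mono (lexx 1) h1 h2) _.
  by rewrite le_eqVlt; apply/orP; left; apply/eqP; ring.
have [h|h] := boolP (0 < r < K)%N; last by rewrite !stay_out.
have E j : stay K j.+1 r =
    (1 - 2 * th) * stay K j r + th * (stay K j r.+1 + stay K j r.-1).
  by rewrite /= h.
by rewrite [leLHS](E k.+1) [leRHS](E k); apply: lazy_mono; exact: IH.
Qed.

Lemma stay_anti K j k r : (j <= k)%N -> stay K k r <= stay K j r.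
Proof.
elim: k => [|k IH]; first by rewrite leqn0 => /eqP ->.
rewrite leq_eqVlt => /predU1P[->//|]; rewrite ltnS => /IH; apply: le_trans.
exact: stay_decr.
Qed.

(** A surviving walk has either reached [K] before 0, with probability at most r / K as in the
    gambler's ruin, or is still between 0 and [K]. *)
Lemma survive_le K k r : (0 < K)%N -> (r <= K)%N ->
  survive k r <= r%:R / K%:R + stay K k r.
Proof.
move=> K0; have K0R : (0 : R) < K%:R by rewrite ltr0n.
elim: k r => [|k IH] r rK.
  case: r rK => [|r] rK /=; first by rewrite mul0r addr0.
  case: ifP => h; first by rewrite lerDr divr_ge0.
  have -> : r.+1 = K by move: h; rewrite /= => /negbT; rewrite -leqNgt; lia.
  by rewrite divff ?gt_eqF // addr0.
have [->|r0] := posnP r; first by rewrite survive0 mul0r add0r stay_ge0.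
have [h|h] := ltnP r K; last first.
  have -> : r = K by lia.
  by rewrite divff ?gt_eqF // ler_wpDr ?stay_ge0 ?survive_le1.
case: r r0 rK h => // r _ rK h.
rewrite [stay _ _ _]/= -/(stay K k) h /=.
have h1 := IH r.+1 rK; have h2 := IH r.+2 h; have h3 := IH r (ltnW rK).
have E2 : r.+2%:R / K%:R = r.+1%:R / K%:R + K%:R^-1 :> R.
  by rewrite -[in LHS]natr1 mulrDl mul1r.
have E0 : r%:R / K%:R = r.+1%:R / K%:R - K%:R^-1 :> R.
  by rewrite -[r.+1%:R]natr1 mulrDl mul1r addrK.
rewrite E2 in h2; rewrite E0 in h3.
have -> : r.+1%:R / K%:R + ((1 - 2 * th) * stay K k r.+1 + th * (stay K k r.+2 + stay K k r))
  = (1 - 2 * th) * (r.+1%:R / K%:R + stay K k r.+1) +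
    th * ((r.+1%:R / K%:R + K%:R^-1 + stay K k r.+2) +
          (r.+1%:R / K%:R - K%:R^-1 + stay K k r)) by ring.
by apply: lazy_mono; rewrite ?E2 ?E0 //; lra.
Qed.

(** The sum is at most the mean exit time from (0, K). A step has variance 2 th, which makes that
    time r (K - r) / (2 th). *)
Lemma sum_stay_le K k r : (r <= K)%N ->
  2 * th * \sum_(j < k) stay K j r <= r%:R * (K%:R - r%:R).
Proof.
elim: k r => [|k IH] r rK.
  by rewrite big_ord0 mulr0 mulr_ge0 // subr_ge0 ler_nat.
have [h|h] := boolP (0 < r < K)%N; last first.
  rewrite big1 ?mulr0 ?mulr_ge0 ?subr_ge0 ?ler_nat // => j _; exact: stay_out.
case: r rK h => // r rK /andP[_ h].
rewrite big_ord_recl /= h.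
rewrite (eq_bigr (fun j : 'I_k => (1 - 2 * th) * stay K j r.+1 +
    th * (stay K j r.+2 + stay K j r))); last by [].
rewrite big_split /= -!big_distrr /= big_split /=.
have := IH r.+1 rK; have := IH r.+2 h; have := IH r (ltnW rK).
rewrite -[r.+2%:R]natr1 -[r.+1%:R]natr1.
move: (\sum_(_ < k) stay K _ r.+1) (\sum_(_ < k) stay K _ r.+2) (\sum_(_ < k) stay K _ r).
move=> a b c' hc hb ha.
have := lerD (lerD (ler_wpM2l (_ : 0 <= 1 - 2 * th) ha) (ler_wpM2l (ltW th_ge0) hb))
  (ler_wpM2l (ltW th_ge0) hc).
by have -> : 0 <= 1 - 2 * th; [move: th_half; lra|move=> /(_ isT); lra].
Qed.

Lemma survive1_le K k : (0 < K)%N -> (0 < k)%N ->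
  survive k 1 <= K%:R^-1 + K%:R / (2 * th * k%:R).
Proof.
move=> K0 k0; have := @survive_le K k 1 K0 K0; rewrite mul1r => h.
apply: le_trans h _; rewrite lerD2l.
have k0R : (0 : R) < k%:R by rewrite ltr0n.
rewrite ler_pdivlMr ?mulr_gt0 //.
(* [stay] decreases in time, so its last value is at most the average. *)
have h1 : k%:R * stay K k 1 <= \sum_(j < k) stay K j 1.
  rewrite -[X in X%:R * _](card_ord k) mulr_natl -sumr_const; apply: ler_sum => j _.
  by apply: stay_anti; exact: ltnW.
have := @sum_stay_le K k 1 K0.
have := ler_wpM2l (ltW th_ge0) h1; rewrite mul1r => h2 h3.
by move: h2 h3; move: (\sum_(_ < k) _) => s; nra.
Qed.

End LazyWalk.

(** * Independent copies of a distribution *)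

Section Powers.
Variables (R : realType) (T : eqType) (d : fdist R T).

Fixpoint fpow (k : nat) : fdist R (seq T) :=
  if k is j.+1 then fmap (fun z => z.1 :: z.2) (fprod d (fpow j))
  else fret R [::].

Lemma Ex_pow0 F : Ex (fpow 0) F = F [::].
Proof. exact: Ex_ret. Qed.

Lemma Ex_powS k F :
  Ex (fpow k.+1) F = Ex d (fun x => Ex (fpow k) (fun l => F (x :: l))).
Proof. by rewrite Ex_map Ex_prod. Qed.

Lemma supp_pow k l : supp (fpow k) l -> size l = k /\ forall x, x \in l -> supp d x.
Proof.
elim: k l => [|k IH] l /=; first by rewrite supp_ret => /eqP ->.
move=> /supp_map[[x l'] /supp_prod[/= xd /IH[<- h]] ->] /=; split=> // y.
by rewrite inE => /predU1P[->//|/h].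
Qed.

(** Each further independent copy of [Y] adds at most what the first one adds. *)
Lemma Kaimanovich_Vershik_pow (T3 : eqType) (d3 : fdist R T3) (V : zmodType)
    (Y : T -> V) (W : T3 -> V) k :
  Hent (fprod (fpow k) d3) (fun z => \sum_(x <- z.1) Y x + W z.2) <=
  Hent d3 W + k%:R * (Hent (fprod d d3) (fun z => Y z.1 + W z.2) - Hent d3 W).
Proof.
elim: k => [|k IH].
  rewrite mul0r addr0 le_eqVlt; apply/orP; left; apply/eqP.
  apply: H_law => F; rewrite Ex_prod Ex_pow0; apply: eq_Ex => x _.
  by rewrite big_nil add0r.
have := Kaimanovich_Vershik d (fpow k) d3 Y (fun l => \sum_(x <- l) Y x) W.
have -> : Hent (fprod (fprod d (fpow k)) d3)
    (fun z => Y z.1.1 + \sum_(x <- z.1.2) Y x + W z.2) =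
  Hent (fprod (fpow k.+1) d3) (fun z => \sum_(x <- z.1) Y x + W z.2).
  apply: H_law => F; rewrite !Ex_prod Ex_powS; apply: eq_Ex => x _.
  by apply: eq_Ex => l _; apply: eq_Ex => y _; rewrite /= big_cons.
rewrite -natr1; lra.
Qed.

Lemma Ex_pow_sum k (Z : T -> R) : Ex d Z = 0 ->
  Ex (fpow k) (fun l => \sum_(x <- l) Z x) = 0.
Proof.
move=> Z0; elim: k => [|k IH]; first by rewrite Ex_pow0 big_nil.
rewrite Ex_powS -[RHS]Z0; apply: eq_Ex => x _.
by under eq_Ex do rewrite big_cons; rewrite ExD IH Ex_cst addr0.
Qed.

Lemma variance_pow k (Z : T -> R) (b : R) : Ex d Z = 0 ->
  (forall x, supp d x -> `|Z x| <= b) ->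
  Ex (fpow k) (fun l => (\sum_(x <- l) Z x) ^+ 2) <= k%:R * b ^+ 2.
Proof.
move=> Z0 Zb; elim: k => [|k IH]; first by rewrite Ex_pow0 big_nil mul0r expr0n.
rewrite Ex_powS.
apply: (@le_trans _ _ (Ex d (fun x => b ^+ 2 + k%:R * b ^+ 2))); last first.
  by rewrite Ex_cst -natr1; lra.
apply: le_Ex => x xd; under eq_Ex do rewrite big_cons sqrrD.
rewrite !ExD Ex_cst !ExZ Ex_pow_sum // mulr0 !addr0.
rewrite lerD // -[leLHS]ger0_norm ?sqr_ge0 // normrX.
by rewrite ler_sqr ?nnegrE ?Zb // (le_trans _ (Zb x xd)).
Qed.

End Powers.

(** * Littlewood-Offord bound for unit windows *)

Section LittlewoodOfford.
Variable R : realType.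

(** [W] lists the left ends of half-open unit windows; [sepw] makes them ordered and disjoint. *)
Definition inw (W : seq R) (y : R) : bool := has (fun u => (u <= y) && (y < u + 1)) W.

Definition sepw (W : seq R) : bool := pairwise (fun a b => a + 1 <= b) W.

Lemma inw_shift W y s : inw W (y + s) = inw [seq u - y | u <- W] s.
Proof.
rewrite /inw has_map; apply: eq_has => u /=.
by congr (_ && _); apply/idP/idP; lra.
Qed.

Lemma sepw_shift W y : sepw [seq u - y | u <- W] = sepw W.
Proof.
rewrite /sepw pairwise_map; apply: eq_pairwise => a b /=.
by apply/idP/idP; lra.
Qed.

(** The exchange that drives the argument: as b >= a + 1, the lowest window shifted by b lies below
    all windows shifted by a, so it can move to the other family. Two families of r + 1 windows
    become families of r + 2 and r, which are the steps of the walk in [survive]. *)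
Lemma inw_pair u W a b s : sepw (u :: W) -> a + 1 <= b ->
  ((inw (u :: W) (a + s))%:R + (inw (u :: W) (b + s))%:R <=
   (inw ((u - b) :: [seq x - a | x <- u :: W]) s)%:R +
   (inw [seq x - b | x <- W] s)%:R :> R).
Proof.
move=> sW ab; rewrite !inw_shift.
have -> : inw [seq x - b | x <- u :: W] s = inw [:: u - b] s || inw [seq x - b | x <- W] s.
  by rewrite /inw /= orbF.
have -> : inw ((u - b) :: [seq x - a | x <- u :: W]) s =
    inw [:: u - b] s || inw [seq x - a | x <- u :: W] s by rewrite /inw /= orbF.
have : ~~ (inw [:: u - b] s && inw [seq x - a | x <- u :: W] s).
  apply/negP => /andP[]; rewrite /inw /= orbF => /andP[h1 h2].
  case/orP => [/andP[h3 _]|]; first by lra.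
  move=> /hasP[_ /mapP[x xW ->] /andP[h3 _]].
  move: sW; rewrite /sepw /= => /andP[/allP/(_ x xW)] h _.
  by lra.
by move: (inw [:: u - b] s) (inw [seq x - a | x <- u :: W] s)
  (inw [seq x - b | x <- W] s) => [] [] [] //= _; lra.
Qed.

Section Bound.
Variables (T Vt : eqType) (d : fdist R T) (V : T -> Vt) (Y : T -> R) (th : R).
(** One step of the walk: outcomes of total probability 2 th can be paired inside cells at distance
    at least 1. [averaging] provides it. *)
Hypothesis avg : forall (f : T -> R) (q0 q1 : R),
  (forall x, supp d x -> f x <= q0) ->
  (forall x y, supp d x -> supp d y -> V x = V y -> Y x + 1 <= Y y ->
     f x + f y <= q1) ->
  Ex d f <= (1 - 2 * th) * q0 + th * q1.

(* W may depend on the cells V of the summands: this is an anticoncentration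
   bound conditional on the cells. *)
Lemma window_bound k (W : seq Vt -> seq R) r :
  (forall v, sepw (W v)) -> (forall v, size (W v) = r) ->
  Ex (fpow d k) (fun l => (inw (W (map V l)) (\sum_(x <- l) Y x))%:R) <= survive th k r.
Proof.
elim: k W r => [|k IH] W r sW zW.
  rewrite Ex_pow0 /=; have := zW [::]; case: (W [::]) => [|a w] <- //=.
  by rewrite lern1 leq_b1.
rewrite Ex_powS; case: r zW => [|r] zW.
  rewrite survive0; apply: Ex_le_cst => x _; apply: Ex_le_cst => l _.
  by rewrite (size0nil (zW _)).
apply: avg => [x xd|x y xd yd Vxy Yxy].
  apply: le_trans (IH (fun v => [seq u - Y x | u <- W (V x :: v)]) r.+1 _ _).
  - by rewrite le_eqVlt; apply/orP; left; apply/eqP; apply: eq_Ex => l _; rewrite big_cons inw_shift.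
  - by move=> v; rewrite sepw_shift.
  - by move=> v; rewrite size_map.
rewrite -ExD.
pose W1 v := (head 0 (W (V x :: v)) - Y y) :: [seq u - Y x | u <- W (V x :: v)].
pose W2 v := [seq u - Y y | u <- behead (W (V x :: v))].
have Wc v : W (V x :: v) = head 0 (W (V x :: v)) :: behead (W (V x :: v)).
  by have := zW (V x :: v); case: (W _).
have s1 v : sepw (W1 v).
  rewrite /W1; have := sW (V x :: v); have := zW (V x :: v).
  case: (W _) => [//|u w] _ sw.
  have := sepw_shift (u :: w) (Y x); rewrite sw /= => h.
  case/andP: h => h1 h2; rewrite /sepw /= -/(sepw _) h1 h2 !andbT.
  rewrite -[_ && _]/(all [eta >= (u - Y y + 1)] [seq u0 - Y x | u0 <- u :: w]).
  apply/allP => _ /mapP[u' u'w ->].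
  move: sw; rewrite /sepw pairwise_cons => /andP[/allP hh _].
  by move: u'w; rewrite inE => /predU1P[->|/hh]; lra.
have s2 v : sepw (W2 v).
  rewrite /W2 sepw_shift; have := sW (V x :: v); case: (W _) => [//|u w].
  by rewrite /sepw pairwise_cons => /andP[].
have z1 v : size (W1 v) = r.+2 by rewrite /W1 /= size_map zW.
have z2 v : size (W2 v) = r by rewrite /W2 size_map size_behead zW.
apply: le_trans (lerD (IH W1 _ s1 z1) (IH W2 _ s2 z2)).
rewrite -ExD; apply: le_Ex => l _.
rewrite /W1 /W2 [map V (y :: l)]/= -Vxy !big_cons.
have := sW (V x :: map V l); have := zW (V x :: map V l).
rewrite /=; case: (W _) => [//|u w] _ sw.
exact: inw_pair.
Qed.

End Bound.

(** Drawing one point of [L] and one of [M] independently shows that the two means of [f] sum to at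
    most [q1]. Mass [th] of each set is used in this way; the rest is bounded by [q0]. *)
Lemma avg_cell (T : eqType) (e : fdist R T) (L M : pred T) (f : T -> R) (q0 q1 th : R) :
  0 < th -> (forall x, supp e x -> f x <= q0) ->
  (forall x y, supp e x -> supp e y -> L x -> M y -> f x + f y <= q1) ->
  (forall x, supp e x -> ~~ (L x && M x)) ->
  th <= Ex e (fun x => (L x)%:R) -> th <= Ex e (fun x => (M x)%:R) ->
  Ex e f <= (1 - 2 * th) * q0 + th * q1.
Proof.
move=> th0 fq fp dis.
set a := Ex e (fun x => (L x)%:R); set b := Ex e (fun x => (M x)%:R) => ha hb.
pose A := Ex e (fun x => (L x)%:R * f x); pose B := Ex e (fun x => (M x)%:R * f x).
have Aa : A <= a * q0.
  rewrite /A /a -ExZr; apply: le_Ex => x xe.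
  by case: (L x); rewrite ?mul0r // !mul1r fq.
have Bb : B <= b * q0.
  rewrite /B /b -ExZr; apply: le_Ex => x xe.
  by case: (M x); rewrite ?mul0r // !mul1r fq.
have AB : b * A + a * B <= a * b * q1.
  have -> : b * A + a * B =
      Ex e (fun x => Ex e (fun y => (L x)%:R * (M y)%:R * (f x + f y))).
    transitivity (Ex e (fun x => Ex e (fun y => (L x)%:R * f x * (M y)%:R) +
                                  Ex e (fun y => (L x)%:R * ((M y)%:R * f y)))).
      rewrite ExD; congr (_ + _).
        by rewrite mulrC /A -ExZr; apply: eq_Ex => x _; rewrite ExZ.
      by rewrite /a -ExZr; apply: eq_Ex => x _; rewrite ExZ.
    by apply: eq_Ex => x _; rewrite -ExD; apply: eq_Ex => y _; ring.
  have -> : a * b * q1 = Ex e (fun x => Ex e (fun y => (L x)%:R * (M y)%:R * q1)).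
    rewrite /a -mulrA -ExZr; apply: eq_Ex => x _.
    by rewrite /b -ExZr -ExZ; apply: eq_Ex => y _; rewrite mulrA.
  apply: le_Ex => x xe; apply: le_Ex => y ye.
  by case: (boolP (L x)) => Lx; case: (boolP (M y)) => My; rewrite ?mul0r ?mulr0 ?mul0r // !mul1r fp.
have fE : Ex e f <= A + B + (1 - a - b) * q0.
  have -> : A + B + (1 - a - b) * q0 = Ex e (fun x => (L x)%:R * f x + (M x)%:R * f x
      + (1 - (L x)%:R - (M x)%:R) * q0).
    by rewrite !ExD -/A -/B ExZr !ExB Ex_cst.
  apply: le_Ex => x xe; have := dis x xe; have := fq x xe.
  by case: (L x); case: (M x) => //=; lra.
apply: le_trans fE _.
have a0 : 0 < a by exact: lt_le_trans ha.
have b0 : 0 < b by exact: lt_le_trans hb.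
have AB' : A / a + B / b <= q1.
  rewrite -(ler_pM2l (mulr_gt0 a0 b0)).
  have -> : a * b * (A / a + B / b) = b * A + a * B by field; rewrite !gt_eqF.
  by [].
have hA : A <= (a - th) * q0 + th * (A / a).
  have -> : A = (a - th) * (A / a) + th * (A / a) by field; rewrite gt_eqF.
  by rewrite [in leRHS](_ : ((a - th) * (A / a) + th * (A / a)) / a = A / a) ?lerD2r ?ler_wpM2l ?subr_ge0 ?ler_pdivrMr // 1?mulrC //; field; rewrite gt_eqF.
have hB : B <= (b - th) * q0 + th * (B / b).
  have -> : B = (b - th) * (B / b) + th * (B / b) by field; rewrite gt_eqF.
  by rewrite [in leRHS](_ : ((b - th) * (B / b) + th * (B / b)) / b = B / b) ?lerD2r ?ler_wpM2l ?subr_ge0 ?ler_pdivrMr // 1?mulrC //; field; rewrite gt_eqF.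
have := ler_wpM2l (ltW th0) AB'.
by move: (A / a) (B / b) hA hB => x y; lra.
Qed.

End LittlewoodOfford.

(** * From conditional entropy to spread inside cells *)

Section Spread.
Variable R : realType.

Lemma seq_argmax (U : eqType) (F : U -> R) (s : seq U) : s != [::] ->
  exists2 u, u \in s & forall v, v \in s -> F v <= F u.
Proof.
elim: s => // a s IH _; have [->|/IH [u us hu]] := eqVneq s [::].
  by exists a; rewrite ?mem_head // => v; rewrite inE => /eqP ->.
have [h|h] := lerP (F u) (F a).
  exists a; rewrite ?mem_head // => v; rewrite inE => /predU1P[->//|/hu].
  by move/le_trans; apply.
exists u; first by rewrite inE us orbT.
by move=> v; rewrite inE => /predU1P[->|/hu//]; exact: ltW.
Qed.

(** The best guess of [X] from [Y] takes a most likely value in each cell; by Jensen the conditional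
    entropy is at least minus the logarithm of its success probability. *)
Lemma cond_entropy_ge_ln (T U V : eqType) (d : fdist R T) (X : T -> U) (Y : T -> V)
    (q : R) :
  (forall W : V -> U, Ex d (fun w => (X w == W (Y w))%:R) <= q) ->
  - ln q <= Hent d (fun w => (X w, Y w)) - Hent d Y.
Proof.
move=> hq.
pose P u v := pm d (fun w => (X w, Y w)) (u, v).
have P0 w : supp d w -> 0 < P (X w) (Y w).
  exact: (@pm_gt0 _ _ d _ (fun w => (X w, Y w))).
have Q0 w : supp d w -> 0 < pm d Y (Y w) by exact: pm_gt0.
have [x0 x0d] := supp_exists d.
have /choice[W hW] : forall v, exists u, forall w, supp d w -> P (X w) v <= P u v.
  move=> v; have [|u _ hu] := @seq_argmax U (P ^~ v) [seq X z.2 | z <- fdl d].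
    by move: x0d; rewrite /supp; case: (fdl d).
  exists u => w /mapP[z zd ->]; apply: hu; exact: map_f.
rewrite /Hent -ExB (@eq_Ex _ _ _ _ (fun w => - ln (P (X w) (Y w) / pm d Y (Y w)))); last first.
  by move=> w wd; rewrite ln_div ?posrE ?P0 ?Q0 //; ring.
rewrite ExN lerN2.
apply: (le_trans (Jensen_ln _)) => [w wd|]; first by rewrite divr_gt0 ?P0 ?Q0.
have E0 : 0 < Ex d (fun w => P (X w) (Y w) / pm d Y (Y w)).
  apply: (Ex_gt0 _ x0d) => [x xd|]; last by rewrite divr_gt0 ?P0 ?Q0.
  by rewrite ltW // divr_gt0 ?P0 ?Q0.
suff h : Ex d (fun w => P (X w) (Y w) / pm d Y (Y w)) <= q.
  by rewrite ler_ln ?posrE ?(lt_le_trans E0 h).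
apply: le_trans (hq W).
apply: (@le_trans _ _ (Ex d (fun w => P (W (Y w)) (Y w) / pm d Y (Y w)))).
  apply: le_Ex => w wd; rewrite ler_wpM2r ?hW // invr_ge0 ltW ?Q0 //.
rewrite (@eq_Ex _ _ _ _ (fun w => Ex d (fun w' =>
    ((X w', Y w') == (W (Y w), Y w))%:R / pm d Y (Y w)))); last first.
  by move=> w wd; rewrite ExZr.
rewrite Ex_swap; apply: le_Ex => w' w'd.
rewrite (@eq_Ex _ _ _ _ (fun w => (X w' == W (Y w'))%:R * ((Y w == Y w')%:R / pm d Y (Y w)))).
  by rewrite ExZ -[leRHS]mulr1 ler_wpM2l // Ex_pmV.
move=> w _; rewrite xpair_eqE [Y w == Y w']eq_sym.
by case: (eqVneq (Y w') (Y w)) => [->|_]; rewrite ?andbF ?andbT ?mul0r ?mulr0 ?mul1r.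
Qed.

Lemma count_near (s : seq int) (u0 : int) : uniq s ->
  \sum_(u <- s | `|u - u0| <= 1) (6%:R^-1 : R) <= 2^-1.
Proof.
move=> us; rewrite -big_filter big_const_seq count_predT iter_addr_0.
have : (size [seq u <- s | (`|u - u0| <= 1)%R] <= size [:: (u0 - 1)%R; u0; (u0 + 1)%R])%N.
  apply: uniq_leq_size; first exact: filter_uniq.
  move=> u; rewrite mem_filter !inE => /andP[h _].
  have : (u = u0 - 1 \/ u = u0 \/ u = u0 + 1) by lia.
  by move=> [->|[->|->]]; rewrite eqxx ?orbT.
case: (size _) => [|[|[|[|k]]]] //= _; rewrite ?mulr0n ?invr_ge0 //.
- by rewrite mulr1n; lra.
- by rewrite mulr2n; lra.
- by rewrite -[_ *+ 3]mulr_natr; lra.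
Qed.

Section FromEntropy.
Variables (T Vt : eqType) (d : fdist R T) (U : T -> int) (V : T -> Vt)
  (S : Vt -> seq int) (N : nat) (be : R).
Hypothesis hS : forall w, supp d w -> U w \in S (V w).
Hypothesis hN : forall v, (size (S v) <= N)%N.
Hypothesis be0 : 0 < be.
Hypothesis hH : ln 6 + be * ln (2 * N%:R) <= Hent d (fun w => (U w, V w)) - Hent d V.

Let N0 : (0 < N)%N.
Proof.
have [w wd] := supp_exists d; apply: leq_trans (hN (V w)).
by case: (S _) (hS wd).
Qed.

(** Satisfied by a most likely value of [U] in each cell, as a cell carries at most [N] values. *)
Definition modal (u : Vt -> int) := forall a, supp d a ->
  N%:R^-1 <= Ex (fcond d V (V a)) (fun w => (U w == u (V a))%:R).

Lemma modal_exists : exists u, modal u.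
Proof.
have /choice[u hu] : forall v, exists u, forall a, supp d a -> V a = v ->
    N%:R^-1 <= Ex (fcond d V v) (fun w => (U w == u)%:R).
  move=> v; have [[a [ad va]]|h] := pselect (exists a, supp d a /\ V a = v); last first.
    by exists 0 => a ad va; exfalso; apply: h; exists a.
  pose F u := Ex (fcond d V v) (fun w => (U w == u)%:R).
  have Sn : S v != [::] by rewrite -va; case: (S _) (hS ad).
  have [u us hu] := @seq_argmax _ F (S v) Sn.
  exists u => _ _ _; rewrite -/(F u).
  have pv : 0 < pm d V v by rewrite -va pm_gt0.
  have h1 : 1 <= \sum_(x <- S v) F x.
    rewrite /F -Ex_sum; apply: Ex_ge_cst => w /(supp_cond pv)[wd wv].
    by rewrite (big_rem (U w)) /= ?eqxx ?lerDl ?sumr_ge0 // -wv hS.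
  have : 1 <= N%:R * F u.
    apply: le_trans h1 _; apply: (@le_trans _ _ (\sum_(x <- S v) F u)).
      by rewrite big_seq [leRHS]big_seq; apply: ler_sum => x xs; exact: hu.
    rewrite big_const_seq count_predT iter_addr_0 -(mulr_natl _ (size _)).
    rewrite ler_wpM2r ?ler_nat ?hN //; apply: Ex_ge0 => *; exact: ler0n.
  by rewrite -[N%:R^-1]mul1r ler_pdivrMr ?ltr0n // mulrC.
by exists u => a ad; apply: (hu (V a) a ad erefl).
Qed.

(** A code that favours the three integers around [u0] costs ln 6 plus ln (2 N) times the far mass,
    so the entropy hypothesis forces far mass at least [be]. *)
Lemma spread_mass u0 : modal u0 ->
  be <= Ex d (fun w => (1 < `|U w - u0 (V w)|)%R%:R).
Proof.
move=> _.
(* Total weight at most 1: three near integers of weight 1 / 6, and at most N values of weight 1 /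
   (2 N). *)
pose k (u : int) (v : Vt) : R := if `|u - u0 v| <= 1 then 6^-1 else (2 * N%:R)^-1.
have NR : (0 : R) < N%:R by rewrite ltr0n N0.
have k0 u v : 0 < k u v.
  by rewrite /k; case: ifP => _; rewrite invr_gt0 ?mulr_gt0.
have h1 : Hent d (fun w => (U w, V w)) <= Hent d V + Ex d (fun w => - ln (k (U w) (V w))).
  apply: (@H_pair_kernel _ _ d _ _ U V (fun v => undup (S v)) k) => //.
    by move=> w wd; rewrite mem_undup hS.
  move=> w wd; rewrite (bigID (fun u => `|u - u0 (V w)| <= 1)) /=.
  have -> : 1 = 2^-1 + 2^-1 :> R by field.
  apply: lerD.
    apply: le_trans (count_near (u0 (V w)) (undup_uniq (S (V w)))).
    by apply: ler_sum => u h; rewrite /k h.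
  apply: (@le_trans _ _ (\sum_(u <- undup (S (V w))) (2 * N%:R)^-1)).
    rewrite [leRHS](bigID (fun u => `|u - u0 (V w)| <= 1)) /=.
    apply: ler_wpDl; first by apply: sumr_ge0 => *; rewrite invr_ge0 mulr_ge0.
    by apply: ler_sum => u h; rewrite /k (negbTE h).
  rewrite big_const_seq count_predT iter_addr_0 -(mulr_natl _ (size _)).
  rewrite invfM mulrCA ler_piMr // ler_pdivrMr // mul1r ler_nat.
  exact: leq_trans (size_undup _) (hN _).
have h2 : Ex d (fun w => - ln (k (U w) (V w))) <=
    ln 6 + Ex d (fun w => (1 < `|U w - u0 (V w)|)%R%:R) * ln (2 * N%:R).
  rewrite -ExZr -[X in X + _](Ex_cst d) -ExD; apply: le_Ex => w wd.
  have l6 : 0 <= ln (6 : R) by rewrite ln_ge0 //; lra.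
  rewrite /k ltNge; case: ifP => h /=; rewrite lnV ?posrE ?mulr_gt0 // opprK ?mul0r ?addr0 //.
  by rewrite mul1r lerDr.
have l2 : 0 < ln (2 * N%:R) :> R.
  have N1 : (1 : R) <= N%:R by rewrite ler1n N0.
  by apply: ln_gt0; lra.
rewrite -(ler_pM2r l2); move: hH h1 h2; lra.
Qed.

(** Spread cells have far mass at least be / 2, hence be / 4 on one side of the modal value. That
    side and the modal value itself serve as the two sets, in increasing order. *)
Lemma spread_cells : exists (sp : Vt -> bool) (L M : pred T),
  [/\ be / 2 <= Ex d (fun w => (sp (V w))%:R),
      forall x y, V x = V y -> L x -> M y -> U x + 2 <= U y &
      forall a, supp d a -> sp (V a) ->
        Num.min N%:R^-1 (be / 4) <= Ex (fcond d V (V a)) (fun x => (L x)%:R) /\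
        Num.min N%:R^-1 (be / 4) <= Ex (fcond d V (V a)) (fun x => (M x)%:R)].
Proof.
have [u0 mu0] := modal_exists.
have hb := spread_mass mu0.
pose e v := fcond d V v.
pose up v := Ex (e v) (fun w => (u0 v + 2 <= U w)%R%:R) : R.
pose dn v := Ex (e v) (fun w => (U w + 2 <= u0 v)%R%:R) : R.
pose far v := Ex (e v) (fun w => (1 < `|U w - u0 v|)%R%:R) : R.
pose sp v := be / 2 <= far v.
pose isup v := be / 4 <= up v.
exists sp, (fun x => if isup (V x) then U x == u0 (V x) else U x + 2 <= u0 (V x)),
  (fun x => if isup (V x) then u0 (V x) + 2 <= U x else U x == u0 (V x)).
split.
- have E : Ex d (fun w => (1 < `|U w - u0 (V w)|)%R%:R) = Ex d (fun a => far (V a)) :> R.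
    rewrite (Ex_total d V); apply: eq_Ex => a ad; apply: eq_Ex => w.
    by move=> /(supp_cond (pm_gt0 V ad))[_ ->].
  have h : Ex d (fun a => far (V a)) <= Ex d (fun a => (sp (V a))%:R + be / 2).
    apply: le_Ex => a ad; rewrite /sp; case: (lerP (be / 2) (far (V a))) => h; last first.
      by rewrite add0r ltW.
    have : far (V a) <= 1 by apply: Ex_le_cst => w _; rewrite lern1 leq_b1.
    by move: be0; rewrite /=; lra.
  by move: hb; rewrite E => hb; move: h; rewrite ExD Ex_cst; lra.
- move=> x y <-; case: ifP => _; first by move=> /eqP -> /=.
  by move=> h /eqP ->.
move=> a ad spa.
have pv := pm_gt0 V ad.
have Eh F : Ex (e (V a)) F = Ex (fcond d V (V a)) F by [].
have rw (F : bool -> T -> bool) :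
   Ex (fcond d V (V a)) (fun x => (F (isup (V x)) x)%:R) =
   Ex (e (V a)) (fun x => (F (isup (V a)) x)%:R) :> R.
  by apply: eq_Ex => w /(supp_cond pv)[_ ->].
have rw2 (F : int -> T -> bool) :
   Ex (e (V a)) (fun x => (F (u0 (V x)) x)%:R) = Ex (e (V a)) (fun x => (F (u0 (V a)) x)%:R) :> R.
  by apply: eq_Ex => w /(supp_cond pv)[_ ->].
have mid : Num.min N%:R^-1 (be / 4) <= Ex (e (V a)) (fun x => (U x == u0 (V x))%:R).
  rewrite (rw2 (fun u x => U x == u)); apply: le_trans (mu0 a ad).
  by rewrite ge_min lexx.
rewrite (rw (fun b x => if b then U x == u0 (V x) else U x + 2 <= u0 (V x))).
rewrite (rw (fun b x => if b then u0 (V x) + 2 <= U x else U x == u0 (V x))).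
rewrite /isup; case: (lerP (be / 4) (up (V a))) => h; split => //.
  by rewrite (rw2 (fun u x => u + 2 <= U x)) ge_min h orbT.
rewrite (rw2 (fun u x => U x + 2 <= u)) ge_min; apply/orP; right.
rewrite -/(dn (V a)).
have : far (V a) <= up (V a) + dn (V a).
  rewrite /up /dn -ExD; apply: le_Ex => w _.
  case: ltrP => // h3; last by rewrite addr_ge0.
  have : (u0 (V a) + 2 <= U w) || (U w + 2 <= u0 (V a)) by lia.
  by case/orP => ->; rewrite ?lerDl ?lerDr.
by move: spa; rewrite /sp; lra.
Qed.

End FromEntropy.

(** [avg_cell] inside the spread cells, the trivial bound [q0] in the others. *)
Lemma averaging (T Vt : eqType) (d : fdist R T) (V : T -> Vt) (Y : T -> R)
    (sp : Vt -> bool) (L M : pred T) (th : R) : 0 < th ->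
  (forall x y, V x = V y -> L x -> M y -> Y x + 1 <= Y y) ->
  (forall a, supp d a -> sp (V a) ->
     th <= Ex (fcond d V (V a)) (fun x => (L x)%:R) /\
     th <= Ex (fcond d V (V a)) (fun x => (M x)%:R)) ->
  forall (f : T -> R) (q0 q1 : R), (forall x, supp d x -> f x <= q0) ->
  (forall x y, supp d x -> supp d y -> V x = V y -> Y x + 1 <= Y y ->
     f x + f y <= q1) ->
  Ex d f <= (1 - 2 * (th * Ex d (fun w => (sp (V w))%:R))) * q0 +
            th * Ex d (fun w => (sp (V w))%:R) * q1.
Proof.
move=> th0 LM hsp f q0 q1 fq fp; rewrite (Ex_total d V).
apply: (@le_trans _ _ (Ex d (fun a => q0 + (sp (V a))%:R * (th * (q1 - 2 * q0))))).
  apply: le_Ex => a ad; have pv := pm_gt0 V ad.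
  have fq' x : supp (fcond d V (V a)) x -> f x <= q0.
    by move=> /(supp_cond pv)[xd _]; exact: fq.
  case: (boolP (sp (V a))) => spa; last by rewrite mul0r addr0; exact: Ex_le_cst.
  have [hL hM] := hsp a ad spa.
  have := @avg_cell R T (fcond d V (V a)) (predI (fun x => V x == V a) L)
     (predI (fun x => V x == V a) M) f q0 q1 th th0 fq'.
  have EL (K : pred T) : Ex (fcond d V (V a)) (fun x => (predI (fun x => V x == V a) K x)%:R) =
     Ex (fcond d V (V a)) (fun x => (K x)%:R) :> R.
    by apply: eq_Ex => x /(supp_cond pv)[_ /= ->]; rewrite eqxx.
  rewrite !EL => h; apply: le_trans (h _ _ hL hM) _; last by rewrite mul1r; lra.
    move=> x y /(supp_cond pv)[xd xv] /(supp_cond pv)[yd yv] /andP[_ Lx] /andP[_ My].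
    by apply: fp => //; rewrite ?xv ?yv //; apply: LM => //; rewrite xv yv.
  move=> x _; apply/negP => /andP[/andP[_ Lx] /andP[_ Mx]].
  by have := LM x x erefl Lx Mx; lra.
by rewrite ExD Ex_cst ExZr; lra.
Qed.

(* Littlewood-Offord in entropy form: cells of unit size carrying conditional
   entropy force the k-fold sum to have conditional entropy about ln k / 2. *)
Theorem sum_entropy (T Vt : eqType) (d : fdist R T) (Y : T -> R) (V : T -> Vt)
    (S : Vt -> seq int) (N : nat) (be : R) :
  (forall w, supp d w -> Num.floor (Y w) \in S (V w)) ->
  (forall v, (size (S v) <= N)%N) -> 0 < be -> be <= 1 ->
  ln 6 + be * ln (2 * N%:R) <=
    Hent d (fun w => (Num.floor (Y w), V w)) - Hent d V ->
  exists2 th : R, 0 < th <= 2^-1 /\ Num.min N%:R^-1 (be / 4) * (be / 2) <= th &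
  forall k, - ln (survive th k 1) <=
    Hent (fpow d k) (fun l => (Num.floor (\sum_(x <- l) Y x), map V l)) -
    Hent (fpow d k) (fun l => map V l).
Proof.
move=> hS hN be0 be1 hH.
have [sp [L [M [h1 h2 h3]]]] := spread_cells hS hN be0 hH.
have N0 : (0 < N)%N.
  have [w wd] := supp_exists d; apply: leq_trans (hN (V w)).
  by case: (S _) (hS w wd).
have NR : (0 : R) < N%:R by rewrite ltr0n.
set mn := Num.min _ _ in h3 *.
have mn0 : 0 < mn by rewrite lt_min invr_gt0 NR divr_gt0.
have mn4 : mn <= 4^-1.
  by rewrite /mn ge_min; apply/orP; right; lra.
set P := Ex d (fun w => (sp (V w))%:R) in h1.
have P1 : P <= 1 by apply: Ex_le_cst => w _; rewrite lern1 leq_b1.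
have P0 : 0 < P by move: be0 h1; lra.
exists (mn * P).
  split; last by rewrite ler_wpM2l // ltW.
  rewrite mulr_gt0 //=; apply: le_trans (_ : 4^-1 * 1 <= _); last by lra.
  by apply: ler_pM => //; exact: ltW.
(* Integer parts at distance 2 guarantee a real distance of at least 1. *)
have LM x y : V x = V y -> L x -> M y -> Y x + 1 <= Y y.
  move=> Vxy Lx My; have := h2 x y Vxy Lx My; rewrite -(ler_int R) intrD /=.
  have /andP[_] := floor_itv (Y x); have /andP[] := floor_itv (Y y).
  by rewrite intrD /=; lra.
have av := averaging mn0 LM h3.
move=> k; apply: cond_entropy_ge_ln => W.
(* A guess of the integer part is right exactly when the sum lies in one unit window, so the walk
   starts at 1. *)
have := @window_bound R T Vt d V Y (mn * P) av k (fun v => [:: (W v)%:~R]) 1.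
move=> /(_ (fun _ => isT) (fun _ => erefl)); apply: le_trans.
apply: le_Ex => l _; rewrite /inw /= orbF ler_nat.
case: eqP => // <-; rewrite floor_le /=.
by have /andP[_] := floor_itv (\sum_(x <- l) Y x); rewrite intrD /= => ->.
Qed.

End Spread.

Section Aux.
Variable R : realType.

Lemma Q_scale (r s x : R) : 0 <= r -> r <= s -> 0 < s ->
  `|(Q r x)%:~R - r / s * (Q s x)%:~R| <= 2.
Proof.
move=> r0 rs s0; have h1 := Q_near r x; have h2 := Q_near s x.
have -> : (Q r x)%:~R - r / s * (Q s x)%:~R =
  ((Q r x)%:~R - r * x) - r / s * ((Q s x)%:~R - s * x).
  by field; rewrite gt_eqF.
apply: le_trans (ler_normB _ _) _; have -> : 2 = 1 + 1 :> R by ring.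
apply: lerD => //; rewrite normrM -[leRHS]mulr1 ler_pM //.
by rewrite ger0_norm ?divr_ge0 ?ler_pdivrMr ?mul1r // ltW.
Qed.

Lemma sum_uniq_sub (T : eqType) (s s' : seq T) (F : T -> R) : (forall x, 0 <= F x) ->
  uniq s -> uniq s' -> {subset s <= s'} -> \sum_(x <- s) F x <= \sum_(x <- s') F x.
Proof.
move=> F0 us us' ss; rewrite [leRHS](bigID (mem s)) /= -[X in _ <= X + _]big_filter.
rewrite (perm_big [seq x <- s' | x \in s]) /=; last first.
  apply: uniq_perm => //; first exact: filter_uniq.
  by move=> x; rewrite mem_filter andb_idr // => /ss.
by rewrite lerDl sumr_ge0.
Qed.

Lemma sum_half_iota n : \sum_(i <- iota 0 n) (2^-1 : R) ^+ i <= 2.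
Proof.
suff -> : \sum_(i <- iota 0 n) (2^-1 : R) ^+ i = 2 - 2 * 2^-1 ^+ n.
  by rewrite lerBlDr lerDl mulr_ge0 // exprn_ge0 // invr_ge0.
elim: n => [|n IH]; first by rewrite big_nil expr0; ring.
by rewrite -addn1 iotaD big_cat /= big_seq1 IH addn1 exprS add0n; field.
Qed.

Lemma sum_half_nat (s : seq nat) : uniq s -> \sum_(i <- s) (2^-1 : R) ^+ i <= 2.
Proof.
move=> us; apply: le_trans (sum_half_iota (\max_(i <- s) i).+1).
apply: sum_uniq_sub; rewrite ?iota_uniq //.
by move=> i si; rewrite mem_iota /= add0n ltnS; apply: leq_bigmax_seq.
Qed.

Lemma sum_half_int (s : seq int) (c : int) : uniq s ->
  \sum_(u <- s) (2^-1 : R) ^+ absz (u - c) <= 4.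
Proof.
move=> us; rewrite (bigID (fun u => c <= u)) /=.
have h (P : pred int) : {in s & , forall u v, P u -> P v -> absz (u - c) = absz (v - c) -> u = v} ->
    \sum_(u <- s | P u) (2^-1 : R) ^+ absz (u - c) <= 2.
  move=> inj; rewrite -big_filter.
  rewrite -(big_map (fun u : int => absz (u - c)) predT (fun i => 2^-1 ^+ i)).
  apply: sum_half_nat; rewrite map_inj_in_uniq ?filter_uniq // => u v.
  by rewrite !mem_filter => /andP[Pu us'] /andP[Pv vs]; apply: inj.
have -> : 4 = 2 + 2 :> R by ring.
by apply: lerD; apply: h => u v _ _; lia.
Qed.

(** For errors that are bounded only on average: the geometric code 2^-|u - g| / 4 has a length
    linear in the error. *)
Lemma H_mean_near (T V : eqType) (d : fdist R T) (X : T -> int) (Y : T -> V)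
    (g : V -> int) :
  Hent d (fun w => (X w, Y w)) <= Hent d Y + ln 4 +
    Ex d (fun w => `|(X w - g (Y w))%:~R|).
Proof.
pose k (u : int) (v : V) : R := 4^-1 * 2^-1 ^+ absz (u - g v).
have k0 u v : 0 < k u v by rewrite /k mulr_gt0 ?invr_gt0 // exprn_gt0 // invr_gt0.
have := @H_pair_kernel _ _ d _ _ X Y (fun _ => undup [seq X z.2 | z <- fdl d]) k.
move=> h; apply: le_trans (h _ k0 _) _.
- by move=> w /mapP[z zd ->]; rewrite mem_undup map_f.
- move=> w wd; rewrite /k -big_distrr /= mulrC ler_pdivrMr // mul1r.
  exact: sum_half_int (undup_uniq _).
rewrite -addrA lerD2l -[X in _ <= X + _](Ex_cst d) -ExD; apply: le_Ex => w wd.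
rewrite /k lnM ?posrE ?invr_gt0 ?exprn_gt0 ?invr_gt0 // opprD lnV ?posrE // opprK lerD2l.
rewrite lnXn ?invr_gt0 // lnV ?posrE // mulNrn opprK.
have l2 : ln 2 <= 1 :> R by have := @ln_le_sub1 R 2; lra.
have l20 : 0 <= ln 2 :> R by rewrite ln_ge0 //; lra.
rewrite -intr_norm -abszE -pmulrn -[_ *+ absz _]mulr_natr.
by rewrite ler_piMl.
Qed.

Lemma survive_gt0 (th : R) k r : 0 < th -> th <= 2^-1 -> 0 < survive th k r.+1.
Proof.
move=> th0 th2; elim: k r => [|k IH] r; first by rewrite /= ltr01.
have h0 : 0 <= survive th k r by case: r => [|r]; [rewrite survive0|exact/ltW].
rewrite /=; have := IH r; have := IH r.+1; move: h0.
move: (survive th k r) (survive th k r.+1) (survive th k r.+2) => a b c a0 c0 b0.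
apply: ltr_wpDl; first by rewrite mulr_ge0 ?(ltW b0) //; lra.
by rewrite mulr_gt0 // ltr_pwDl.
Qed.

(** K of order sqrt k balances the two terms of [survive1_le]. *)
Lemma survive_sqrt (th : R) k : 0 < th -> th <= 2^-1 -> (0 < k)%N ->
  ln k%:R / 2 - ln (1 + th^-1) <= - ln (survive th k 1).
Proof.
move=> th0 th2 k0.
have k1 : (1 : R) <= k%:R by rewrite ler1n.
set s := Num.sqrt (k%:R : R).
have ss : s * s = k%:R by rewrite -expr2 sqr_sqrtr //; lra.
have s1 : 1 <= s by rewrite -[1]sqrtr1 ler_sqrt //; lra.
have h := @survive1_le R th th0 th2 (Num.truncn s).+1 k isT k0.
have b1 : s < (Num.truncn s).+1%:R by rewrite truncnS_gt.
have b2 : (Num.truncn s).+1%:R <= 2 * s.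
  by have /andP[h1 _] := truncn_itv (le_trans ler01 s1); rewrite -natr1; lra.
have sp : 0 < 1 + th^-1 by rewrite addr_gt0 ?invr_gt0.
have h2 : survive th k 1 <= (1 + th^-1) / s.
  apply: le_trans h _; rewrite [leRHS]mulrDl mul1r; apply: lerD.
    by rewrite lef_pV2 ?posrE // ?ltW //; lra.
  rewrite -ss ler_pdivrMr ?mulr_gt0 //; try lra.
  have -> : th^-1 / s * (2 * th * (s * s)) = 2 * s by field; rewrite !gt_eqF //; lra.
  by [].
have -> : ln k%:R / 2 - ln (1 + th^-1) = - ln ((1 + th^-1) / s).
  rewrite ln_div ?posrE //; last by lra.
  rewrite -ss lnM ?posrE; try lra.
by rewrite lerN2 ler_ln ?posrE ?survive_gt0 // divr_gt0 //; lra.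
Qed.

End Aux.

Section BlockAux.
Variable R : realType.

Lemma half_ln_ge (k l : nat) : expR (l%:R : R) ^+ 2 <= k%:R -> l%:R <= ln (k%:R : R) / 2.
Proof.
move=> h; have e0 : 0 < expR (l%:R : R) ^+ 2 by rewrite exprn_gt0 // expR_gt0.
have k0 : 0 < k%:R :> R by exact: lt_le_trans h.
have : ln (expR (l%:R : R) ^+ 2) <= ln k%:R by rewrite ler_ln.
have -> : ln (expR (l%:R : R) ^+ 2) = l%:R + l%:R.
  by rewrite lnXn ?expR_gt0 // expRK.
lra.
Qed.

(** Linear errors are traded for squares by |z| <= z^2 + 1, so that a variance bound applies. *)
Lemma near_chain (q f x b z C : R) : `|q - b| <= 1 -> f <= x -> x < f + 1 ->
  `|b - x - z| <= C -> `|q - f| <= z ^+ 2 + (C + 3).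
Proof.
have h6 := sqr_ge0 (z - 1); have h7 := sqr_ge0 (z + 1); have h8 := sqr_ge0 z.
rewrite !ler_norml => /andP[? ?] ? ? /andP[? ?]; apply/andP; split; lra.
Qed.

End BlockAux.

(** * Entropy of a k-fold sum between two scales *)

Section Blocks.
Variables (R : realType) (S : wifs R).
Local Notation A := ('I_(wm S).+1).
Local Notation E j := (expR (j%:R : R)).
Local Notation C0 := (Ctr S).
Local Notation c := (cmin S).

Lemma E_gt0 j : 0 < E j. Proof. exact: expR_gt0. Qed.
Lemma E_ge1 j : 1 <= E j. Proof. by rewrite -expR0 ler_expR. Qed.
Lemma ED i j : E (i + j)%N = E i * E j. Proof. by rewrite natrD expRD. Qed.
Lemma E_le i j : (i <= j)%N -> E i <= E j. Proof. by rewrite ler_expR ler_nat. Qed.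

Variables (T : eqType) (d : fdist R T) (Y : T -> R) (g : R) (n i l k : nat).
Hypothesis hil : (i + l <= n)%N.
Hypothesis g_ge : c <= `|g|.
Hypothesis g_le : `|g| <= 1.
(** With k of order e^(2 l), a sum of k independent variables confined to cells of length e^-(i+l)
    fluctuates by about e^-i. Given the cells, it is known at scale e^-i and may still be fully
    spread at scale e^-(i+l). *)
Hypothesis hk : k%:R <= 2 * E l ^+ 2.

Definition blockD := fprod (fpow d k) (Stop S (E n * `|g|)).
Definition blockS (z : seq T * seq A) : R := \sum_(x <- z.1) Y x + g * trw S z.2.
(** The last word of [blockD] is cut where its contraction times |g| reaches e^-i: the first part is
    visible at that scale, the second is a fresh copy of mu. *)
Definition blockD2 := fpair (fprod (fpow d k) (Stop S (E i * `|g|)))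
  (fun z => Stop S (E n * `|g| * `|lamw S z.2|)).
Definition blockS2 (z : seq T * seq A * seq A) : R :=
  \sum_(x <- z.1.1) Y x + g * trw S (z.1.2 ++ z.2).
Definition cell x := Q (E (i + l)) (Y x).
(** Determines the block sum at scale e^-i up to a bounded mean error, see [block_coarse]. *)
Definition blockG (z : seq T * seq A * seq A) := (map cell z.1.1, z.1.2).

Lemma block_law (U : eqType) (F : R -> U) :
  Hent blockD (fun z => F (blockS z)) = Hent blockD2 (fun z => F (blockS2 z)).
Proof.
apply: H_law => f; rewrite Ex_prod [RHS]Ex_pair Ex_prod; apply: eq_Ex => l' _.
rewrite (@Stop_cat _ S (E i * `|g|)) // ler_wpM2r // E_le //.
exact: leq_trans (leq_addr _ _) hil.
Qed.

Definition cell_mean (v : int) : R :=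
  Ex d (fun x => (cell x == v)%:R * Y x) / pm d cell v.

Lemma cell_mean_zero : Ex d (fun x => Y x - cell_mean (cell x)) = 0.
Proof.
rewrite ExB (Ex_total d cell Y); apply/eqP; rewrite subr_eq0; apply/eqP.
by apply: eq_Ex => a ad; rewrite Ex_cond ?pm_gt0.
Qed.

Lemma cell_mean_near x : supp d x -> `|Y x - cell_mean (cell x)| <= (E (i + l))^-1.
Proof.
move=> xd; have pv := pm_gt0 cell xd.
have e0 := E_gt0 (i + l).
have h y : cell y = cell x -> (cell x)%:~R / E (i + l) <= Y y <= ((cell x)%:~R + 1) / E (i + l).
  move=> <-; have /andP[h1 h2] := Q_bound (E (i + l)) (Y y).
  by rewrite ler_pdivrMr // ler_pdivlMr // ![Y y * _]mulrC /cell; lra.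
have /andP[y1 y2] := h x erefl.
have m1 : (cell x)%:~R / E (i + l) <= cell_mean (cell x).
  rewrite /cell_mean -Ex_cond //; apply: Ex_ge_cst => y /(supp_cond pv)[_ /h].
  by case/andP.
have m2 : cell_mean (cell x) <= ((cell x)%:~R + 1) / E (i + l).
  rewrite /cell_mean -Ex_cond //; apply: Ex_le_cst => y /(supp_cond pv)[_ /h].
  by case/andP.
move: y1 y2 m1 m2; rewrite mulrDl mul1r ler_norml.
by move: ((cell x)%:~R / E (i + l)) ((E (i + l))^-1) => u v; move=> *; apply/andP; split; lra.
Qed.

Lemma cmin_le_Eg : c <= E i * `|g|.
Proof.
apply: le_trans g_ge _; rewrite ler_peMl //; exact: E_ge1.
Qed.

Definition KB1 : R := ln 4 + (C0 + 5).

Lemma block_coarse :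
  Hent blockD2 (fun z => (Q (E i) (blockS2 z), blockG z)) <= Hent blockD2 blockG + KB1.
Proof.
(* Each summand is replaced by the mean of its cell, so that the errors are centred and their
   variances add. *)
pose ctr (v : seq int * seq A) :=
  Num.floor (E i * (\sum_(u <- v.1) cell_mean u + g * trw S v.2)).
apply: le_trans (@H_mean_near _ _ _ blockD2 (fun z => Q (E i) (blockS2 z)) blockG ctr) _.
rewrite -addrA lerD2l /KB1 lerD2l.
pose Z (l' : seq T) := \sum_(x <- l') (Y x - cell_mean (cell x)).
apply: (@le_trans _ _ (Ex blockD2 (fun z => (E i * Z z.1.1) ^+ 2 + (C0 + 3)))).
  apply: le_Ex => [[[l' w] v]] /supp_pair[/= /supp_prod[/= _ wS] _].
  rewrite /ctr /blockG /= big_map.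
  have h1 := Q_near (E i) (blockS2 (l', w, v)).
  set x := E i * (\sum_(j <- l') cell_mean (cell j) + g * trw S w).
  have /andP[h2 h3] := floor_itv x; rewrite intrD /= in h3.
  have h4 : `|E i * blockS2 (l', w, v) - x - E i * Z l'| <= C0.
    have -> : E i * blockS2 (l', w, v) - x - E i * Z l' =
       E i * g * trw S (w ++ v) - E i * g * trw S w.
      by rewrite /x /blockS2 /Z sumrB /=; ring.
    rewrite trw_cat -mulrBr addrAC subrr add0r mulrA normrM.
    apply: le_trans (trw_le v); rewrite -[leRHS]mul1r ler_wpM2r //.
    by rewrite !normrM (ger0_norm (ltW (E_gt0 i))) (Stop_upper wS).
  by rewrite rmorphB /=; exact: near_chain h1 h2 h3 h4.
rewrite ExD Ex_cst Ex_pair Ex_prod.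
have -> : C0 + 5 = 2 + (C0 + 3) by ring.
rewrite lerD2r.
rewrite (@eq_Ex _ _ _ _ (fun l' => E i ^+ 2 * Z l' ^+ 2)); last first.
  move=> l' _; rewrite -exprMn -[RHS](Ex_cst (Stop S (E i * `|g|))).
  by apply: eq_Ex => w _; rewrite /= Ex_cst.
rewrite ExZ.
have := @variance_pow _ _ d k _ _ cell_mean_zero cell_mean_near.
rewrite exprVn ED exprMn => h.
apply: le_trans (ler_wpM2l (sqr_ge0 (E i)) h) _.
have -> : E i ^+ 2 * (k%:R / (E i ^+ 2 * E l ^+ 2)) = k%:R / E l ^+ 2.
  by field; rewrite !gt_eqF ?E_gt0.
by rewrite ler_pdivrMr ?exprn_gt0 ?E_gt0.
Qed.

(** Given the fine value, the coarse one costs O(1). Conditioning also on [blockG] lowers the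
    entropy, and given [blockG] the coarse value is again O(1). *)
Lemma block_increment :
  Hent blockD2 (fun z => (Q (E (i + l)) (blockS2 z), blockG z)) - Hent blockD2 blockG
    - (KB1 + lnb 2) <=
  Hent blockD (fun z => Q (E (i + l)) (blockS z)) - Hent blockD (fun z => Q (E i) (blockS z)).
Proof.
rewrite (block_law (Q (E i))) (block_law (Q (E (i + l)))).
set P1 := fun z => Q (E (i + l)) (blockS2 z); set P0 := fun z => Q (E i) (blockS2 z).
have h1 : Hent blockD2 (fun z => (P0 z, P1 z)) <= Hent blockD2 P1 + lnb 2.
  apply: (@H_near _ _ _ _ _ _ (fun z : int => E i / E (i + l) * z%:~R)) => // z _.
  by apply: Q_scale; rewrite ?E_gt0 ?(ltW (E_gt0 _)) // E_le // leq_addr.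
have h2 := @H_cond_le _ _ blockD2 _ _ _ P1 (fun z => (P0 z, blockG z)) P0.
have {}h2 := h2 (fun w w' _ _ e => congr1 fst e).
have h3 := block_coarse; rewrite -/P0 in h3.
have h4 : Hent blockD2 (fun z => (P1 z, blockG z)) <=
          Hent blockD2 (fun z => (P1 z, (P0 z, blockG z))).
  by apply: H_fun_le => w w' _ _ [e1 _ e2 e3]; rewrite /blockG e1 e2 e3.
have h5 := H_pairC blockD2 P0 P1.
move: h1 h2 h3 h4 h5.
move: (Hent _ (fun z => (P0 z, P1 z))) (Hent _ (fun z => (P1 z, P0 z)))
  (Hent _ (fun z => (P1 z, (P0 z, blockG z)))) (Hent _ (fun z => (P0 z, blockG z)))
  (Hent _ (fun z => (P1 z, blockG z))) (Hent _ P0) (Hent _ P1) (Hent _ blockG).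
by move: KB1 (lnb 2) => *; lra.
Qed.

Definition KB2 : R := KB1 + lnb 2 + lnb 2 + KS1 S + KS2 S.

(** With all summands and the first part of the word fixed, the rest of the word is still an affine
    copy of mu with about l levels to go. *)
Lemma block_general :
  hS S (E l) - KB2 <=
  Hent blockD (fun z => Q (E (i + l)) (blockS z)) - Hent blockD (fun z => Q (E i) (blockS z)).
Proof.
apply: le_trans block_increment; rewrite /KB2.
set P1 := fun z => Q (E (i + l)) (blockS2 z).
have h1 := @H_cond_le _ _ blockD2 _ _ _ P1 fst blockG.
have {}h1 : Hent blockD2 (fun w => (P1 w, w.1)) - Hent blockD2 fst <=
     Hent blockD2 (fun w => (P1 w, blockG w)) - Hent blockD2 blockG.
  by apply: h1 => w w' _ _ e; rewrite /blockG e.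
have h2 : Hent blockD2 (fun z => (z.1, P1 z)) = Hent (fprod (fpow d k) (Stop S (E i * `|g|))) id +
   Ex (fprod (fpow d k) (Stop S (E i * `|g|))) (fun a =>
     Hent (Stop S (E n * `|g| * `|lamw S a.2|)) (fun b => P1 (a, b))).
  by apply: H_pair_chain => a a' F _ _ ->.
have h3 : Hent blockD2 fst = Hent (fprod (fpow d k) (Stop S (E i * `|g|))) id.
  exact: (@H_fst _ _ _ _ _ _ id).
have h4 := H_pairC blockD2 P1 fst.
suff h5 : hS S (E l) - KS1 S - KS2 S - lnb 2 <=
   Ex (fprod (fpow d k) (Stop S (E i * `|g|))) (fun a =>
     Hent (Stop S (E n * `|g| * `|lamw S a.2|)) (fun b => P1 (a, b))) by lra.
apply: Ex_ge_cst => [[l' w]] /supp_prod[/= _ wS].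
have u := Stop_upper wS; have lo := Stop_lower cmin_le_Eg wS.
have w0 := lamw_gt0 w.
have g0 : 0 < `|g| by apply: lt_le_trans g_ge; exact: cmin_gt0.
set r := E (i + l) * (`|g| * `|lamw S w|).
have rE : r = E l * (E i * `|g| * `|lamw S w|) by rewrite /r ED; ring.
have r0 : 0 < r by rewrite /r !mulr_gt0 ?E_gt0.
have r1 : r <= E l by rewrite rE ler_piMr // ltW // E_gt0.
have r2 : c * E l <= r by rewrite rE [leRHS]mulrC ler_wpM2r // ltW // E_gt0.
have r3 : r <= E n * `|g| * `|lamw S w|.
  by rewrite -mulrA ler_wpM2r ?E_le // mulr_ge0 // ltW.
have e1 := hS_comparable r0 r1 r2; have e2 := hS_le_later S (ltW r0) r3.
have e3 := @H_affine_ge _ _ (Stop S (E n * `|g| * `|lamw S w|)) (E (i + l))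
   (\sum_(x <- l') Y x + g * trw S w) (g * lamw S w) (trw S).
have {}e3 := e3 (mulf_neq0 _ (lamw_neq0 w)).
have gn : g != 0 by rewrite -normr_gt0.
have {}e3 := e3 gn; rewrite normrM -/r in e3.
have -> : Hent (Stop S (E n * `|g| * `|lamw S w|)) (fun b => P1 (l', w, b)) =
   Hent (Stop S (E n * `|g| * `|lamw S w|)) (fun v => Q (E (i + l))
     (\sum_(x <- l') Y x + g * trw S w + g * lamw S w * trw S v)).
  apply: eq_H => v _; rewrite /P1 /blockS2 /= trw_cat; congr Q; ring.
lra.
Qed.

Variable sg : nat.
Variable be : R.
Hypothesis be0 : 0 < be.
Hypothesis be1 : be <= 1.

(** Length of a list of candidates for the cell [sg] levels finer, once the cell of a summand is
    known. *)
Definition numch : nat := (2 * (Num.truncn (E sg + 1)).+1 + 2)%N.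

Hypothesis hspread : ln 6 + be * ln (2 * numch%:R) <=
  Hent d (fun x => (Q (E (i + l + sg)) (Y x), cell x)) - Hent d cell.

(** A lower bound for the pairing probability that depends on neither [n] nor [k], which keeps [KB3]
    constant. *)
Definition thsp : R := Num.min numch%:R^-1 (be / 4) * (be / 2).
Definition KB3 : R := KB1 + lnb 2 + lnb (2 * E sg + 1) + ln (1 + thsp^-1).

Lemma thsp_gt0 : 0 < thsp.
Proof. by rewrite /thsp mulr_gt0 ?divr_gt0 // lt_min invr_gt0 ltr0n divr_gt0 // andbT. Qed.

(** Here the whole word is fixed and the entropy comes from the summands: if they spread just below
    scale e^-(i+l), [sum_entropy] yields (ln k) / 2 >= l up to a constant. *)
Lemma block_spread : E l ^+ 2 <= k%:R ->
  l%:R - KB3 <=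
  Hent blockD (fun z => Q (E (i + l)) (blockS z)) - Hent blockD (fun z => Q (E i) (blockS z)).
Proof.
move=> hk2.
apply: le_trans block_increment; rewrite /KB3.
set P1 := fun z => Q (E (i + l)) (blockS2 z).
pose G' (z : seq T * seq A * seq A) := (map cell z.1.1, (z.1.2, z.2)).
pose UT (z : seq T * seq A * seq A) := Q (E (i + l + sg)) (\sum_(x <- z.1.1) Y x).
have h1 : Hent blockD2 (fun w => (P1 w, G' w)) - Hent blockD2 G' <=
     Hent blockD2 (fun w => (P1 w, blockG w)) - Hent blockD2 blockG.
  by apply: H_cond_le => w w' _ _ [e1 e2 _]; rewrite /blockG e1 e2.
have h2 : Hent blockD2 (fun w => (UT w, (P1 w, G' w))) <=
          Hent blockD2 (fun w => (P1 w, G' w)) + lnb (2 * E sg + 1).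
  apply: (@H_near _ _ _ _ _ _ (fun v => E sg * (v.1%:~R - E (i + l) * (g * trw S (v.2.2.1 ++ v.2.2.2))))).
    by have := E_gt0 sg; lra.
  move=> [[l' w] v] _ /=.
  have q1 := Q_near (E (i + l + sg)) (\sum_(x <- l') Y x).
  have q2 := Q_near (E (i + l)) (blockS2 (l', w, v)).
  rewrite /UT /P1 /=.
  set X := Q _ _ in q1 *; set X' := Q _ _ in q2 *.
  have -> : X%:~R - E sg * (X'%:~R - E (i + l) * (g * trw S (w ++ v))) =
     (X%:~R - E (i + l + sg) * (\sum_(x <- l') Y x)) -
     E sg * (X'%:~R - E (i + l) * blockS2 (l', w, v)).
    by rewrite /blockS2 /= (ED (i + l) sg); ring.
  apply: le_trans (ler_normB _ _) _; rewrite normrM (ger0_norm (ltW (E_gt0 sg))).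
  have : E sg * `|X'%:~R - E (i + l) * blockS2 (l', w, v)| <= E sg * 1.
    by rewrite ler_wpM2l // ltW // E_gt0.
  by have := E_gt0 sg; lra.
have h3 : Hent blockD2 (fun w => (UT w, G' w)) <= Hent blockD2 (fun w => (UT w, (P1 w, G' w))).
  by apply: H_fun_le => w w' _ _ [e1 _ e2 e3 e4]; rewrite /G' e1 e2 e3 e4.
pose DS := fpair (Stop S (E i * `|g|)) (fun w => Stop S (E n * `|g| * `|lamw S w|)).
have law (U : eqType) (F : seq T -> U) :
    Hent blockD2 (fun z => (F z.1.1, (z.1.2, z.2))) = Hent (fpow d k) F + Hent DS id.
  rewrite -H_prod; apply: H_law => f; rewrite Ex_prod Ex_pair Ex_prod.
  by apply: eq_Ex => l' _; rewrite Ex_pair.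
have h4 : Hent blockD2 (fun w => (UT w, G' w)) =
   Hent (fpow d k) (fun l' => (Q (E (i + l + sg)) (\sum_(x <- l') Y x), map cell l')) + Hent DS id.
  by rewrite -law; apply: H_fun_eq => w w' _ _; rewrite /UT /G' => -[-> -> -> ->].
have h5 : Hent blockD2 G' = Hent (fpow d k) (map cell) + Hent DS id by rewrite -law.
have [||th [/andP[th0 th2] th3] h6] := @sum_entropy R T _ d (fun x => E (i + l + sg) * Y x) cell
   (fun v => near_ints (E sg * v%:~R) (E sg + 1)) numch be _ _ be0 be1 hspread.
- move=> x _; apply: mem_near_ints; first by have := E_gt0 sg; lra.
  have q1 := Q_near (E (i + l + sg)) (Y x).
  have q2 := Q_near (E (i + l)) (Y x); rewrite -/(cell x) in q2.
  rewrite -/(Q _ _).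
  have -> : (Q (E (i + l + sg)) (Y x))%:~R - E sg * (cell x)%:~R =
     ((Q (E (i + l + sg)) (Y x))%:~R - E (i + l + sg) * Y x) -
     E sg * ((cell x)%:~R - E (i + l) * Y x).
    by rewrite (ED (i + l) sg); ring.
  apply: le_trans (ler_normB _ _) _; rewrite normrM (ger0_norm (ltW (E_gt0 sg))).
  have : E sg * `|(cell x)%:~R - E (i + l) * Y x| <= E sg * 1.
    by rewrite ler_wpM2l // ltW // E_gt0.
  lra.
- by move=> v; rewrite size_near_ints.
have k0 : (0 < k)%N.
  by rewrite -(ltr0n R); apply: lt_le_trans hk2; rewrite exprn_gt0 // E_gt0.
have h7 := survive_sqrt th0 th2 k0; have h8 := h6 k.
have h9 : Hent (fpow d k) (fun l' => (Num.floor (\sum_(x <- l') E (i + l + sg) * Y x), map cell l'))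
  = Hent (fpow d k) (fun l' => (Q (E (i + l + sg)) (\sum_(x <- l') Y x), map cell l')).
  by apply: eq_H => l' _; rewrite /Q big_distrr.
have h10 := half_ln_ge hk2.
have h11 : ln (1 + th^-1) <= ln (1 + thsp^-1).
  rewrite ler_ln ?posrE ?addr_gt0 ?invr_gt0 ?thsp_gt0 // lerD2l lef_pV2 ?posrE ?thsp_gt0 //.
rewrite h9 in h8; lra.
Qed.

End Blocks.

(** * The inverse theorem *)

Section InverseAux.
Variable R : realType.
Local Notation E j := (expR (j%:R : R)).

(** Telescoping along all residues modulo l at once. *)
Lemma shift_sum (f : nat -> R) l k :
  \sum_(i < k) (f (i + l)%N - f i) = \sum_(j < l) f (k + j)%N - \sum_(j < l) f j.
Proof.
have step i : \sum_(j < l) f (i.+1 + j)%N = \sum_(j < l) f (i + j)%N + f (i + l)%N - f i.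
  elim: l => [|l IH]; first by rewrite !big_ord0 addn0; ring.
  rewrite !big_ord_recr /= IH addSnnS; ring.
elim: k => [|k IH]; first by rewrite big_ord0; under eq_bigr do rewrite add0n; ring.
by rewrite big_ord_recr /= IH step; ring.
Qed.

Lemma lnb_E (a : nat) (u v : R) : 0 <= u -> 0 <= v ->
  lnb (u * E a + v) <= a%:R + (2 * u + 2 * v + 4).
Proof.
move=> u0 v0; have e1 := E_ge1 R a; have e0 := E_gt0 R a.
have p : 0 < 2 * u + 2 * v + 4 by lra.
apply: (@le_trans _ _ (ln (E a * (2 * u + 2 * v + 4)))).
  rewrite /lnb ler_ln ?posrE ?mulr_gt0 //; last first.
    by have h : 0 <= u * E a; [rewrite mulr_ge0 // ltW|lra].
  have : v * 1 <= v * E a by rewrite ler_wpM2l.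
  by move: e1; lra.
rewrite lnM ?posrE // expRK lerD2l.
by have := ln_le_sub1 p; lra.
Qed.

Lemma ln_numch sg : ln (2 * (numch R sg)%:R) <= sg%:R + 20 :> R.
Proof.
have e1 := E_ge1 R sg.
have nc : (numch R sg)%:R <= 2 * E sg + 6 :> R.
  have p0 : 0 <= E sg + 1 by lra.
  have /andP[h _] := truncn_itv p0.
  by rewrite /numch natrD natrM -[(Num.truncn _).+1%:R]natr1; lra.
apply: (@le_trans _ _ (lnb (2 * E sg + 4))); last first.
  by apply: le_trans (@lnb_E sg 2 4 _ _) _ => //; lra.
by rewrite /lnb ler_ln ?posrE ?mulr_gt0 ?ltr0n //; lra.
Qed.

Lemma arch_nat (x : R) : exists n0, forall n, (n0 <= n)%N -> x <= n%:R.
Proof.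
exists (Num.truncn x).+1 => n h; apply: ltW.
by apply: (lt_le_trans (truncnS_gt x)); rewrite ler_nat.
Qed.

Lemma max3 a b c : exists l, [/\ (0 < l)%N, (a <= l)%N, (b <= l)%N & (c <= l)%N].
Proof. by exists (maxn 1 (maxn a (maxn b c))); split; lia. Qed.

Lemma arith_top M l s j n : n = (M + l + s)%N -> (j < s)%N -> n = (M + j + l + (s - j))%N.
Proof. lia. Qed.

Lemma arith_split n l s : (l + s <= n)%N -> n = (n - (l + s) + l + s)%N.
Proof. lia. Qed.

Lemma arith_mid n l s i : (l + s <= n)%N -> (i < n - (l + s))%N -> (i + l <= n)%N.
Proof. lia. Qed.

Lemma arith_low n l s j : (l + s <= n)%N -> (j < l)%N -> (n - (l + s) + j <= n)%N.
Proof. lia. Qed.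

Lemma arith_count (s n l M e G x : R) : 20 <= s -> 0 <= G -> M <= n -> 0 < e ->
  s * (e * n - l - 2 * s - 14) <= x -> x <= G * (s + 8) + M * (e * s / 2) ->
  e * n / 4 - (l + 2 * s + 14) / 2 <= G.
Proof.
move=> s20 G0 Mn e0 h1 h2.
have s0 : 0 < s by lra.
have h3 : M * (e * s / 2) <= n * (e * s / 2).
  by rewrite ler_wpM2r // divr_ge0 // mulr_ge0 // ltW.
have h4 : G * (s + 8) <= G * (2 * s) by rewrite ler_wpM2l //; lra.
by rewrite -(ler_pM2l s0); lra.
Qed.

Lemma arith_sum (s n l e x y : R) : 0 <= s ->
  s * (e * n - s - 8) <= x -> y <= s * (l + s + 6) ->
  s * (e * n - l - 2 * s - 14) <= x - y.
Proof. lra. Qed.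

Lemma arith_spread (x y e s : R) : e <= 1 -> 20 <= e * s -> x <= 6 - 1 ->
  y <= e / 8 * (s + 20) -> x + y <= e * s / 2.
Proof. lra. Qed.

Lemma arith_key (s n l M al e G h lb : R) : 0 <= al -> al < 1 -> 0 <= s -> 0 <= l ->
  0 < e -> M = n - (l + s) ->
  e * n / 4 - (l + 2 * s + 14) / 2 <= G ->
  M * (al - e * (1 - al) / 32) + G * ((1 - al) / 2) <= h + lb ->
  lb + (l + s) + (l + 2 * s + 20) <= n * ((1 - al) * e / 32) ->
  (al + (1 - al) * e / 16) * n <= h.
Proof.
move=> al0 al1 s0 l0 e0 EM hG key hn.
have p1 : 0 < 1 - al by lra.
have h1 : (e * n / 4 - (l + 2 * s + 14) / 2) * ((1 - al) / 2) <= G * ((1 - al) / 2).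
  by rewrite ler_wpM2r //; lra.
have h2 : (l + 2 * s + 14) / 2 * ((1 - al) / 2) <= l + 2 * s + 20.
  have p : 0 <= (l + 2 * s + 14) / 2 by lra.
  by apply: le_trans (ler_wpM2l p (_ : (1 - al) / 2 <= 1)) _; lra.
have h3 : (l + s) * al <= (l + s) * 1 by rewrite ler_wpM2l //; lra.
have h4 : 0 <= (l + s) * (e * (1 - al) / 32) by rewrite !mulr_ge0 //; lra.
by rewrite {}EM in key; lra.
Qed.

Section UnitInterval.
Variables (T : eqType) (d : fdist R T) (Y : T -> R).
Hypothesis Y01 : forall x, supp d x -> 0 <= Y x <= 1.
Let F j := Hent d (fun x => Q (E j) (Y x)).

Lemma unit_entropy_le j : F j <= j%:R + 6.
Proof.
have e0 := E_gt0 R j.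
have : F j <= Hent d (fun=> tt) + lnb (E j).
  apply: (@H_near_le _ _ _ _ _ _ (fun=> 0)) => [|x xd]; first exact: ltW.
  have /andP[y0 y1] := Y01 xd; rewrite subr0 ger0_norm.
    have /andP[_] := Q_bound (E j) (Y x); move/le_trans; apply.
    by rewrite ler_piMr // ltW.
  by rewrite ler0z floor_ge0 mulr_ge0 // ltW.
rewrite H_cst add0r => h; apply: le_trans h _.
have := @lnb_E j 1 0; rewrite mul1r addr0 => h; apply: le_trans (h _ _) _ => //; lra.
Qed.

Lemma unit_near i a x :
  `|(Q (E (i + a)) (Y x))%:~R - E a * (Q (E i) (Y x))%:~R| <= E a + 1.
Proof.
have q1 := Q_near (E (i + a)) (Y x); have q2 := Q_near (E i) (Y x).
have -> : (Q (E (i + a)) (Y x))%:~R - E a * (Q (E i) (Y x))%:~R =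
   ((Q (E (i + a)) (Y x))%:~R - E (i + a) * Y x) -
   E a * ((Q (E i) (Y x))%:~R - E i * Y x) by rewrite ED; ring.
apply: le_trans (ler_normB _ _) _; rewrite normrM (ger0_norm (ltW (E_gt0 R a))).
have : E a * `|(Q (E i) (Y x))%:~R - E i * Y x| <= E a * 1.
  by rewrite ler_wpM2l // ltW // E_gt0.
lra.
Qed.

Lemma unit_cond_le i a :
  Hent d (fun x => (Q (E (i + a)) (Y x), Q (E i) (Y x))) - F i <= a%:R + 8.
Proof.
have e0 := E_gt0 R a.
have : Hent d (fun x => (Q (E (i + a)) (Y x), Q (E i) (Y x))) <= F i + lnb (E a + 1).
  apply: (@H_near _ _ _ d _ _ (fun v : int => E a * v%:~R)); first lra.
  by move=> x _; exact: unit_near.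
have := @lnb_E a 1 1; rewrite mul1r => /(_ ler01 ler01); lra.
Qed.

Lemma unit_entropy_drop i a : F (i + a) <= F i + a%:R + 8.
Proof.
have := unit_cond_le i a.
have := H_pair_ge1 d (fun x => Q (E (i + a)) (Y x)) (fun x => Q (E i) (Y x)).
rewrite -/(F (i + a)); lra.
Qed.

End UnitInterval.
End InverseAux.

Section Inverse.
Variables (R : realType) (S : wifs R).
Local Notation A := ('I_(wm S).+1).
Local Notation E j := (expR (j%:R : R)).
Local Notation c := (cmin S).
Variables (al C : R).
Hypothesis al0 : 0 <= al.
Hypothesis al1 : al < 1.
Hypothesis hS_up : forall n, hS S (E n) <= al * n%:R + C.
Hypothesis hS_low : forall e, 0 < e -> exists n0, forall n, (n0 <= n)%N ->
    (al - e) * n%:R <= hS S (E n).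

(** A level i is good if [Y] has enough entropy between e^-(i+l) and e^-(i+l+sg); by averaging a
    proportion of order e of the levels is good. There the k-fold sum gains nearly l, elsewhere
    nearly al l as mu alone does. Since al < 1, the total exceeds al n linearly. *)
Lemma inverse_lower (e : R) : 0 < e -> e <= 1 -> exists k n1 : nat, (0 < k)%N /\
  forall n, (n1 <= n)%N -> forall (T : eqType) (d : fdist R T) (Y : T -> R) (g : R),
  (forall x, supp d x -> 0 <= Y x <= 1) -> c <= `|g| -> `|g| <= 1 ->
  e * n%:R <= Hent d (fun x => Q (E n) (Y x)) ->
  (al + (1 - al) * e / 16) * n%:R <=
    Hent (blockD S d g n k) (fun z => Q (E n) (blockS Y g z)).
Proof.
move=> e0 e1.
have b1 : 0 < 1 - al by rewrite subr_gt0.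
(* Makes e sg / 2 at least 5 + (e / 8) (sg + 20), the entropy that [block_spread] asks of a good
   level. *)
have [sg0 hsg0] := arch_nat (20 / e); pose sg := sg0.
have sgR : 20 / e <= sg%:R by exact: hsg0.
have sgR2 : 20 <= e * sg%:R by rewrite mulrC -ler_pdivrMr.
have sg20 : 20 <= sg%:R :> R.
  by apply: le_trans sgR2 _; rewrite ler_piMl.
pose be := e / 8.
have be0 : 0 < be by rewrite divr_gt0.
have be1 : be <= 1 by rewrite /be; lra.
pose eta := e * (1 - al) / 32.
have eta0 : 0 < eta by rewrite /eta !mulr_gt0.
(* [l] is chosen after [sg] and [be], large enough to outweigh the constants of [block_general] and
   [block_spread]. *)
have [l1 hl1] := hS_low (divr_gt0 eta0 (ltr0n R 2)).
have [l2 hl2] := arch_nat (`|KB2 S| * 2 / eta).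
have [l3 hl3] := arch_nat ((`|C| + `|KB3 S sg be| + `|KB2 S|) * 2 / (1 - al)).
have [l [l_gt0 le1 le2 le3]] := max3 l1 l2 l3.
have lR : 0 < l%:R :> R by rewrite ltr0n.
have {}hl1 : (al - eta / 2) * l%:R <= hS S (E l) by exact: hl1.
have {}hl2 : `|KB2 S| * 2 / eta <= l%:R by exact: hl2.
have {}hl3 : (`|C| + `|KB3 S sg be| + `|KB2 S|) * 2 / (1 - al) <= l%:R. by exact: hl3.
have a_ge : (al - eta) * l%:R <= hS S (E l) - KB2 S.
  rewrite ler_pdivrMr // in hl2; have := ler_norm (KB2 S).
  by move: hl1 hl2; rewrite !mulrBl; lra.
have b_ge : (1 - al) * l%:R / 2 <= l%:R - KB3 S sg be - (hS S (E l) - KB2 S).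
  rewrite ler_pdivrMr // in hl3; have := ler_norm (KB3 S sg be).
  have := ler_norm C; have := ler_norm (- KB2 S); rewrite normrN.
  by have := hS_up l; move: hl3; rewrite !mulrBr mulrBl; lra.
clear hl1 hl2 hl3.
set a := hS S (E l) - KB2 S in a_ge b_ge.
set b := l%:R - KB3 S sg be - a in b_ge.
pose k := (Num.truncn (E l ^+ 2)).+1.
have El2 : 1 <= E l ^+ 2 by rewrite exprn_ege1 // E_ge1.
have hk2 : E l ^+ 2 <= k%:R by rewrite ltW // truncnS_gt.
have hk : k%:R <= 2 * E l ^+ 2.
  have /andP[h _] := truncn_itv (le_trans ler01 El2).
  by rewrite /k -natr1; lra.
pose Cst : R := lnb 2 + (l + sg)%:R + (l%:R + 2 * sg%:R + 20).
have [n1 hn1] := arch_nat (Cst / ((1 - al) * e / 32)).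
exists k, (maxn n1 (l + sg)); split=> // n hn T d Y g Y01 g1 g2 hY.
have [hn2 n0] : (n1 <= n)%N /\ (l + sg <= n)%N by apply/andP; rewrite -geq_max.
have {}hn1 : Cst <= n%:R * ((1 - al) * e / 32).
  by rewrite -ler_pdivrMr ?divr_gt0 ?mulr_gt0 //; apply: hn1.
pose M := (n - (l + sg))%N.
have nM : n = (M + l + sg)%N by exact: arith_split.
have nMR : n%:R = M%:R + l%:R + sg%:R :> R by rewrite nM !natrD.
pose F j := Hent d (fun x => Q (E j) (Y x)).
pose HH j := Hent (blockD S d g n k) (fun z => Q (E j) (blockS Y g z)).
pose ee i := Hent d (fun x => (Q (E (i + l + sg)) (Y x), cell Y i l x)) - F (i + l)%N.
pose good i := e * sg%:R / 2 <= ee i.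
pose G := \sum_(i < M) (good i)%:R : R.
have G0 : 0 <= G by apply: sumr_ge0.
(* Increments over windows of length sg, summed over all starting levels, count the entropy of [Y]
   about sg times. *)
have sumee : sg%:R * (e * n%:R - l%:R - 2 * sg%:R - 14) <= \sum_(i < M) ee i.
  apply: (@le_trans _ _ (\sum_(i < M) (F (i + sg + l)%N - F (i + l)%N))).
    rewrite (shift_sum (fun j => F (j + l)%N)).
    have h1 : sg%:R * (e * n%:R - sg%:R - 8) <= \sum_(j < sg) F (M + j + l)%N.
      rewrite -[X in X%:R * _](card_ord sg) mulr_natl -sumr_const.
      apply: ler_sum => j _.
      have nE := arith_top nM (ltn_ord j).
      have := unit_entropy_drop d Y (M + j + l) (sg - j); rewrite -{1}nE -/(F (M + j + l)%N).
      have : (sg - j)%N%:R <= sg%:R :> R by rewrite ler_nat leq_subr.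
      by move: hY; lra.
    have h2 : \sum_(j < sg) F (j + l)%N <= sg%:R * (l%:R + sg%:R + 6).
      rewrite -[X in X%:R * _](card_ord sg) mulr_natl -sumr_const.
      apply: ler_sum => j _.
      apply: le_trans (unit_entropy_le Y01 (j + l)) _.
      have : (j + l)%N%:R <= l%:R + sg%:R :> R by rewrite -natrD ler_nat addnC leq_add2l ltnW.
      lra.
    exact: arith_sum h1 h2.
  apply: ler_sum => i _; rewrite /ee lerD2r.
  rewrite [(i + sg + l)%N]addnAC.
  exact: H_pair_ge1.
have ee_le i : ee i <= (good i)%:R * (sg%:R + 8) + e * sg%:R / 2.
  rewrite /good; case: (lerP (e * sg%:R / 2) (ee i)) => h; last by rewrite mul0r add0r ltW.
  rewrite mul1r; have := unit_cond_le d Y (i + l) sg; rewrite -/(F _) => h2.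
  by apply: le_trans h2 _; rewrite lerDl; lra.
have GG : e * n%:R / 4 - (l%:R + 2 * sg%:R + 14) / 2 <= G.
  have h : \sum_(i < M) ee i <= G * (sg%:R + 8) + M%:R * (e * sg%:R / 2).
    rewrite /G mulr_suml -[X in X%:R * _](card_ord M) mulr_natl -sumr_const -big_split.
    by apply: ler_sum => i _; exact: ee_le.
  have MnR : M%:R <= n%:R :> R by rewrite ler_nat /M leq_subr.
  exact: arith_count sumee h.
have termP i : (i < M)%N -> a + (good i)%:R * b <= HH (i + l)%N - HH i.
  move=> iM; have il := arith_mid n0 iM.
  have gen := block_general d Y il g1 hk.
  rewrite /good; case: (lerP (e * sg%:R / 2) (ee i)) => h; last first.
    by rewrite mul0r addr0.
  have hsp : ln 6 + be * ln (2 * (numch R sg)%:R) <= ee i.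
    apply: le_trans h; have l6 := @ln_le_sub1 R 6.
    have lnn := ln_numch R sg.
    have lnn3 : be * ln (2 * (numch R sg)%:R) <= be * (sg%:R + 20) by rewrite ler_wpM2l // ltW.
    by apply: (arith_spread e1 sgR2 (l6 _) lnn3).
  have spr := block_spread S g il hk be0 be1 hsp hk2.

  by rewrite mul1r /b addrC subrK.
(* In the same way, increments over blocks of length l count the final entropy l times. *)
have sumH : M%:R * a + G * b <= l%:R * (HH n + lnb 2).
  apply: (@le_trans _ _ (\sum_(i < M) (HH (i + l)%N - HH i))).
    rewrite /G mulr_suml -[X in X%:R * _](card_ord M) mulr_natl -sumr_const -big_split.
    by apply: ler_sum => i _; exact: termP.
  rewrite shift_sum.
  have h1 : \sum_(j < l) HH (M + j)%N <= l%:R * (HH n + lnb 2).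
    rewrite -[X in X%:R * _](card_ord l) mulr_natl -sumr_const.
    apply: ler_sum => j _.
    have jn : (M + j <= n)%N by exact: arith_low.
    apply: (@H_near_le _ _ _ _ _ _ (fun z : int => E (M + j) / E n * z%:~R)) => // z _.
    by apply: Q_scale; rewrite ?E_gt0 ?(ltW (E_gt0 _ _)) // E_le.
  have h2 : 0 <= \sum_(j < l) HH j by apply: sumr_ge0 => j _; exact: H_ge0.
  by apply: le_trans h1; rewrite lerBlDr lerDl.
have key : M%:R * (al - eta) + G * ((1 - al) / 2) <= HH n + lnb 2.
  rewrite -(ler_pM2l lR); apply: le_trans sumH.
  have h1 : M%:R * ((al - eta) * l%:R) <= M%:R * a by rewrite ler_wpM2l.
  have h2 : G * ((1 - al) * l%:R / 2) <= G * b by rewrite ler_wpM2l.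
  apply: le_trans (lerD h1 h2); rewrite le_eqVlt; apply/orP; left; apply/eqP.
  by field.
apply: (arith_key _ _ _ _ _ _ GG key) => //.
  by rewrite nMR; ring.
by move: hn1; rewrite /Cst natrD.
Qed.

End Inverse.

(** * Entropy growth under a single convolution *)

Section Inverse2.
Variables (R : realType) (S : wifs R).
Local Notation A := ('I_(wm S).+1).
Local Notation E j := (expR (j%:R : R)).
Local Notation c := (cmin S).

Lemma KS2_ge0 : 0 <= KS2 S.
Proof.
ifs_bounds S; apply: lnb_ge0; rewrite addr_ge0 // divr_ge0 //; [lra|exact: ltW].
Qed.

Lemma lnb2_ge0 : 0 <= lnb 2 :> R. Proof. exact: lnb_ge0. Qed.

Lemma hS_affine n (a g : R) : c <= `|g| -> `|g| <= 1 ->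
  hS S (E n) - (KS2 S + lnb 2) <=
  Hent (Stop S (E n * `|g|)) (fun w => Q (E n) (a + g * trw S w)).
Proof.
move=> g1 g2; have g0 : 0 < `|g| by apply: lt_le_trans g1; exact: cmin_gt0.
have gn : g != 0 by rewrite -normr_gt0.
have h1 := H_affine_ge (Stop S (E n * `|g|)) (E n) a (trw S) gn.
have e0 := E_gt0 R n.
have r0 : 0 < E n * `|g| by rewrite mulr_gt0.
have r1 : E n * `|g| <= E n by rewrite ler_piMr // ltW.
have r2 : c * E n <= E n * `|g| by rewrite mulrC ler_wpM2l // ltW.
have h2 := hS_comparable r0 r1 r2.
by rewrite -/(hS S (E n * `|g|)) in h1; lra.
Qed.

Lemma arith_inverse (k al ka x y h B n : R) : 1 <= k -> 0 < ka -> 0 <= n ->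
  (al + ka) * n <= x -> (al - ka / (4 * k)) * n <= h -> B <= n * (ka / 2) ->
  x + (k - 1) * h <= k * y + B -> (al + ka / (4 * k)) * n <= y.
Proof.
move=> k1 ka0 n0 u1 u2 u3 u4.
have kp : 0 < k by lra.
pose q := ka / (4 * k).
have kq : k * q = ka / 4 by rewrite /q; field; rewrite gt_eqF.
have q0 : 0 < q by rewrite divr_gt0 // mulr_gt0.
rewrite -/q in u2 *.
have u5 : (k - 1) * ((al - q) * n) <= (k - 1) * h by rewrite ler_wpM2l //; lra.
rewrite -(ler_pM2l kp).
have -> : k * ((al + q) * n) = k * al * n + k * q * n by ring.
have e5 : (k - 1) * ((al - q) * n) = (k - 1) * al * n - k * q * n + q * n by ring.
rewrite e5 in u5; rewrite kq in u5 *.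
have qn : 0 <= q * n by rewrite mulr_ge0 // ltW.
lra.
Qed.

Lemma arith_KV (k hw hb hs hy ht h L1 L3 K2 l2 : R) : 1 <= k -> 0 <= K2 -> 0 <= l2 ->
  hs <= hw + k * (hy - hw) -> hb <= hs + L1 -> hy <= ht + L3 ->
  h - (K2 + l2) <= hw -> hb + (k - 1) * h <= k * ht + (L1 + k * (L3 + K2 + l2)).
Proof.
move=> k1 K0 l0 h1 h2 h3 h4.
have h5 : (k - 1) * (h - (K2 + l2)) <= (k - 1) * hw by rewrite ler_wpM2l //; lra.
have h6 : k * hy <= k * (ht + L3) by rewrite ler_wpM2l //; lra.
lra.
Qed.

(** With the first summand fixed an affine copy of mu remains, so convolution loses no more than a
    constant. *)
Lemma inverse_trivial n (T : eqType) (d : fdist R T) (Y : T -> R) (g : R) :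
  c <= `|g| -> `|g| <= 1 ->
  hS S (E n) - (KS2 S + lnb 2) <=
  Hent (fprod d (Stop S (E n * `|g|))) (fun z => Q (E n) (Y z.1 + g * trw S z.2)).
Proof.
move=> g1 g2; have g0 : 0 < `|g| by apply: lt_le_trans g1; exact: cmin_gt0.
set D := fprod _ _; pose P z := Q (E n) (Y z.1 + g * trw S z.2).
have h1 : Hent D (fun z => (P z, z.1)) - Hent D fst <= Hent D P.
  have := @H_cond_le _ _ D _ _ _ P fst (fun=> tt) (fun _ _ _ _ _ => erefl).
  have := H_pair_le D P (fun=> tt); rewrite H_cst; lra.
have h2 : Hent D (fun z => (z.1, P z)) = Hent d id +
   Ex d (fun a => Hent (Stop S (E n * `|g|)) (fun w => P (a, w))).
  by apply: H_pair_chain => a a' F _ _ ->.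
have h3 : Hent D fst = Hent d id by exact: (@H_fst _ _ _ _ _ _ id).
have h4 := H_pairC D P fst.
suff h5 : hS S (E n) - (KS2 S + lnb 2) <=
    Ex d (fun a => Hent (Stop S (E n * `|g|)) (fun w => P (a, w))).
  move: h1 h2 h3 h4 h5; rewrite -/P.
  move: (Hent D (fun z => (P z, z.1))) (Hent D (fun z => (z.1, P z))) (Hent D fst)
    (Hent D P) (Ex d _) (Hent d id) (hS S _) => *; lra.
apply: Ex_ge_cst => a _.
exact: (hS_affine n (Y a) g1 g2).
Qed.

(** [Kaimanovich_Vershik_pow] needs sums in a group, so it is applied to integer parts. The error
    grows with [k] but not with [n]. *)
Lemma KV_bound n k (T : eqType) (d : fdist R T) (Y : T -> R) (g : R) :
  c <= `|g| -> `|g| <= 1 -> (0 < k)%N ->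
  Hent (blockD S d g n k) (fun z => Q (E n) (blockS Y g z)) + (k%:R - 1) * hS S (E n) <=
  k%:R * Hent (fprod d (Stop S (E n * `|g|))) (fun z => Q (E n) (Y z.1 + g * trw S z.2)) +
  (lnb (k%:R + 2) + k%:R * (lnb 3 + KS2 S + lnb 2)).
Proof.
move=> g1 g2 k0; have g0 : 0 < `|g| by apply: lt_le_trans g1; exact: cmin_gt0.
pose Yd x := Q (E n) (Y x); pose Wd w := Q (E n) (g * trw S w).
set d3 := Stop S (E n * `|g|).
have kv := Kaimanovich_Vershik_pow d d3 Yd Wd k.
have h1 : Hent (blockD S d g n k) (fun z => Q (E n) (blockS Y g z)) <=
   Hent (fprod (fpow d k) d3) (fun z => \sum_(x <- z.1) Yd x + Wd z.2) + lnb (k%:R + 2).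
  apply: (@H_near_le _ _ _ _ _ _ (fun z : int => z%:~R)); first by rewrite addr_ge0.
  move=> [l w] /supp_prod[/= /supp_pow[zl _] _].
  have q1 := Q_near (E n) (blockS Y g (l, w)); have q2 := Q_near (E n) (g * trw S w).
  have q3 : `|\sum_(x <- l) ((Yd x)%:~R - E n * Y x)| <= k%:R.
    rewrite -zl; apply: le_trans (ler_norm_sum _ _ _) _.
    rewrite -[leRHS]mulr1 mulr_natl -(count_predT l) -[leRHS]iter_addr_0 -big_const_seq.
    by apply: ler_sum => x _; exact: Q_near.
  have -> : (Q (E n) (blockS Y g (l, w)))%:~R - (\sum_(x <- l) Yd x + Wd w)%:~R =
    ((Q (E n) (blockS Y g (l, w)))%:~R - E n * blockS Y g (l, w)) -
    (\sum_(x <- l) ((Yd x)%:~R - E n * Y x)) - ((Wd w)%:~R - E n * (g * trw S w)).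
    by rewrite intrD rmorph_sum sumrB -mulr_sumr /blockS /=; ring.
  apply: le_trans (ler_normB _ _) _.
  apply: le_trans (lerD (ler_normB _ _) q2) _; lra.
have h2 : Hent (fprod d d3) (fun z => Yd z.1 + Wd z.2) <=
   Hent (fprod d d3) (fun z => Q (E n) (Y z.1 + g * trw S z.2)) + lnb 3.
  apply: (@H_near_le _ _ _ _ _ _ (fun z : int => z%:~R)) => // -[x w] _.
  have q1 := Q_near (E n) (Y x); have q2 := Q_near (E n) (g * trw S w).
  have q3 := Q_near (E n) (Y x + g * trw S w).
  rewrite intrD; move: q1 q2 q3; rewrite /Yd /Wd mulrDr !ler_norml /=.
  by move=> /andP[? ?] /andP[? ?] /andP[? ?]; apply/andP; split; lra.
have h3 : hS S (E n) - (KS2 S + lnb 2) <= Hent d3 Wd.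
  have h := hS_affine n 0 g1 g2; apply: le_trans h _; rewrite le_eqVlt; apply/orP; left; apply/eqP.
  by apply: eq_H => w _; rewrite add0r.
have k1 : 1 <= k%:R :> R by rewrite ler1n.
exact: (arith_KV k1 KS2_ge0 lnb2_ge0 kv h1 h2 h3).
Qed.

Variables (al C : R).
Hypothesis al0 : 0 <= al.
Hypothesis al1 : al < 1.
Hypothesis hS_up : forall n, hS S (E n) <= al * n%:R + C.
Hypothesis hS_low : forall e, 0 < e -> exists n0, forall n, (n0 <= n)%N ->
    (al - e) * n%:R <= hS S (E n).

(** If one convolution gained less than ka / (4 k) per level, k of them would gain less than
    [inverse_lower] guarantees. As k is fixed before n, the gain is linear in n. *)
Theorem inverse_entropy (e : R) : 0 < e -> e <= 1 -> exists2 de : R, 0 < de &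
  exists n1 : nat, forall n, (n1 <= n)%N ->
  forall (T : eqType) (d : fdist R T) (Y : T -> R) (g : R),
  (forall x, supp d x -> 0 <= Y x <= 1) -> c <= `|g| -> `|g| <= 1 ->
  e * n%:R <= Hent d (fun x => Q (E n) (Y x)) ->
  (al + de) * n%:R <=
    Hent (fprod d (Stop S (E n * `|g|))) (fun z => Q (E n) (Y z.1 + g * trw S z.2)).
Proof.
move=> e0 e1.
have [k [n1 [k0 h1]]] := inverse_lower al0 al1 hS_up hS_low e0 e1.
have k1 : 1 <= k%:R :> R by rewrite ler1n.
pose ka := (1 - al) * e / 16.
have ka0 : 0 < ka by rewrite /ka !mulr_gt0 ?subr_gt0.
have kk0 : 0 < ka / (4 * k%:R) by rewrite divr_gt0 // mulr_gt0 // ltr0n.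
have [n2 h2] := hS_low kk0.
pose B : R := lnb (k%:R + 2) + k%:R * (lnb 3 + KS2 S + lnb 2).
have [n3 h3] := arch_nat (B / (ka / 2)).
exists (ka / (4 * k%:R)) => //.
exists (maxn n1 (maxn n2 n3)) => n; rewrite !geq_max => /and3P[hn1 hn2 hn3].
move=> T d Y g Y01 g1 g2 hY.
have u1 := h1 n hn1 T d Y g Y01 g1 g2 hY.
have u2 := h2 n hn2; have u3 := h3 n hn3.
have u4 := KV_bound n d Y g1 g2 k0.
rewrite -/ka -/B in u1 u4.
have p2 : 0 < ka / 2 by rewrite divr_gt0.
rewrite (ler_pdivrMr _ _ p2) in u3.
exact: (arith_inverse k1 ka0 (ler0n R n) u1 u2 u3 u4).
Qed.

End Inverse2.

(** * Super-exponential scales *)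

Section StepA.
Variables (R : realType) (S : wifs R).
Local Notation A := ('I_(wm S).+1).
Local Notation E j := (expR (j%:R : R)).
Local Notation c := (cmin S).

Definition lenb (n : nat) : nat := Num.truncn ((n%:R - ln c) / - ln (rmax S)).

Lemma ln_rmax_lt0 : 0 < - ln (rmax S).
Proof. by rewrite oppr_gt0 ln_lt0 // rmax_gt0 rmax_lt1. Qed.

Lemma Stop_size_le n w : supp (Stop S (E n)) w -> (size w <= lenb n)%N.
Proof.
move=> wS; have := Stop_size (E_ge1 R n) wS; rewrite expRK -ler_pdivlMr ?ln_rmax_lt0 // => h.
by rewrite /lenb truncn_ge_nat // (le_trans _ h).
Qed.

Lemma lamw_count w : lamw S w = \prod_j wlam j ^+ (count_mem j w).
Proof.
elim: w => [|i w IH]; first by rewrite lamw_nil big1.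
rewrite lamw_cons IH (bigD1 i) //= [RHS](bigD1 i) //= eqxx add1n exprS mulrA.
congr (_ * _); apply: eq_bigr => j ji.
by rewrite eq_sym (negbTE ji).
Qed.

Lemma ln_sublinear (K x : R) : 0 < K -> 0 < x -> ln x <= x / K + ln K.
Proof.
move=> K0 x0; have -> : x = x / K * K by rewrite divfK // gt_eqF.
rewrite lnM ?posrE ?divr_gt0 // mulfK ?gt_eqF // lerD2r.
by have := @ln_le_sub1 R (x / K) (divr_gt0 x0 K0); lra.
Qed.

(** The ratio depends only on the letter counts and a word stopped at e^-n has length O(n).
    Polynomially many ratios have entropy O(ln n). *)
Lemma H_lamw_sublinear (e : R) : 0 < e -> exists n0, forall n, (n0 <= n)%N ->
  Hent (Stop S (E n)) (lamw S) <= e * n%:R.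
Proof.
move=> e0; pose m1 := (wm S).+1; have m0 : 0 < m1%:R :> R by rewrite ltr0n.
have l0 := ln_rmax_lt0; set lr := - ln (rmax S) in l0.
have c0 : 0 <= - ln c by rewrite oppr_ge0 ln_le0 // ltW // cmin_lt1.
pose K : R := m1%:R * 2 / (e * lr).
have K0 : 0 < K by rewrite divr_gt0 ?mulr_gt0.
pose B : R := m1%:R * ((- ln c / lr + 1) / K + ln K).
have [n0 hn0] := arch_nat (B / (e / 2)).
exists n0 => n /hn0 hn; have e2 : 0 < e / 2 by rewrite divr_gt0.
rewrite (ler_pdivrMr _ _ e2) in hn.
pose L := lenb n.
have h1 : Hent (Stop S (E n)) (lamw S) <= ln ((L.+1 ^ m1)%N%:R).
  pose X w : {ffun A -> 'I_L.+1} := [ffun j => inord (count_mem j w)].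
  apply: (@le_trans _ _ (Hent (Stop S (E n)) X)).
    apply: H_fun_le => w w' wS w'S XX; rewrite !lamw_count.
    apply: eq_bigr => j _; congr (_ ^+ _).
    have := congr1 (fun f : {ffun A -> 'I_L.+1} => val (f j)) XX.
    rewrite /X /= !ffunE !inordK // ltnS.
      by apply: leq_trans (count_size _ _) _; exact: Stop_size_le.
    by apply: leq_trans (count_size _ _) _; exact: Stop_size_le.
  apply: (@H_le_ln _ _ _ _ _ (enum {: {ffun A -> 'I_L.+1}})).
    by move=> w _; rewrite mem_enum.
  by rewrite -cardE card_ffun !card_ord.
apply: (le_trans h1); rewrite natrX lnXn ?ltr0n // -(mulr_natl _ m1).
have hL : L.+1%:R <= (n%:R - ln c) / lr + 1 :> R.
  have p : 0 <= (n%:R - ln c) / lr by rewrite divr_ge0 ?(ltW l0) // addr_ge0.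
  by have /andP[h _] := truncn_itv p; rewrite -natr1 lerD2r.
have h2 := @ln_sublinear K L.+1%:R K0 (ltr0Sn _ _).
have h3 : L.+1%:R / K <= ((n%:R - ln c) / lr + 1) / K.
  by rewrite ler_wpM2r // invr_ge0 ltW.
have h4 : m1%:R * ln L.+1%:R <= m1%:R * (((n%:R - ln c) / lr + 1) / K + ln K).
  by rewrite ler_wpM2l ?(ltW m0) // (le_trans h2) // lerD2r.
apply: (le_trans h4).
have -> : m1%:R * (((n%:R - ln c) / lr + 1) / K + ln K) = m1%:R * (n%:R / lr / K) + B.
  by rewrite /B; field; rewrite !gt_eqF.
have -> : m1%:R * (n%:R / lr / K) = e / 2 * n%:R.
  by rewrite /K; field; rewrite !gt_eqF.
by move: hn; clear; move: B => b; lra.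
Qed.

Definition coarse n (w : seq A) := (Q (E n) (trw S w), lamw S w).

Section OneScale.
Variables (n N : nat).
Let D := fpair (Stop S (E n)) (fun w => Stop S (E (n + N) * `|lamw S w|)).
Let X (z : seq A * seq A) := Q (E (n + N)) (trw S (z.1 ++ z.2)).
(** The words sharing cell and ratio with [w0]; the common ratio is what makes the next level a
    convolution. *)
Definition condw (w0 : seq A) := fcond (Stop S (E n)) (coarse n) (coarse n w0).
Definition resid (w0 w : seq A) : R := E n * trw S w - (Q (E n) (trw S w0))%:~R.
Definition scal (w0 : seq A) : R := E n * lamw S w0.
(** Entropy at scale e^-(n+N) inside the cell of [w0], magnified by e^n: the words of the cell
    convolved with a copy of mu. *)
Definition convH (w0 : seq A) : R :=
  Hent (fprod (condw w0) (Stop S (E N * `|scal w0|)))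
    (fun z => Q (E N) (resid w0 z.1 + scal w0 * trw S z.2)).

(** Conditioning on the ratio besides the cell lowers entropy, so the average over cells is at most
    the growth of [hS] from level n to n + N. *)
Lemma mean_convH : Ex (Stop S (E n)) convH <=
  hS S (E (n + N)) - hS S (E n) + (lnb (Ctr S + 2) + lnb 2).
Proof.
ifs_bounds S.
have e0 := E_gt0 R n.
have hX : hS S (E (n + N)) = Hent D X.
  by rewrite /hS (@H_Stop_cat _ _ _ _ (E n)) // E_le // leq_addr.
pose Yn (z : seq A * seq A) := Q (E n) (trw S z.1).
have e1 : Hent D (fun z => (Yn z, X z)) <= Hent D X + lnb (Ctr S + 2).
  apply: (@H_near _ _ _ _ _ _ (fun z : int => z%:~R / E N)) => [|[w v]]; first by lra.
  move=> /supp_pair[/= wS _].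
  have h1 := trw_cat_near v (ltW e0) (Stop_upper wS).
  have h2 := Q_near (E n) (trw S w); have h3 := Q_near (E (n + N)) (trw S (w ++ v)).
  have f0 := E_gt0 R N; have f1 := E_ge1 R N.
  rewrite /Yn /X /=.
  have -> : (Q (E n) (trw S w))%:~R - (Q (E (n + N)) (trw S (w ++ v)))%:~R / E N =
    ((Q (E n) (trw S w))%:~R - E n * trw S w) + - (E n * trw S (w ++ v) - E n * trw S w)
    + - (((Q (E (n + N)) (trw S (w ++ v)))%:~R - E (n + N) * trw S (w ++ v)) / E N).
    move: (Q (E (n + N)) _)%:~R (Q (E n) _)%:~R => x y.
    by rewrite ED; field; rewrite gt_eqF.
  apply: le_trans (ler_normD _ _) _; rewrite normrN normrM normfV (ger0_norm (ltW f0)).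
  have h4 : `|(Q (E (n + N)) (trw S (w ++ v)))%:~R - E (n + N) * trw S (w ++ v)| / E N <= 1.
    by rewrite ler_pdivrMr ?mul1r //; lra.
  have := ler_normD ((Q (E n) (trw S w))%:~R - E n * trw S w) (- (E n * trw S (w ++ v) - E n * trw S w)).
  by rewrite normrN; lra.
have hY : Hent D Yn = hS S (E n) by exact: (@H_fst _ _ _ _ _ _ (fun w => Q (E n) (trw S w))).
pose An (z : seq A * seq A) := coarse n z.1.
have e2 : Hent D (fun z => (X z, An z)) - Hent D An <= Hent D (fun z => (X z, Yn z)) - Hent D Yn.
  by apply: H_cond_le => w w' _ _ [].
have hA : Hent D An = Hent (Stop S (E n)) (coarse n) by exact: H_fst.
pose f w0 := fprod (condw w0) (Stop S (E (n + N) * `|lamw S w0|)).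
have e3 : Hent D (fun z => (An z, X z)) =
   Hent (Stop S (E n)) (coarse n) + Ex (Stop S (E n)) (fun w0 => Hent (f w0) X).
  rewrite -(@H_pair_chain _ _ _ _ _ (Stop S (E n)) f (coarse n) (fun z => X z.2)); last first.
    move=> a a' F _ _ aa; rewrite /f /condw aa.
    by case: aa => _ ->.
  apply: H_law => F; rewrite !Ex_pair (Ex_total _ (coarse n)).
  apply: eq_Ex => w0 w0S; rewrite /f Ex_prod; apply: eq_Ex => w.
  rewrite supp_cond ?pm_gt0 // => -[_ ww].
  by rewrite /An /= -ww; case: ww => _ <-.
have e4 : Ex (Stop S (E n)) convH <= Ex (Stop S (E n)) (fun w0 => Hent (f w0) X + lnb 2).
  apply: le_Ex => w0 w0S; rewrite /convH /f.
  have -> : E N * `|scal w0| = E (n + N) * `|lamw S w0|.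
    by rewrite /scal normrM (ger0_norm (ltW e0)) ED; ring.
  apply: (@H_near_le _ _ _ _ _ _ (fun z : int => z%:~R - E N * (Q (E n) (trw S w0))%:~R)) => //.
  move=> [w v] /supp_prod[/= ]; rewrite supp_cond ?pm_gt0 // => -[_ [_ ll]] _.
  have q1 := Q_near (E N) (resid w0 w + scal w0 * trw S v).
  have q2 := Q_near (E (n + N)) (trw S (w ++ v)).
  rewrite /X /=; move: q1 q2.
  have -> : E N * (resid w0 w + scal w0 * trw S v) =
     E (n + N) * trw S (w ++ v) - E N * (Q (E n) (trw S w0))%:~R.
    by rewrite trw_cat ll /resid /scal ED; ring.
  rewrite !ler_norml => /andP[? ?] /andP[? ?]; apply/andP; split; lra.
rewrite ExD Ex_cst in e4.
have h5 := H_pairC D X An; have h6 := H_pairC D X Yn.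
move: hX e1 hY e2 hA e3 e4 h5 h6.
move: (Hent D (fun z => (Yn z, X z))) (Hent D (fun z => (X z, Yn z)))
  (Hent D (fun z => (X z, An z))) (Hent D (fun z => (An z, X z))) (Hent D X) (Hent D Yn)
  (Hent D An) (Ex _ convH) (Ex _ (fun w0 => Hent (f w0) X)) (Hent _ (coarse n)) (hS _ _) (hS _ _).
move=> *; lra.
Qed.

Lemma fine_given_coarse :
  Hent (Stop S (E n)) (fun w => (Q (E (n + N)) (trw S w), lamw S w)) <=
  hS S (E n) + Hent (Stop S (E n)) (lamw S) +
  Ex (Stop S (E n)) (fun w0 => Hent (condw w0) (fun w => Q (E N) (resid w0 w)) + lnb 2).
Proof.
set D0 := Stop S (E n).
have h1 : Hent D0 (fun w => (Q (E (n + N)) (trw S w), lamw S w)) <=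
   Hent D0 (fun w => (coarse n w, Q (E (n + N)) (trw S w))).
  by apply: H_fun_le => w w' _ _ [_ -> ->].
have h2 := H_cond_chain D0 (coarse n) (fun w => Q (E (n + N)) (trw S w)).
have h3 : Hent D0 (coarse n) <= hS S (E n) + Hent D0 (lamw S) by exact: H_pair_le.
have h4 : Ex D0 (fun a => Hent (fcond D0 (coarse n) (coarse n a)) (fun w => Q (E (n + N)) (trw S w)))
  <= Ex D0 (fun w0 => Hent (condw w0) (fun w => Q (E N) (resid w0 w)) + lnb 2).
  apply: le_Ex => w0 w0S.
  apply: (@H_near_le _ _ _ _ _ _ (fun z : int => z%:~R + E N * (Q (E n) (trw S w0))%:~R)) => //.
  move=> w _; have q1 := Q_near (E N) (resid w0 w); have q2 := Q_near (E (n + N)) (trw S w).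
  move: q1 q2; have -> : E N * resid w0 w =
     E (n + N) * trw S w - E N * (Q (E n) (trw S w0))%:~R by rewrite /resid ED; ring.
  rewrite !ler_norml => /andP[? ?] /andP[? ?]; apply/andP; split; lra.
rewrite h2 in h1; move: h1 h3 h4.
move: (Ex D0 _) (Ex D0 _) (Hent _ _) (Hent _ _) (Hent _ _) => *; lra.
Qed.

Lemma resid01 w0 w : supp (Stop S (E n)) w0 -> supp (condw w0) w -> 0 <= resid w0 w <= 1.
Proof.
move=> w0S; rewrite supp_cond ?pm_gt0 // => -[_ [E1 _]].
rewrite /resid -E1; have /andP[] := Q_bound (E n) (trw S w).
by move=> ? ?; apply/andP; split; lra.
Qed.

Lemma scal_bounds w0 : supp (Stop S (E n)) w0 -> c <= `|scal w0| /\ `|scal w0| <= 1.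
Proof.
move=> w0S; rewrite /scal normrM (ger0_norm (ltW (E_gt0 R n))); split.
  by apply: Stop_lower => //; apply: le_trans (E_ge1 R n); rewrite ltW // cmin_lt1.
exact: Stop_upper.
Qed.

End OneScale.

Lemma arith_bad (al de eta n N P K hnN hn cv : R) : 0 <= eta -> n <= N ->
  cv <= hnN - hn + K -> hnN <= al * (n + N) + K -> (al - eta) * n <= hn ->
  (al - eta) * N + P * (de * N) - K <= cv ->
  P * (de * N) <= eta * N * 2 + 3 * K.
Proof.
move=> e0 nN h1 h2 h3 h4.
have : eta * n <= eta * N by rewrite ler_wpM2l.
lra.
Qed.

Lemma arith_fin (HX Hl h M C0 aC l e a n x : R) : 0 <= e * n -> HX <= h + Hl + M ->
  M <= x + 6 + l -> aC + l + 6 <= n * (e / 4) -> h <= a * n + C0 ->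
  Hl <= e / 4 * n -> C0 <= aC -> x <= e / 4 * n -> HX <= (a + e) * n.
Proof. lra. Qed.

Lemma arith_scale (e1 N q n e : R) : 0 <= e1 -> 0 <= n -> N <= q * n ->
  e1 * (8 * q) <= e -> 2 * e1 * N <= e / 4 * n.
Proof.
move=> e0 n0 Nq h; apply: (@le_trans _ _ (2 * e1 * (q * n))).
  by rewrite ler_wpM2l // mulr_ge0.
have -> : 2 * e1 * (q * n) = (e1 * (8 * q)) / 4 * n by field.
by rewrite ler_wpM2r // ler_wpM2r.
Qed.

Variables (al C : R).
Hypothesis al0 : 0 <= al.
Hypothesis al1 : al < 1.
Hypothesis hS_up : forall n, hS S (E n) <= al * n%:R + C.
Hypothesis hS_low : forall e, 0 < e -> exists n0, forall n, (n0 <= n)%N ->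
    (al - e) * n%:R <= hS S (E n).

(* Hochman's argument: conditionally on a level-n cell and contraction, mu is the
   convolution of the word measure inside the cell with a copy of mu, so entropy of
   the former would make the entropy of mu grow faster than al. *)
Theorem superexp_entropy (q : nat) (e : R) : (2 <= q)%N -> 0 < e ->
  exists n0, forall n, (n0 <= n)%N ->
  Hent (Stop S (E n)) (fun w => (Q (E (q * n)) (trw S w), lamw S w)) <= (al + e) * n%:R.
Proof.
move=> q2 e0.
have q0 : 0 < q%:R :> R by rewrite ltr0n; apply: leq_trans q2.
pose e1 : R := Num.min 1 (e / (8 * q%:R)).
have e10 : 0 < e1 by rewrite lt_min ltr01 divr_gt0 // mulr_gt0.
have e11 : e1 <= 1 by rewrite ge_min lexx.
have e1e : e1 * (8 * q%:R) <= e by rewrite -ler_pdivlMr ?mulr_gt0 // ge_min lexx orbT.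
have [de de0 [n1 hIT]] := inverse_entropy al0 al1 hS_up hS_low e10 e11.
(* The possible loss on ordinary cells must be small against the gain [de] on a proportion [e1] of
   cells. *)
pose eta := de * e1 / 4.
have eta0 : 0 < eta by rewrite /eta !mulr_gt0.
have [n2 hlow] := hS_low eta0.
pose K : R := `|C| + (lnb (Ctr S + 2) + lnb 2) + (KS2 S + lnb 2).
have [n3 h3] := arch_nat (3 * K / (de * e1 / 2)).
have e4 : 0 < e / 4 by rewrite divr_gt0.
have [n4 h4] := H_lamw_sublinear e4.
have [n5 h5] := arch_nat ((`|C| + lnb 2 + 6) / (e / 4)).
exists (maxn n1 (maxn n2 (maxn n3 (maxn n4 n5)))) => n.
rewrite !geq_max => /and5P[hn1 hn2 hn3 hn4 hn5].
(* Level q n is n + N, and N >= n because q >= 2, so bounds valid from n on also hold at N. *)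
pose N := (q.-1 * n)%N.
have nN : (n <= N)%N by rewrite /N leq_pmull //; case: (q) q2 => [|[|]].
have qn : (q * n = n + N)%N by rewrite /N -mulSn prednK // (leq_trans _ q2).
have NN k : (k <= n)%N -> (k <= N)%N by move=> kn; exact: leq_trans kn nN.
have en0 : 0 <= e * n%:R by rewrite mulr_ge0 // ltW.
have Nq : N%:R <= q%:R * n%:R :> R by rewrite -natrM ler_nat qn leq_addl.
pose D0 := Stop S (E n).
pose Hr w0 := Hent (condw n w0) (fun w => Q (E N) (resid n w0 w)).
(* In these cells the words carry entropy and the convolution gains de N. As the mean growth is at
   most al N, up to small errors, their probability is at most [e1]. *)
pose bad w0 := e1 * N%:R <= Hr w0.
pose P := Ex D0 (fun w0 => (bad w0)%:R).
have cv_low : (al - eta) * N%:R + P * (de * N%:R) - K <= Ex D0 (convH n N).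
  rewrite /P -ExZr -[X in X + _ - _](Ex_cst D0) -ExD -[X in _ - X](Ex_cst D0) -ExB.
  apply: le_Ex => w0 w0S; have [s1 s2] := scal_bounds w0S.
  have K0 : KS2 S + lnb 2 <= K.
    rewrite /K lerDr addr_ge0 // addr_ge0 //; last exact: lnb2_ge0.
    by apply: lnb_ge0; have := Ctr_ge1 S; lra.
  have K1 : 0 <= K by apply: le_trans K0; rewrite addr_ge0 ?KS2_ge0 ?lnb2_ge0.
  have hb := hIT N (NN _ hn1) _ (condw n w0) (resid n w0) (scal n w0)
    (fun x => @resid01 n w0 x w0S) s1 s2.
  have hg := inverse_trivial N (condw n w0) (resid n w0) s1 s2.
  have hl := hlow N (NN _ hn2).
  rewrite -/(convH n N w0) in hb hg.
  rewrite /bad; case: (lerP (e1 * N%:R) (Hr w0)) => hh.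
    have := hb hh; have : 0 <= eta * N%:R by rewrite mulr_ge0 // ltW.
    by move: K1; rewrite mul1r; clear; move: (convH _ _ _) => *; lra.
  rewrite mul0r addr0; move: hg hl K0; clear; move: (convH _ _ _) => *; lra.
have cv_up := mean_convH n N.
have hC : hS S (E (n + N)) <= al * (n%:R + N%:R) + K.
  rewrite -natrD; apply: le_trans (hS_up _) _; rewrite lerD2l /K.
  apply: le_trans (ler_norm _) _; rewrite -addrA lerDl !addr_ge0 ?KS2_ge0 ?lnb2_ge0 //.
  by apply: lnb_ge0; have := Ctr_ge1 S; lra.
have cv_up2 : Ex D0 (convH n N) <= hS S (E (n + N)) - hS S (E n) + K.
  apply: le_trans cv_up _; rewrite lerD2l /K -addrA addrCA lerDl addr_ge0 //.
  by rewrite addr_ge0 ?KS2_ge0 ?lnb2_ge0.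
have nNR : n%:R <= N%:R :> R by rewrite ler_nat.
have PP := arith_bad (ltW eta0) nNR cv_up2 hC (hlow n hn2) cv_low.
have P1 : P * N%:R <= e1 * N%:R.
  have := h3 N (NN _ hn3); rewrite ler_pdivrMr ?divr_gt0 ?mulr_gt0 // => h.
  rewrite -(ler_pM2l de0).
  have -> : de * (e1 * N%:R) = eta * N%:R * 2 + N%:R * (de * e1 / 2) by rewrite /eta; field.
  by apply: (le_trans (le_trans _ PP)); [rewrite mulrCA|rewrite lerD2l].
have P2 : P <= 1 by apply: Ex_le_cst => w _; rewrite lern1 leq_b1.
have P0 : 0 <= P by apply: Ex_ge0.
have meanH : Ex D0 (fun w0 => Hr w0 + lnb 2) <= 2 * e1 * N%:R + 6 + lnb 2.
  apply: (@le_trans _ _ (Ex D0 (fun w0 => e1 * N%:R + (bad w0)%:R * (N%:R + 6) + lnb 2))).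
    apply: le_Ex => w0 w0S; rewrite lerD2r /bad.
    have := unit_entropy_le (fun x => @resid01 n w0 x w0S) N; rewrite -/(Hr w0) => hu.
    case: (lerP (e1 * N%:R) (Hr w0)) => hh; last by rewrite mul0r addr0 ltW.
    by rewrite mul1r; apply: le_trans hu _; rewrite lerDr mulr_ge0 // ltW.
  by rewrite !ExD !Ex_cst ExZr -/P mulrDr; lra.
have fin := fine_given_coarse n N.
rewrite -qn in fin.
have h6 := h5 n hn5; rewrite ler_pdivrMr // in h6.
have h7 := hS_up n; have h8 := h4 n hn4; have h9 := ler_norm C.
have h10 := arith_scale (ltW e10) (ler0n R n) Nq e1e.
exact: (arith_fin en0 fin meanH h6 h7 h8 h9 h10).
Qed.

End StepA.

(** * Heights *)

Section IntegralModule.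
Variables (R : realType) (m : nat) (lam : 'I_m -> R).
Hypothesis lam_alg : forall j, algebraicOver (@ratr R) (lam j).

(** The remainder of X^i modulo an annihilating polynomial. It is stated for all large n so that one
    n can serve every letter. *)
Lemma algebraic_powers j : exists n0, forall n, (n0 <= n)%N -> forall i : nat,
  exists c : 'I_n -> rat, lam j ^+ i = \sum_(a < n) ratr (c a) * lam j ^+ a.
Proof.
have [p p0 /rootP px] := lam_alg j; exists (size p) => n pn i.
pose r := ('X^i %% p)%R; exists (fun a => r`_a).
have sr : (size r <= n)%N by apply: leq_trans (ltnW _) pn; rewrite ltn_modp.
have e : ('X^i : {poly rat}) = 'X^i %/ p * p + r by exact: divp_eq.
have := congr1 (fun f => (map_poly (@ratr R) f).[lam j]) e.
rewrite rmorphD rmorphM /= hornerD hornerM px mulr0 add0r map_polyXn hornerXn => ->.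
rewrite (@horner_coef_wide _ n) ?size_map_poly //.
by apply: eq_bigr => a _; rewrite coef_map.
Qed.

(** [v] generates over the rationals a space stable under multiplication by every ratio, and [B j]
    is the matrix of that multiplication. *)
Definition has_module (d : nat) : Prop :=
  exists (B : 'I_m -> 'M[rat]_d) (v : 'cV[R]_d), v != 0 /\
    forall j, map_mx ratr (B j) *m v = lam j *: v.

(** The monomials in the ratios with all exponents below n. *)
Lemma module_exists : exists d, has_module d.
Proof.
have /(_ _)/cid-/all_sig[N hN] := algebraic_powers.
pose n := (\max_j N j).+1.
have hn j i : exists c : 'I_n -> rat, lam j ^+ i = \sum_(a < n) ratr (c a) * lam j ^+ a.
  by apply: hN; rewrite /n ltnW // ltnS leq_bigmax.
have [c hc] := boolp.choice (fun ji : 'I_m * nat => hn ji.1 ji.2).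
pose I := {ffun 'I_m -> 'I_n}.
pose upd (f : I) j a : I := [ffun k => if k == j then a else f k].
pose v (f : I) : R := \prod_k lam k ^+ f k.
pose b j (f g : I) : rat := \sum_(a < n) (if g == upd f j a then c (j, (f j).+1) a else 0).
have hv j f : \sum_g ratr (b j f g) * v g = lam j * v f.
  have -> : lam j * v f = lam j ^+ (f j).+1 * \prod_(k | k != j) lam k ^+ f k.
    by rewrite /v (bigD1 j) //= exprS mulrA.
  rewrite (hc (j, (f j).+1)) /= mulr_suml.
  under eq_bigr do rewrite /b rmorph_sum /= mulr_suml.
  rewrite exchange_big /=; apply: eq_bigr => a _.
  rewrite (bigD1 (upd f j a)) //= eqxx big1 ?addr0 => [|g /negbTE ->]; last first.
    by rewrite rmorph0 mul0r.
  rewrite -[RHS]mulrA; congr (_ * _); rewrite /v (bigD1 j) //= ffunE eqxx; congr (_ * _).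
  by apply: eq_bigr => k /negbTE kj; rewrite ffunE kj.
exists #|{: I}|, (fun j => \matrix_(x, y) b j (enum_val x) (enum_val y)), (\col_x v (enum_val x)).
split.
  apply/negP => /eqP /colP /(_ (enum_rank [ffun=> ord0])) /eqP.
  by rewrite !mxE enum_rankK /v big1 ?oner_eq0 // => k _; rewrite ffunE expr0.
move=> j; apply/colP => x; rewrite !mxE -hv [RHS](reindex _ (onW_bij _ (@enum_val_bij I))) /=.
by apply: eq_bigr => y _; rewrite !mxE.
Qed.

(** In a family of minimal size no member can be eliminated, and a rational relation would eliminate
    one. *)
Lemma independent_module : exists (d : nat) (B : 'I_m -> 'M[rat]_d) (v : 'cV[R]_d),
  [/\ v != 0, forall j, map_mx ratr (B j) *m v = lam j *: v &
   forall u : 'rV[rat]_d, map_mx ratr u *m v = 0 -> u = 0].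
Proof.
have ex : exists d, `[< has_module d >] by have [d h] := module_exists; exists d; exact/asboolP.
have [d /asboolP[B [v [v0 hB]]] dmin] := ex_minnP ex.
exists d, B, v; split=> // u uv; apply/eqP; apply: contraT => /rV0Pn[i0 ui0].
case: d B v v0 hB dmin u uv i0 ui0 => [|d] B v v0 hB dmin u uv i0 ui0; first by case: i0 ui0.
pose K : 'M[rat]_(d.+1, d) := \matrix_(i, k)
  if i == i0 then - u 0 (lift i0 k) / u 0 i0 else (i == lift i0 k)%:R.
pose v' := row' i0 v.
have r0 : ratr (u 0 i0) != 0 :> R by rewrite fmorph_eq0.
have vK : v = map_mx ratr K *m v'.
  apply/colP => i; rewrite !mxE; case: (unliftP i0 i) => [k ->|->].
    rewrite (bigD1 k) //= big1 => [|l lk]; rewrite !mxE eq_sym (negbTE (neq_lift _ _)).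
      by rewrite eqxx rmorph1 mul1r addr0.
    by rewrite (inj_eq (@lift_inj _ i0)) eq_sym (negbTE lk) rmorph0 mul0r.
  have := congr1 (fun M : 'M[R]_1 => M 0 0) uv; rewrite !mxE (bigD1_ord i0) //= !mxE => h.
  apply: (mulfI r0); apply/eqP; rewrite -subr_eq0 -[X in _ == X]h; apply/eqP.
  rewrite mulr_sumr -sumrN; congr (_ + _); apply: eq_bigr => k _.
  by rewrite !mxE eqxx rmorphM rmorphN fmorphV /=; field.
have hm : has_module d.
  exists (fun j => row' i0 (B j *m K)), v'; split.
    by apply: contraNneq v0 => v'0; rewrite vK v'0 mulmx0.
  move=> j; apply/colP => k.
  have := congr1 (fun M : 'cV[R]_d.+1 => M (lift i0 k) 0) (hB j).
  rewrite {1}vK mulmxA -map_mxM !mxE => <-.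
  by apply: eq_bigr => l _; rewrite !mxE.
by have := dmin d (asboolT hm); rewrite ltnn.
Qed.

(** [a] is a common denominator of the entries of all the matrices. *)
Lemma integral_module : exists (d a : nat) (B : 'I_m -> 'M[int]_d.+1) (v : 'cV[R]_d.+1),
  [/\ (0 < a)%N, forall u : 'rV[int]_d.+1, map_mx intr u *m v = 0 -> u = 0 &
   forall j, map_mx intr (B j) *m v = (a%:R * lam j) *: v].
Proof.
have [[|d] [B [v [v0 hB ind]]]] := independent_module.
  by move: v0; rewrite [v]flatmx0 eqxx.
pose a : nat := \prod_(z : 'I_m * 'I_d.+1 * 'I_d.+1) `|denq (B z.1.1 z.1.2 z.2)|%N.
have a0 : (0 < a)%N by rewrite prodn_gt0 // => z; rewrite absz_gt0 denq_eq0.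
have hb z : exists b : int, b%:~R = a%:R * B z.1.1 z.1.2 z.2.
  have : (denq (B z.1.1 z.1.2 z.2) %| (a%:Z))%Z.
    by rewrite dvdzE /= /a (bigD1 z) //= dvdn_mulr.
  move=> /dvdzP[q e]; exists (q * numq (B z.1.1 z.1.2 z.2)).
  rewrite -[X in _ = _ * X]divq_num_den -[a%:R]/((a%:Z)%:~R) e !rmorphM /=.
  by field; rewrite intr_eq0 denq_eq0.
have [b hb'] := boolp.choice hb.
exists d, a, (fun j => \matrix_(i, k) b (j, i, k)), v; split=> // [u uv|j].
  have : map_mx intr u = 0 :> 'rV[rat]_d.+1.
    apply: ind; rewrite -uv; congr (_ *m _); apply/rowP => i.
    by rewrite !mxE ratr_int.
  move=> /rowP h; apply/rowP => i; have /eqP := h i.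
  by rewrite !mxE intr_eq0 => /eqP.
rewrite -scalerA -hB scalemxAl; congr (_ *m _); apply/matrixP => i k.
rewrite !mxE -(ratr_int R) (hb' (j, i, k)) /= rmorphM /=.
by rewrite -[a%:R]/((a%:Z)%:~R) ratr_int.
Qed.
End IntegralModule.

Lemma det_bound (R : numDomainType) r (A : 'M[R]_r) (L : R) :
  (forall i j, `|A i j| <= L) -> `|\det A| <= r`!%:R * L ^+ r.
Proof.
move=> hA; apply: le_trans (ler_norm_sum _ _ _) _.
apply: (@le_trans _ _ (\sum_(s : 'S_r) L ^+ r)).
  apply: ler_sum => s _; rewrite normrMsign normr_prod.
  rewrite -[X in L ^+ X]card_ord -prodr_const.
  by apply: ler_prod => i _; rewrite normr_ge0 hA.
by rewrite sumr_const card_Sn mulr_natl.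
Qed.

Lemma adj_bound (R : numDomainType) r (A : 'M[R]_r) (L : R) i j :
  (forall i j, `|A i j| <= L) -> `|(\adj A) i j| <= r.-1`!%:R * L ^+ r.-1.
Proof.
move=> hA; rewrite !mxE /cofactor normrMsign; apply: det_bound => k l.
by rewrite !mxE.
Qed.

Section Heights.
Variables (R : realType) (d a : nat) (v : 'cV[R]_d.+1).
Hypothesis a0 : (0 < a)%N.
Hypothesis v_ind : forall u : 'rV[int]_d.+1, map_mx intr u *m v = 0 -> u = 0.
Local Notation D := (d.+1%:R : R).

(* x has denominator a ^ n and height at most L: multiplication by a ^ n * x acts on
   the module generated by v through an integral matrix with entries at most L. *)
Definition rep (n : nat) (L x : R) : Prop :=
  exists N : 'M[int]_d.+1, map_mx intr N *m v = (a%:R ^+ n * x) *: v /\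
    forall i j, `|(N i j)%:~R : R| <= L.

Lemma rep_ge0 n L x : rep n L x -> 0 <= L.
Proof. by case=> N [_ /(_ ord0 ord0)]; apply: le_trans. Qed.

Lemma rep_le n L L' x : L <= L' -> rep n L x -> rep n L' x.
Proof. by move=> LL [N [h1 h2]]; exists N; split=> // i j; apply: le_trans LL. Qed.

Lemma rep0 n : rep n 0 0.
Proof.
exists 0; split=> [|i j]; last by rewrite mxE normr0.
by rewrite map_mx0 mul0mx mulr0 scale0r.
Qed.

Lemma rep1 : rep 0 1 1.
Proof.
exists 1%:M; split=> [|i j]; first by rewrite map_mx1 mul1mx mulr1 scale1r.
by rewrite mxE; case: (_ == _); rewrite ?normr1 ?normr0.
Qed.

Lemma repN n L x : rep n L x -> rep n L (- x).
Proof.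
move=> [N [h1 h2]]; exists (- N); split=> [|i j].
  by rewrite map_mxN mulNmx h1 mulrN scaleNr.
by rewrite mxE rmorphN normrN; exact: h2.
Qed.

Lemma repD n L L' x y : rep n L x -> rep n L' y -> rep n (L + L') (x + y).
Proof.
move=> [N [h1 h2]] [M [k1 k2]]; exists (N + M); split=> [|i j].
  by rewrite map_mxD mulmxDl h1 k1 mulrDr scalerDl.
by rewrite mxE rmorphD; apply: le_trans (ler_normD _ _) _; apply: lerD; [exact: h2|exact: k2].
Qed.

Lemma repM n n' L L' x y : rep n L x -> rep n' L' y -> rep (n + n') (D * (L * L')) (x * y).
Proof.
move=> [N [h1 h2]] [M [k1 k2]]; exists (M *m N); split=> [|i j].
  rewrite map_mxM -mulmxA h1 -scalemxAr k1 scalerA exprD; congr (_ *: _).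
  by move: (_ ^+ n) (_ ^+ n') => *; ring.
rewrite mxE rmorph_sum /=; apply: le_trans (ler_norm_sum _ _ _) _.
apply: (@le_trans _ _ (\sum_(k < d.+1) (L * L'))); last first.
  by rewrite sumr_const card_ord mulr_natl.
apply: ler_sum => k _; rewrite rmorphM normrM mulrC.
by apply: ler_pM => //; [exact: h2|exact: k2].
Qed.

Lemma rep_pad k n L x : rep n L x -> rep (k + n) (a%:R ^+ k * L) x.
Proof.
move=> [N [h1 h2]]; exists (a%:R ^+ k *: N); split=> [|i j].
  have -> : map_mx intr (a%:R ^+ k *: N) = (a%:R ^+ k : R) *: map_mx intr N.
    by apply/matrixP => i j; rewrite !mxE rmorphM rmorphXn /= natz.
  by rewrite -scalemxAl h1 scalerA mulrA exprD.
rewrite mxE rmorphM rmorphXn /= natz normrM ger0_norm ?exprn_ge0 //.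
by rewrite ler_wpM2l ?exprn_ge0.
Qed.

Lemma rep_sum (I : finType) n (L : I -> R) (x : I -> R) :
  (forall i, rep n (L i) (x i)) -> rep n (\sum_i L i) (\sum_i x i).
Proof.
move=> h; elim/big_rec2: _ => [|i y1 y2 _ IH]; first exact: rep0.
exact: repD.
Qed.

Lemma rep_prod r n (L : R) (x : 'I_r -> R) :
  (forall i, rep n L (x i)) -> rep (r * n) ((D * L) ^+ r) (\prod_i x i).
Proof.
elim: r x => [|r IH] x h; first by rewrite big_ord0 mul0n expr0; exact: rep1.
rewrite big_ord_recl mulSn exprS -mulrA; apply: repM => //; exact: IH.
Qed.

Lemma rep_det r n (L : R) (A : 'M[R]_r) : (forall i j, rep n L (A i j)) ->
  rep (r * n) (r`!%:R * (D * L) ^+ r) (\det A).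
Proof.
move=> h; rewrite mulr_natl -card_Sn -sumr_const; apply: rep_sum => s.
have := rep_prod (fun i => h i (s i)).
by case: (odd_perm s); rewrite ?mulN1r ?mul1r // => /repN.
Qed.

Lemma v_neq0 : exists i, v i 0 != 0.
Proof.
have : v != 0.
  apply/negP => /eqP v0.
  have /rowP/(_ ord0)/eqP := v_ind (etrans (congr1 _ v0) (mulmx0 _ _)) : (const_mx 1 : 'rV[int]_d.+1) = 0.
  by rewrite !mxE oner_eq0.
by move/cV0Pn.
Qed.

(** [v] is an eigenvector of the integral matrix with eigenvalue a^n x; one nonzero coordinate gives
    the bound. *)
Lemma rep_bound : exists2 V : R, 1 <= V & forall n L x, rep n L x -> `|x| <= V * L.
Proof.
have [i vi] := v_neq0; have vi0 : 0 < `|v i 0| by rewrite normr_gt0.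
pose s : R := \sum_k `|v k 0|.
have s1 : `|v i 0| <= s by rewrite /s (bigD1 i) //= lerDl sumr_ge0.
exists (s / `|v i 0|); first by rewrite ler_pdivlMr // mul1r.
move=> n L x [N [/colP/(_ i) h1 h2]].
rewrite -mulrAC ler_pdivlMr //.
have a1 : 1 <= a%:R ^+ n :> R by rewrite exprn_ege1 // ler1n.
apply: (@le_trans _ _ (a%:R ^+ n * (`|x| * `|v i 0|))).
  by rewrite ler_peMl // mulr_ge0.
rewrite mulrA -[X in X * _ * _]ger0_norm ?exprn_ge0 // -!normrM.
move: h1; rewrite !mxE => <-; apply: le_trans (ler_norm_sum _ _ _) _.
rewrite /s mulr_suml; apply: ler_sum => k _.
by rewrite !mxE normrM mulrC ler_wpM2l.
Qed.

(* Liouville: the integral matrix representing a nonzero x has nonzero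
   determinant, since a left kernel vector would be a rational relation
   between the generators. *)
Lemma rep_Liouville : exists2 ka : R, 0 < ka &
  forall n L x, rep n L x -> x != 0 -> ka <= `|x| * (a%:R ^+ n * L ^+ d).
Proof.
have [i vi] := v_neq0; have vi0 : 0 < `|v i 0| by rewrite normr_gt0.
pose s : R := \sum_k `|v k 0|.
have s0 : 0 < s by apply: lt_le_trans vi0 _; rewrite /s (bigD1 i) //= lerDl sumr_ge0.
have f0 : 0 < d`!%:R :> R by rewrite ltr0n fact_gt0.
exists (`|v i 0| / (d`!%:R * s)); first by rewrite divr_gt0 // mulr_gt0.
move=> n L x [N [h1 h2]] x0.
have dN : \det N != 0.
  apply/negP => /det0P[u u0 uN]; case/negP: u0; apply/eqP; apply: v_ind.
  have : map_mx intr u *m (map_mx intr N *m v) = 0.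
    by rewrite mulmxA -map_mxM uN map_mx0 mul0mx.
  rewrite h1 -scalemxAr => /eqP; rewrite scaler_eq0 mulf_eq0 (negbTE x0) orbF.
  by rewrite expf_eq0 pnatr_eq0 -[_ == 0%N]negbK -lt0n a0 andbF /= => /eqP.
have : map_mx intr (\adj N) *m (map_mx intr N *m v) = (\det N)%:~R *: v.
  by rewrite mulmxA -map_mxM mul_adj_mx map_scalar_mx mul_scalar_mx.
rewrite h1 -scalemxAr => /colP/(_ i); rewrite mxE [RHS]mxE => h3.
have d1 : 1 <= `|(\det N)%:~R : R|.
  by rewrite -intr_norm -[1]/((1 : int)%:~R) ler_int -gtz0_ge1 normr_gt0.
rewrite ler_pdivrMr ?mulr_gt0 //.
apply: (@le_trans _ _ `|(\det N)%:~R * v i 0|); first by rewrite normrM ler_peMl.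
rewrite -h3 !normrM [`|a%:R ^+ n|]ger0_norm ?exprn_ge0 // mxE.
have -> : `|x| * (a%:R ^+ n * L ^+ d) * (d`!%:R * s) =
  a%:R ^+ n * `|x| * (d`!%:R * L ^+ d * s) by ring.
apply: ler_wpM2l; first by rewrite mulr_ge0 ?exprn_ge0.
apply: le_trans (ler_norm_sum _ _ _) _; rewrite /s mulr_sumr; apply: ler_sum => k _.
rewrite normrM; apply: ler_wpM2r => //.
rewrite map_mx_adj; apply: (@adj_bound _ d.+1) => p q; rewrite mxE; exact: h2.
Qed.

(* By Cramer's rule and Liouville's bound, a vector of small height in the span
   of vectors of small height has controlled coefficients in a basis extracted
   from them. *)
Lemma Cramer_gap (M : nat) : exists2 C : R, 1 <= C & exists P : nat,
  forall n (L : R) N (V : 'M[R]_(N, M)) (x : 'rV[R]_M), 1 <= L ->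
  (forall i j, rep n L (V i j)) -> (forall j, rep n L (x 0 j)) -> (x <= V)%MS ->
  forall (t : 'cV[R]_M) (th : R), 0 <= th -> (forall i, `|(V *m t) i 0| <= th) ->
  `|(x *m t) 0 0| <= (C * a%:R ^+ n * L) ^+ P * th.
Proof.
have [B B1 hB] := rep_bound; have [ka ka0 hka] := rep_Liouville.
pose C : R := B + D + M`!%:R + M%:R + ka^-1.
have kaV : 0 < ka^-1 by rewrite invr_gt0.
have [CB CD CM CN Ck] : [/\ B <= C, D <= C, M`!%:R <= C, M%:R <= C & ka^-1 <= C].
  have B0 : 0 <= B by apply: le_trans B1.
  have := ler0n R d.+1; have := ler0n R M`!; have := ler0n R M.
  rewrite /C; move: (d.+1%:R) (M`!%:R) (M%:R) (ka^-1) kaV B0 => d1 m1 m2 k1 *.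
  by split; lra.
have C1 : 1 <= C by apply: le_trans CB.
exists C => //; exists (4 + (M + M + d + M * d))%N => n L N V x L1 hV hx xV t th th0 hth.
(* Every constant, height and factorial below is at most Z, so the estimates reduce to counting
   factors. *)
set Z := C * a%:R ^+ n * L.
have A1 : 1 <= a%:R ^+ n :> R by rewrite exprn_ege1 // ler1n.
have CA : C <= C * a%:R ^+ n by rewrite ler_peMr // (le_trans ler01).
have CZ : C <= Z.
  apply: le_trans (CA) _; rewrite /Z ler_peMr //.
  by apply: le_trans ler01 _; apply: le_trans CA.
have Z1 : 1 <= Z by apply: le_trans CZ.
have Z0 : 0 <= Z by apply: le_trans Z1.
have pC : 0 <= C by apply: le_trans C1.
have L0 : 0 <= L by apply: le_trans L1.
have CLZ : C * L <= Z by rewrite /Z ler_wpM2r.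
have AZ : a%:R ^+ n <= Z.
  rewrite /Z mulrAC ler_peMl ?(le_trans ler01) //.
  by rewrite mulr_ege1.
set r := \rank V.
have rM : (r <= M)%N by exact: rank_leq_col.
have cst k : (k <= M)%N -> k%:R <= Z by move=> kM; apply: le_trans CZ; apply: le_trans CN; rewrite ler_nat.
have fct k : (k <= M)%N -> k`!%:R <= Z.
  by move=> kM; apply: le_trans CZ; apply: le_trans CM; rewrite ler_nat leq_fact.
(* V1 is a basis of the row space and G an invertible square block of its transpose; Cramer's rule
   for G gives the coordinates y of x in that basis. *)
pose V1 := rowsub (maxrankfun V) V.
have V1f : row_free V1 by exact: maxrowsub_free.
have V1V : (V1 :=: V)%MS by exact: eq_maxrowsub.
have V1T : row_full V1^T by rewrite /row_full mxrank_tr.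
pose G := rowsub (fullrankfun V1T) V1^T.
have Gu : G \in unitmx by exact: fullrowsub_unit.
have hG i j : rep n L (G i j) by rewrite !mxE.
have [y xy] : exists y, x = y *m V1 by apply/submxP; rewrite V1V.
pose xg := rowsub (fullrankfun V1T) x^T.
have xgy : xg = G *m y^T.
  by rewrite /xg xy trmx_mul /G; apply/colP => i; rewrite !mxE; apply: eq_bigr => k _; rewrite !mxE.
have dG : \det G != 0 by rewrite unitmxE unitfE in Gu.
have hdet : `|\det G|^-1 <= Z ^+ (1 + (r + d + r * d)).
  have h := hka _ _ _ (rep_det hG) dG.
  have p0 : 0 < `|\det G| by rewrite normr_gt0.
  rewrite -(ler_pM2l p0) divff ?gt_eqF //.
  have h2 : a%:R ^+ (r * n) * (r`!%:R * (D * L) ^+ r) ^+ d <= Z ^+ (r + d + r * d).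
    rewrite exprMn -exprM !exprD mulrA; apply: ler_pM.
    - by rewrite mulr_ge0 ?exprn_ge0.
    - by rewrite exprn_ge0 // mulr_ge0.
    - apply: ler_pM; rewrite ?exprn_ge0 //.
        by rewrite mulnC exprM lerXn2r ?nnegrE ?exprn_ge0.
      by rewrite lerXn2r ?nnegrE // fct.
    - rewrite lerXn2r ?nnegrE ?mulr_ge0 //.
      by apply: le_trans CLZ; rewrite ler_wpM2r.
  rewrite exprD expr1; apply: (@le_trans _ _ (ka^-1 * ka)); first by rewrite mulVf ?gt_eqF.
  apply: le_trans (_ : ka^-1 * (`|\det G| * Z ^+ (r + d + r * d)) <= _).
    rewrite ler_wpM2l ?(ltW kaV) //; apply: le_trans h _; exact: ler_wpM2l.
  rewrite mulrCA; apply: ler_wpM2l => //; apply: ler_wpM2r; first exact: exprn_ge0.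
  by apply: le_trans Ck CZ.
have hy i : `|y 0 i| <= Z ^+ (3 + (r + r + d + r * d)).
  have : \adj G *m xg = \det G *: y^T by rewrite xgy mulmxA mul_adj_mx mul_scalar_mx.
  move=> /colP/(_ i); rewrite [RHS]mxE [y^T i 0]mxE => e.
  have -> : y 0 i = (\det G)^-1 * (\adj G *m xg) i 0 by rewrite e mulKf.
  rewrite normrM normfV.
  have ar (k l : nat) : (3 + (k + k + l + k * l) = (1 + (k + l + k * l)) + (2 + k))%N.
    by clear; lia.
  rewrite ar exprD; apply: ler_pM; rewrite ?invr_ge0 //.
  rewrite mxE; apply: le_trans (ler_norm_sum _ _ _) _.
  apply: (@le_trans _ _ (\sum_(k < r) Z ^+ (1 + r))); last first.
    rewrite sumr_const card_ord -[_ *+ _]mulr_natl -[(2 + r)%N]/((1 + r).+1) exprS.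
    by apply: ler_wpM2r; [exact: exprn_ge0|exact: cst].
  apply: ler_sum => k _; rewrite normrM.
  have r0 : (0 < r)%N by apply: leq_ltn_trans (ltn_ord k).
  have er : (1 + r = (1 + r.-1) + 1)%N by rewrite addn1 !add1n (prednK r0).
  rewrite er exprD expr1; apply: ler_pM => //.
    apply: (@le_trans _ _ (r.-1`!%:R * (B * L) ^+ r.-1)).
      by apply: adj_bound => p q; apply: hB (hG p q).
    rewrite exprD expr1; apply: ler_pM; rewrite ?exprn_ge0 ?mulr_ge0 ?(le_trans ler01 B1) //.
      by apply: fct; apply: leq_trans rM; exact: leq_pred.
    rewrite lerXn2r ?nnegrE ?mulr_ge0 ?(le_trans ler01 B1) //.
    by apply: le_trans CLZ; rewrite ler_wpM2r.
  rewrite !mxE; apply: le_trans (hB _ _ _ (hx _)) _.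
  by apply: le_trans CLZ; rewrite ler_wpM2r.
have : `|(x *m t) 0 0| <= Z ^+ (4 + (r + r + d + r * d)) * th.
  rewrite xy -mulmxA mxE; apply: le_trans (ler_norm_sum _ _ _) _.
  apply: (@le_trans _ _ (\sum_(k < r) Z ^+ (3 + (r + r + d + r * d)) * th)).
    apply: ler_sum => k _; rewrite normrM; apply: ler_pM => //.
    have -> : (V1 *m t) k 0 = (V *m t) (maxrankfun V k) 0 by rewrite /V1 !mxE; apply: eq_bigr => l _; rewrite mxE.
    exact: hth.
  rewrite sumr_const card_ord -[_ *+ _]mulr_natl mulrA; apply: ler_wpM2r => //.
  rewrite -[(4 + _)%N]/((3 + (r + r + d + r * d)).+1) exprS.
  by apply: ler_wpM2r; [exact: exprn_ge0|exact: cst].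
move=> h; apply: le_trans h _; apply: ler_wpM2r => //.
apply: ler_weXn2l => //; rewrite leq_add2l leq_add //; last by rewrite leq_mul2r rM orbT.
by rewrite leq_add2r leq_add.
Qed.
End Heights.

(** * Linear relations between translations *)

Section Translations.
Variables (R : realType) (S : wifs R).
Hypothesis lam_alg : forall j, algebraicOver (@ratr R) (@wlam R S j).
Local Notation A := ('I_(wm S).+1).
Local Notation lam := (@wlam R S).
Local Notation m1 := (wm S).+1.
Local Notation E j := (expR (j%:R : R)).

(* The coefficients of the translation part of a word, seen as a linear form in
   the translations of the maps. *)
Fixpoint cw (w : seq A) : 'rV[R]_m1 :=
  if w is j :: w' then delta_mx 0 j + lam j *: cw w' else 0.

Definition tv : 'cV[R]_m1 := \col_j @wt R S j.

Lemma cw_cat u w : cw (u ++ w) = cw u + lamw S u *: cw w.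
Proof.
elim: u => [|j u IH] /=; first by rewrite add0r lamw_nil scale1r.
by rewrite IH scalerDr addrA scalerA lamw_cons.
Qed.

Lemma cw_trw w : (cw w *m tv) 0 0 = trw S w.
Proof.
elim: w => [|j w IH] /=; first by rewrite mul0mx mxE trw_nil.
rewrite mulmxDl mxE -rowE -scalemxAl [X in _ + X]mxE IH !mxE.
by rewrite /trw /= /ifs_map addrC.
Qed.

Definition dif (l : nat) (x : 'rV[R]_m1) : Prop :=
  exists w w', [/\ (size w <= l)%N, (size w' <= l)%N & x = cw w - cw w'].

Lemma dif_tv w w' : ((cw w - cw w') *m tv) 0 0 = trw S w - trw S w'.
Proof. by rewrite mulmxBl !mxE -!cw_trw !mxE. Qed.

(** Coefficient vectors of words of length l have height exponential in l, so the polynomial loss of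
    [Cramer_gap] is exponential in l. *)
Lemma dif_gap : exists2 C : R, 1 <= C &
  forall l N (V : 'M[R]_(N, m1)) x th, 0 <= th ->
  (forall i, dif l (row i V)) -> dif l x -> (x <= V)%MS ->
  (forall i, `|(V *m tv) i 0| <= th) -> `|(x *m tv) 0 0| <= C ^+ l.+1 * th.
Proof.
have [d [a [B [v [a0 ind hB]]]]] := integral_module lam_alg.
pose D : R := d.+1%:R.
pose K : R := \sum_j \sum_i \sum_k `|(B j i k)%:~R|.
have hlam j : rep a v 1 K (lam j).
  exists (B j); split=> [|i k]; first by rewrite expr1 hB.
  rewrite /K (bigD1 j) //= (bigD1 i) //= (bigD1 k) //= -!addrA lerDl.
  by rewrite !addr_ge0 // !sumr_ge0 // => *; rewrite ?sumr_ge0 // => *; rewrite sumr_ge0.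
have K0 : 0 <= K by apply: rep_ge0 (hlam ord0).
have aR : 1 <= a%:R :> R by rewrite ler1n.
(* Growth of the height per letter: [a] pays for padding the new unit vector to the common
   denominator, [D * K] for one multiplication by a ratio. *)
pose K1 : R := a%:R + D * K.
have DK : 0 <= D * K by rewrite mulr_ge0 ?ler0n.
have K11 : 1 <= K1 by rewrite /K1; lra.
have aK1 : a%:R <= K1 by rewrite /K1; lra.
have hcw l w j : (size w <= l)%N -> rep a v l (K1 ^+ l) (cw w 0 j).
  elim: w l => [|i w IH] [|l] //= sw.
  - by rewrite mxE; apply: rep_le (rep0 _ _ _); rewrite expr0.
  - by rewrite mxE; apply: rep_le (rep0 _ _ _); rewrite exprn_ge0 // (le_trans ler01).
  rewrite mxE [X in _ + X]mxE exprS {1}/K1 mulrDl.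
  apply: repD.
    rewrite mxE; case: (_ && _); last first.
      by apply: rep_le (rep0 _ _ _); rewrite mulr_ge0 ?exprn_ge0 // (le_trans ler01).
    have := rep_pad l.+1 (rep1 a v); rewrite addn0 mulr1; apply: rep_le.
    by rewrite exprS ler_wpM2l // lerXn2r // nnegrE (le_trans ler01).
  by rewrite -mulrA -add1n; apply: repM (hlam i) (IH _ sw).
have hdif l x j : dif l x -> rep a v l (2 * K1 ^+ l) (x 0 j).
  move=> [w [w' [sw sw' ->]]]; rewrite !mxE mulr_natl mulr2n; apply: repD; first exact: hcw.
  apply: repN; exact: hcw.
have [C C1 [P hC]] := Cramer_gap a0 ind m1.
have CK : 1 <= C * a%:R * (2 * K1).
  by rewrite !mulr_ege1 //; lra.
exists ((C * a%:R * (2 * K1)) ^+ P); first exact: exprn_ege1.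
move=> l N V x th th0 hV hx xV ht.
have L1 : 1 <= 2 * K1 ^+ l by rewrite mulr_ege1 ?exprn_ege1 //; lra.
have hV' i j : rep a v l (2 * K1 ^+ l) (V i j) by have := hdif _ _ j (hV i); rewrite mxE.
apply: le_trans (hC l _ _ V x L1 hV' (fun j => hdif _ _ j hx) xV tv th th0 ht) _.
apply: ler_wpM2r => //; rewrite -exprM mulnC exprM.
have p0 y : 1 <= y :> R -> 0 <= y by apply: le_trans.
have [C0 K10] : 0 <= C /\ 0 <= K1 by split; apply: p0.
have X0 : 0 <= C * a%:R ^+ l * (2 * K1 ^+ l) by rewrite !mulr_ge0 ?exprn_ge0.
suff XY : C * a%:R ^+ l * (2 * K1 ^+ l) <= (C * a%:R * (2 * K1)) ^+ l.+1.
  by rewrite lerXn2r ?nnegrE //; apply: le_trans XY.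
have -> : C * a%:R ^+ l * (2 * K1 ^+ l) = (2 * C) * (a%:R ^+ l * K1 ^+ l) by ring.
rewrite !exprMn [(C ^+ _)]exprS.
have X1 : 1 <= C ^+ l by rewrite exprn_ege1.
have X2 : a%:R ^+ l <= a%:R ^+ l.+1 :> R by rewrite ler_weXn2l.
have X3 : K1 ^+ l <= K1 ^+ l.+1 by rewrite ler_weXn2l.
have X4 : 2 <= 2 ^+ l.+1 :> R by rewrite exprS ler_peMr // exprn_ege1 //; lra.
have -> : C * C ^+ l * a%:R ^+ l.+1 * (2 ^+ l.+1 * K1 ^+ l.+1) =
  (2 ^+ l.+1 * (C * C ^+ l)) * (a%:R ^+ l.+1 * K1 ^+ l.+1) by ring.
apply: ler_pM; rewrite ?mulr_ge0 ?exprn_ge0 //.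
  by apply: ler_pM; rewrite ?mulr_ge0 ?exprn_ge0 // ler_peMr //; apply: mulr_ege1.
by apply: ler_pM; rewrite ?mulr_ge0 ?exprn_ge0.
Qed.

Local Notation c := (cmin S).

Lemma lenb_le n n' : (n <= n')%N -> (lenb S n <= lenb S n')%N.
Proof.
move=> nn; apply: le_truncn; rewrite ler_wpM2r ?invr_ge0 ?(ltW (ln_rmax_lt0 S)) //.
by rewrite lerD2r ler_nat.
Qed.

Lemma lenb_unbounded l : exists n0, forall n, (n0 <= n)%N -> (l <= lenb S n)%N.
Proof.
have [n0 h0] := arch_nat (l%:R * - ln (rmax S)); exists n0 => n /h0 h.
have l0 := ln_rmax_lt0 S.
have c0 : 0 <= - ln c by rewrite oppr_ge0 ln_le0 // ltW // cmin_lt1.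
have h2 : l%:R <= (n%:R - ln c) / - ln (rmax S) by rewrite ler_pdivlMr //; lra.
by rewrite /lenb truncn_ge_nat // (le_trans _ h2).
Qed.

Lemma lenb_exp (C : R) : 1 <= C -> exists k : nat, forall n,
  C ^+ (lenb S n).+1 <= E (k * n.+1).
Proof.
move=> C1; have l0 := ln_rmax_lt0 S; set lr := - ln (rmax S) in l0.
have c0 : 0 <= - ln c by rewrite oppr_ge0 ln_le0 // ltW // cmin_lt1.
pose K := (1 - ln c) / lr + 1.
have K0 : 0 <= K by rewrite /K addr_ge0 // divr_ge0 ?(ltW l0) //; lra.
have lC : 0 <= ln C by exact: ln_ge0.
have [k hk] := arch_nat (K * ln C); exists k => n.
have Cp : 0 < C by apply: lt_le_trans C1.
rewrite -[C](lnK Cp) -expRM_natl ler_expR natrM.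
have h := hk k (leqnn k).
have h1 : (lenb S n).+1%:R <= K * n.+1%:R.
  have p : 0 <= (n%:R - ln c) / lr by rewrite divr_ge0 ?(ltW l0) // addr_ge0.
  have /andP[h1 _] := truncn_itv p; rewrite -!natr1.
  apply: le_trans (_ : (n%:R - ln c) / lr + 1 <= _); first by rewrite lerD2r.
  have i0 : 0 <= lr^-1 by rewrite invr_ge0 ltW.
  have : 0 <= n%:R * (- ln c * lr^-1) by rewrite !mulr_ge0.
  have := ler0n R n; rewrite /K; lra.
apply: le_trans (_ : K * n.+1%:R * ln C <= _); first by rewrite ler_wpM2r.
by rewrite mulrAC ler_wpM2r.
Qed.

Definition close_pairs (q n : nat) : seq (seq A * seq A) :=
  [seq z <- [seq (w, w') | w <- unzip2 (fdl (Stop S (E n))),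
                           w' <- unzip2 (fdl (Stop S (E n)))] |
   E (q * n) * `|trw S z.1 - trw S z.2| <= 1].

Definition Wraw q n : 'M[R]_(size (close_pairs q n), m1) :=
  \matrix_i (let z := nth ([::], [::]) (close_pairs q n) i in cw z.1 - cw z.2).

(** The square form of the span gives the spaces of all levels one type. *)
Definition W q n : 'M[R]_m1 := (<<Wraw q n>>)%MS.

Lemma W_mem q n w w' : supp (Stop S (E n)) w -> supp (Stop S (E n)) w' ->
  E (q * n) * `|trw S w - trw S w'| <= 1 -> (cw w - cw w' <= W q n)%MS.
Proof.
move=> sw sw' h; rewrite genmxE.
have zin : (w, w') \in close_pairs q n.
  by rewrite mem_filter h; apply/allpairsP; exists (w, w').
have i0 : (index (w, w') (close_pairs q n) < size (close_pairs q n))%N by rewrite index_mem.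
have -> : cw w - cw w' = row (Ordinal i0) (Wraw q n) by rewrite rowK /= nth_index.
exact: row_sub.
Qed.

Lemma Wraw_row q n i : exists w w', [/\ supp (Stop S (E n)) w, supp (Stop S (E n)) w',
  row i (Wraw q n) = cw w - cw w' & E (q * n) * `|trw S w - trw S w'| <= 1].
Proof.
rewrite rowK; have := mem_nth ([::], [::]) (ltn_ord i); move: (nth _ _ _) => z.
by rewrite mem_filter => /andP[h /allpairsP[[w w'] /= [sw sw' e]]]; exists w, w'; rewrite e in h *.
Qed.

Lemma Wraw_dif q n i : dif (lenb S n) (row i (Wraw q n)).
Proof.
have [w [w' [sw sw' -> _]]] := Wraw_row i; exists w, w'; split=> //; exact: Stop_size_le.
Qed.

Lemma Wraw_tv q n i : `|(Wraw q n *m tv) i 0| <= expR (- (q * n)%:R).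
Proof.
have [w [w' [_ _ e h]]] := Wraw_row i.
have -> : (Wraw q n *m tv) i 0 = (row i (Wraw q n) *m tv) 0 0.
  by rewrite -row_mul [RHS]mxE.
by rewrite e dif_tv expRN -[X in _ <= X]mul1r ler_pdivlMr ?expR_gt0 // mulrC.
Qed.

(** [q] is fixed against the rate of [dif_gap], so that relations as small as e^-(q n) keep their
    linear combinations small at the level of the words combined. *)
Lemma exists_gap : exists q : nat, [/\ (2 <= q)%N,
  forall n x, (0 < n)%N -> dif (lenb S (n + n)) x -> (x <= W q n + W q (n + n))%MS ->
    `|(x *m tv) 0 0| <= expR (- (n + n)%:R) &
  forall n x, (0 < n)%N -> dif (lenb S n) x -> (x <= W q n)%MS ->
    `|(x *m tv) 0 0| <= expR (- n%:R)].
Proof.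
have [C C1 hC] := dif_gap; have [k hk] := lenb_exp C1.
(* At level 2 n the loss is at most e^(k (2 n + 1)) <= e^(3 k n), which leaves e^-(2 n) out of e^-(q
   n). *)
pose q := (3 * k + 2)%N; exists q.
have q2 : (2 <= q)%N by rewrite /q leq_addl.
have ar1 (n : nat) : (0 < n)%N -> (k * (n + n).+1 + (n + n) <= q * n)%N.
  by rewrite /q; clear; nia.
have ar2 (n : nat) : (0 < n)%N -> (k * n.+1 + n <= q * n)%N.
  by rewrite /q; clear; nia.
have fin a b d : (a + b <= d)%N -> E a * expR (- d%:R) <= expR (- b%:R : R).
  by move=> h; rewrite -expRD ler_expR; move: h; rewrite -(ler_nat R) natrD; lra.
split=> // n x n0 dx xW.
- have xV : (x <= col_mx (Wraw q n) (Wraw q (n + n)))%MS.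
    apply: submx_trans xW _; rewrite -addsmxE addsmxS // genmxE //.
  have th0 : 0 <= expR (- (q * n)%:R : R) by apply: expR_ge0.
  apply: le_trans (hC _ _ _ _ _ th0 _ dx xV _) _.
  + move=> i; case: (split_ordP i) => j ->.
      have -> : row (lshift _ j) (col_mx (Wraw q n) (Wraw q (n + n))) = row j (Wraw q n).
        by apply/rowP => kk; rewrite [LHS]mxE col_mxEu [RHS]mxE.
      have [w [w' [sw sw' e]]] := Wraw_dif j; exists w, w'; split=> //.
        by apply: leq_trans sw _; rewrite lenb_le // leq_addr.
      by apply: leq_trans sw' _; rewrite lenb_le // leq_addr.
    have -> : row (rshift _ j) (col_mx (Wraw q n) (Wraw q (n + n))) = row j (Wraw q (n + n)).
      by apply/rowP => kk; rewrite [LHS]mxE col_mxEd [RHS]mxE.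
    exact: Wraw_dif.
  + move=> i; rewrite mul_col_mx; case: (split_ordP i) => j ->; rewrite ?col_mxEu ?col_mxEd.
      exact: Wraw_tv.
    apply: le_trans (Wraw_tv j) _; rewrite ler_expR lerN2 ler_nat mulnDr; exact: leq_addr.
  apply: le_trans (fin _ _ _ (ar1 n n0)); apply: ler_wpM2r => //; exact: hk.
have th0 : 0 <= expR (- (q * n)%:R : R) by apply: expR_ge0.
have xV : (x <= Wraw q n)%MS by move: xW; rewrite genmxE.
apply: le_trans (hC _ _ _ _ _ th0 _ dx xV _) _; [exact: Wraw_dif|exact: Wraw_tv|].
apply: le_trans (fin _ _ _ (ar2 n n0)); apply: ler_wpM2r => //; exact: hk.
Qed.

End Translations.

(** * Entropy of words modulo a subspace *)

Section WordEntropy.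
Variables (R : realType) (S : wifs R).
Local Notation A := ('I_(wm S).+1).
Local Notation lam := (@wlam R S).
Local Notation t := (@wt R S).
Local Notation p := (@wp R S).
Local Notation m1 := (wm S).+1.
Local Notation E j := (expR (j%:R : R)).
Local Notation c := (cmin S).

Definition entn : R := - \sum_j p j * ln (p j).
Definition lyapn : R := - \sum_j p j * ln `|lam j|.

Lemma p_le1 j : p j <= 1.
Proof.
by rewrite -(wp_sum S) (bigD1 j) //= lerDl sumr_ge0 // => k _; rewrite ltW // wp_gt0.
Qed.

Lemma entn_ge0 : 0 <= entn.
Proof.
rewrite /entn -sumrN sumr_ge0 // => j _.
by rewrite -mulrN mulr_ge0 ?(ltW (wp_gt0 j)) // oppr_ge0 ln_le0 // p_le1.
Qed.

Lemma lyapn_gt0 : 0 < lyapn.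
Proof.
have h j : 0 < - (p j * ln `|lam j|).
  by rewrite -mulrN mulr_gt0 ?wp_gt0 // oppr_gt0 ln_lt0 // lam_norm_lt1 lam_norm_gt0.
rewrite /lyapn -sumrN (bigD1 ord0) //=; apply: ltr_pwDl; first exact: h.
by apply: sumr_ge0 => j _; exact/ltW/h.
Qed.

Lemma ln_prod (T : Type) (s : seq T) (f : T -> R) : (forall j, 0 < f j) ->
  ln (\prod_(j <- s) f j) = \sum_(j <- s) ln (f j).
Proof.
move=> f0; elim: s => [|j s IH]; first by rewrite !big_nil ln1.
rewrite !big_cons lnM ?posrE ?f0 ?IH //; exact: prodr_gt0.
Qed.

(** Optional stopping for the centred letter function -ln p + h ln |lam|, combined with the fact
    that a stopped word contracts by at least e^n. *)
Lemma H_words_ge n : entn / lyapn * n%:R <= Hent (Stop S (E n)) id.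
Proof.
have l0 := lyapn_gt0; set h := entn / lyapn.
have h0 : 0 <= h by rewrite divr_ge0 ?entn_ge0 // ltW.
pose f j : R := - ln (p j) + h * ln `|lam j|.
have f0 : \sum_j p j * f j = 0.
  rewrite /f; under eq_bigr do rewrite mulrDr mulrN mulrCA.
  rewrite big_split /= sumrN -mulr_sumr.
  have -> : \sum_j p j * ln `|lam j| = - lyapn by rewrite /lyapn opprK.
  by rewrite -[- \sum_j _]/entn /h mulrN divfK ?subrr // gt_eqF.
rewrite -[X in X <= _]addr0 -(Stop_mart (E n) f0) -[X in X + _](Ex_cst (Stop S (E n))) -ExD.
apply: le_Ex => w wS /=; rewrite pm_Stop // ln_prod; last by exact: wp_gt0.
rewrite /f big_split /= sumrN -mulr_sumr -(@ln_prod _ w (fun j => `|lam j|)); last first.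
  by move=> j; exact: lam_norm_gt0.
have := Stop_upper wS; rewrite -normr_prod -/(lamw S w) => hw.
have lw := lamw_gt0 w.
have : n%:R + ln `|lamw S w| <= 0.
  by rewrite -[n%:R]expRK -lnM ?posrE ?expR_gt0 // ln_le0.
move=> h1; have : h * (n%:R + ln `|lamw S w|) <= 0 by rewrite mulr_ge0_le0.
lra.
Qed.

(** If w and w' give the same map, so do w w' and w' w, which have equal length. These are distinct
    because stopped words form a prefix code. *)
Lemma Stop_injective (s : R) w w' : ~ has_exact_overlaps lam t ->
  supp (Stop S s) w -> supp (Stop S s) w' -> trw S w = trw S w' ->
  lamw S w = lamw S w' -> w = w'.
Proof.
move=> no ws ws' tt ll; apply/eqP; apply: contraT => ww; case: no.
have ne : w ++ w' != w' ++ w.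
  apply/eqP => e; case/negP: ww; apply/eqP.
  have [sz|sz] := leqP (size w) (size w').
    have e1 : w = take (size w) w'.
      by have := congr1 (take (size w)) e; rewrite take_size_cat // takel_cat.
    move: ws'; rewrite -(cat_take_drop (size w) w') -e1 => /(Stop_prefix ws).
    by move=> e2; have := cat_take_drop (size w) w'; rewrite -e1 e2 cats0.
  have e1 : w' = take (size w') w.
    by have := congr1 (take (size w')) e; rewrite takel_cat ?(ltnW sz) // take_size_cat.
  move: ws; rewrite -(cat_take_drop (size w') w) -e1 => /(Stop_prefix ws').
  by move=> e2; have := cat_take_drop (size w') w; rewrite -e1 e2 cats0.
have sz2 : size (w' ++ w) == (size w + size w')%N by rewrite size_cat addnC.
have sz1 : size (w ++ w') == (size w + size w')%N by rewrite size_cat.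
exists (size w + size w')%N, (Tuple sz1), (Tuple sz2); split=> //.
- rewrite lt0n addn_eq0; apply/negP => /andP[/nilP e1 /nilP e2].
  by move: ne; rewrite e1 e2.
- by move=> x; rewrite /= !ifs_wordE !lamw_cat !trw_cat tt ll.
Qed.

(* Entropy of the coefficient vector of a word modulo U, jointly with its ratio. *)
Definition HU (n : nat) (U : 'M[R]_m1) : R :=
  Hent (Stop S (E n)) (fun w => (cw w *m cokermx U, lamw S w)).

Lemma cw_sub (U : 'M[R]_m1) (w w' : seq A) :
  (cw w *m cokermx U = cw w' *m cokermx U) <-> (cw w - cw w' <= U)%MS.
Proof.
by rewrite submxE mulmxBl subr_eq0; split=> [->|/eqP].
Qed.

Lemma HU_le_fun n U (V : eqType) (X : seq A -> V) :
  (forall w w', supp (Stop S (E n)) w -> supp (Stop S (E n)) w' -> X w = X w' ->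
     (cw w - cw w' <= U)%MS /\ lamw S w = lamw S w') -> HU n U <= Hent (Stop S (E n)) X.
Proof. by move=> h; apply: H_fun_le => w w' ws ws' /(h w w' ws ws')[/cw_sub -> ->]. Qed.

Lemma HU_ge_fun n U (V : eqType) (X : seq A -> V) :
  (forall w w', supp (Stop S (E n)) w -> supp (Stop S (E n)) w' ->
    (cw w - cw w' <= U)%MS -> lamw S w = lamw S w' -> X w = X w') ->
  Hent (Stop S (E n)) X <= HU n U.
Proof. by move=> h; apply: H_fun_le => w w' ws ws' [/cw_sub h1 h2]; exact: h. Qed.

Lemma HU_le n U V : (U <= V)%MS -> HU n V <= HU n U.
Proof.
move=> UV; apply: HU_le_fun => w w' _ _ [/cw_sub h ->]; split=> //.
exact: submx_trans UV.
Qed.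

(** Classes modulo [U] and [V] together determine the class modulo the intersection, and each alone
    determines the class modulo the sum. *)
Lemma HU_submodular n U V : HU n (U :&: V)%MS + HU n (U + V)%MS <= HU n U + HU n V.
Proof.
pose X w := (cw w *m cokermx U : 'rV[R]_m1); pose Y w := (cw w *m cokermx V : 'rV[R]_m1).
pose Z w := (cw w *m cokermx (U + V)%MS : 'rV[R]_m1, lamw S w).
have sub := submodular (Stop S (E n)) X Y Z.
have h1 : HU n (U :&: V)%MS <= Hent (Stop S (E n)) (fun w => (X w, Y w, Z w)).
  apply: HU_le_fun => w w' _ _ [/cw_sub h1 /cw_sub h2 _ ->]; split=> //.
  by rewrite sub_capmx h1.
have h2 : Hent (Stop S (E n)) (fun w => (X w, Z w)) <= HU n U.
  apply: HU_ge_fun => w w' _ _ h e; congr (_, (_, _)) => //; apply/cw_sub => //.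
  by apply: submx_trans h _; exact: addsmxSl.
have h3 : Hent (Stop S (E n)) (fun w => (Y w, Z w)) <= HU n V.
  apply: HU_ge_fun => w w' _ _ h e; congr (_, (_, _)) => //; apply/cw_sub => //.
  by apply: submx_trans h _; exact: addsmxSr.
move: sub h1 h2 h3; rewrite -[Hent _ Z]/(HU n (U + V)%MS).
move: (HU _ _) (HU _ _) (HU _ _) (HU _ _) (Hent _ _) (Hent _ _) (Hent _ _) => *; lra.
Qed.

Definition words (b : nat) : seq (seq A) :=
  flatten [seq [seq val u | u <- enum {: k.-tuple A}] | k <- iota 0 b.+1].

Lemma mem_words b w : (size w <= b)%N -> w \in words b.
Proof.
move=> wb; apply/flatten_mapP; exists (size w); first by rewrite mem_iota.
by apply/mapP; exists (in_tuple w) => //; rewrite mem_enum.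
Qed.

(** Words stopped at comparable scales differ by a suffix of bounded length, which takes boundedly
    many values. *)
Lemma HU_scale : exists K : R, forall n s U, c * E n <= s -> s <= E n ->
  Hent (Stop S s) (fun w => (cw w *m cokermx U, lamw S w)) <= HU n U + K.
Proof.
have c0 := cmin_gt0 S; have c1 := cmin_lt1 S.
have l0 := ln_rmax_lt0 S.
pose b := Num.truncn ((- ln c - ln c) / - ln (rmax S)).
exists (ln (size (words b))%:R) => n s U h1 h2.
pose Y w := (cw w *m cokermx U : 'rV[R]_m1, lamw S w).
pose D := fpair (Stop S s) (fun w => Stop S (E n * `|lamw S w|)).
have e1 : Hent (Stop S s) Y = Hent D (fun z => Y z.1) by rewrite H_fst.
have e2 : HU n U = Hent D (fun z => Y (z.1 ++ z.2)) by rewrite /HU (H_Stop_cat Y h2).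
rewrite e1 e2.
apply: (@le_trans _ _ (Hent D (fun z => (Y (z.1 ++ z.2), z.2)))).
  apply: H_fun_le => [[w v] [w' v']] _ _ /= [+ + e3]; rewrite -e3 !cw_cat !lamw_cat.
  move=> e4 /(mulIf (lamw_neq0 v)) e5; rewrite /Y /= -e5; congr (_, _).
  by move: e4; rewrite -e5 !mulmxDl => /addIr.
apply: le_trans (H_pair_le _ _ _) _; rewrite lerD2l.
apply: H_le_ln (leqnn _) => -[w v] /supp_pair[/= ws vs]; apply: mem_words.
case: (lerP (E n * `|lamw S w|) 1) => h3.
  by move: vs; rewrite Stop_le1 // supp_ret => /eqP ->.
have := Stop_size (ltW h3) vs; rewrite -ler_pdivlMr // => h4.
rewrite /b truncn_ge_nat //; last first.
  by apply: divr_ge0 (ltW l0); rewrite addr_ge0 // oppr_ge0 ln_le0 // ltW.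
apply: le_trans h4 _; rewrite ler_wpM2r ?invr_ge0 ?(ltW l0) // lerD2r.
have h5 : E n * `|lamw S w| <= c^-1.
  rewrite -(ler_pM2l c0) divff ?gt_eqF // mulrA.
  by apply: le_trans (Stop_upper ws); rewrite ler_wpM2r.
rewrite -lnV ?posrE // ler_ln ?posrE ?invr_gt0 // (lt_trans ltr01 h3) //.
Qed.

(** A word of level 2 n is one of level n followed by one of nearly level n; the classes and ratios
    of the parts determine those of the whole. *)
Lemma HU_double : exists K : R, 0 <= K /\ forall n U, HU (n + n) U <= 2 * HU n U + K.
Proof.
have c0 := cmin_gt0 S; have c1 := cmin_lt1 S.
have [K hK] := HU_scale; exists `|K|; split=> // n U.
pose Y w := (cw w *m cokermx U : 'rV[R]_m1, lamw S w).
pose f w := Stop S (E (n + n) * `|lamw S w|).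
pose D := fpair (Stop S (E n)) f.
have e1 : HU (n + n) U = Hent D (fun z => Y (z.1 ++ z.2)).
  by rewrite /HU (H_Stop_cat Y (E_le R (leq_addr n n))).
have e2 : Hent D (fun z => (Y z.1, Y z.2)) =
    HU n U + Ex (Stop S (E n)) (fun w => Hent (f w) Y).
  by apply: H_pair_chain => w w' F _ _ [_ ll]; rewrite /f ll.
have h1 : HU (n + n) U <= Hent D (fun z => (Y z.1, Y z.2)).
  rewrite e1; apply: H_fun_le => [[w v] [w' v']] _ _ /= [e3 e4 e5 e6].
  rewrite /Y !cw_cat !lamw_cat e4 e6; congr (_, _).
  by rewrite !mulmxDl -!scalemxAl e3 e5.
have h2 : Ex (Stop S (E n)) (fun w => Hent (f w) Y) <= HU n U + `|K|.
  apply: Ex_le_cst => w ws; apply: le_trans (hK n _ U _ _) _.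
  - have := Stop_lower (le_trans (ltW c1) (E_ge1 R n)) ws => h.
    by rewrite ED -mulrA mulrC ler_wpM2l // ltW // E_gt0.
  - rewrite ED -mulrA ler_piMr ?(ltW (E_gt0 R n)) //; exact: Stop_upper.
  - by rewrite lerD2l ler_norm.
move: h1 h2; rewrite e2; move: (HU _ _) (HU _ _) (Ex _ _) => *; lra.
Qed.

(** Under the hypothesis, class and ratio locate the translation up to e^-n: [rep] picks a word with
    the same data, and its translation is used as the centre. *)
Lemma HU_ge_dim n (U : 'M[R]_m1) :
  (forall w w', supp (Stop S (E n)) w -> supp (Stop S (E n)) w' ->
    (cw w - cw w' <= U)%MS -> `|trw S w - trw S w'| <= expR (- n%:R)) ->
  hS S (E n) <= HU n U + lnb 2.
Proof.
move=> h; pose Y w := (cw w *m cokermx U : 'rV[R]_m1, lamw S w).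
pose rep y := head [::] [seq w <- unzip2 (fdl (Stop S (E n))) | Y w == y].
have hrep w : supp (Stop S (E n)) w -> supp (Stop S (E n)) (rep (Y w)) /\ Y (rep (Y w)) = Y w.
  move=> ws; have win : w \in [seq w' <- unzip2 (fdl (Stop S (E n))) | Y w' == Y w].
    by rewrite mem_filter eqxx.
  have : rep (Y w) \in [seq w' <- unzip2 (fdl (Stop S (E n))) | Y w' == Y w].
    by rewrite /rep; case: [seq _ <- _ | _] win => //= a l _; rewrite mem_head.
  by rewrite mem_filter => /andP[/eqP e1 e2].
apply: (@H_near_le _ _ _ _ _ Y (fun y => E n * trw S (rep y))) => // w ws.
have [rs /= [/esym/cw_sub re _]] := hrep w ws.
have h1 := Q_near (E n) (trw S w).
have h2 : `|E n * trw S w - E n * trw S (rep (Y w))| <= 1.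
  rewrite -mulrBr normrM (ger0_norm (ltW (E_gt0 R n))) mulrC.
  by rewrite -ler_pdivlMr ?E_gt0 // mul1r -expRN; apply: h.
apply: le_trans (ler_distD (E n * trw S w) _ _) _.
have -> : (2 : R) = 1 + 1 by ring.
exact: lerD.
Qed.

(** Two words in one cell of length e^-(q n) form a close pair, so their difference lies in [W]. *)
Lemma HU_W q n : HU n (W S q n) <=
  Hent (Stop S (E n)) (fun w => (Q (E (q * n)) (trw S w), lamw S w)).
Proof.
apply: HU_le_fun => w w' ws ws' [e ->]; split=> //; apply: W_mem => //.
have /andP[a1 a2] := Q_bound (E (q * n)) (trw S w).
have /andP[b1 b2] := Q_bound (E (q * n)) (trw S w').
rewrite -[X in X * _](ger0_norm (ltW (E_gt0 R _))) -normrM mulrBr ler_norml.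
by rewrite e in a1 a2; apply/andP; split; lra.
Qed.

End WordEntropy.

(** * Comparison of the entropy dimension with H(p) / chi *)

Section Rapaport.
Variables (R : realType) (S : wifs R).
Hypothesis lam_alg : forall j, algebraicOver (@ratr R) (@wlam R S j).
Hypothesis no_overlaps : ~ has_exact_overlaps (@wlam R S) (@wt R S).
Variables (al C : R).
Local Notation A := ('I_(wm S).+1).
Local Notation m1 := (wm S).+1.
Local Notation E j := (expR (j%:R : R)).
Hypothesis al0 : 0 <= al.
Hypothesis hS_up : forall n, hS S (E n) <= al * n%:R + C.
Hypothesis hS_low : forall e, 0 < e -> exists n0, forall n, (n0 <= n)%N ->
    (al - e) * n%:R <= hS S (E n).

Fixpoint Wcap (q : nat) (lev : nat -> nat) (i : nat) : 'M[R]_m1 :=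
  if i is k.+1 then (Wcap q lev k :&: W S q (lev i))%MS else W S q (lev 0).

Lemma Wcap_le q lev i j : (i <= j)%N -> (Wcap q lev j <= Wcap q lev i)%MS.
Proof.
elim: j => [|j IH]; first by case: i.
rewrite leq_eqVlt => /orP[/eqP -> //|ij]; apply: submx_trans (IH ij).
exact: capmxSl.
Qed.

Lemma Wcap_W q lev i j : (i <= j)%N -> (Wcap q lev j <= W S q (lev i))%MS.
Proof. by move/(Wcap_le q lev) => h; apply: submx_trans h _; case: i => // i; exact: capmxSr. Qed.

Lemma Wcap_stable q lev : exists i, forall j, (i <= j)%N -> (Wcap q lev i <= Wcap q lev j)%MS.
Proof.
have ex : exists r, `[< exists i, \rank (Wcap q lev i) = r >].
  by exists (\rank (Wcap q lev 0)); apply/asboolP; exists 0%N.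
have [r /asboolP[i ri] rmin] := ex_minnP ex; exists i => j ij.
have le := Wcap_le q lev ij.
rewrite -(geq_leqif (mxrank_leqif_sup le)) ri.
by apply: rmin; apply/asboolP; exists j.
Qed.

Lemma arith_drop (Hn Hs Hi HW H L T r r' m K e a : R) : 0 <= e * L ->
  Hn + Hs <= Hi + HW -> Hi <= 2 * H + K -> HW <= (a + e) * (L + L) ->
  (a - 2 * e) * (L + L) <= Hs -> H <= (a + e) * L + K * (T - 1) + 3 * e * (m - r) * L ->
  r' + 1 <= r ->
  Hn <= (a + e) * (L + L) + K * (2 * T - 1) + 3 * e * (m - r') * (L + L).
Proof.
move=> eL h1 h2 h3 h4 h5 h6; have : 0 <= e * L * (r - r' - 1) by apply: mulr_ge0 => //; lra.
lra.
Qed.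

Lemma arith_dim_low (U h l a e n : R) : h <= U + l -> (a - e) * n <= h -> l <= n * e ->
  (a - 2 * e) * n <= U.
Proof. lra. Qed.

Lemma arith_same (Hn Hi H L T r m K e a : R) :
  Hn <= Hi -> Hi <= 2 * H + K -> H <= (a + e) * L + K * (T - 1) + 3 * e * (m - r) * L ->
  Hn <= (a + e) * (L + L) + K * (2 * T - 1) + 3 * e * (m - r) * (L + L).
Proof. lra. Qed.

Lemma arith_end (h a e H L N T r m K : R) : 0 <= e -> 0 < L -> 0 <= K -> 0 <= r -> a < h ->
  e * (8 * (m + 1)) = h - a -> K <= N * ((h - a) / 8) -> L = N * T -> 0 <= T ->
  h * L <= H -> H <= (a + e) * L + K * (T - 1) + 3 * e * (m - r) * L -> 0 <= m -> False.
Proof.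
move=> e0 L0 K0 r0 ah e1 h1 e2 T0 h2 h3 m0.
have a1 : K * T <= N * ((h - a) / 8) * T by rewrite ler_wpM2r.
have a2 : 0 <= e * r * L by rewrite !mulr_ge0 // ltW.
have a3 : N * ((h - a) / 8) * T = L * (h - a) / 8 by rewrite e2; field.
have a4 : e * (8 * (m + 1)) * L = (h - a) * L by rewrite e1.
have a5 : 0 <= e * m * L by rewrite !mulr_ge0 // ltW.
have a6 : 0 <= e * L by rewrite !mulr_ge0 // ltW.
have a7 : 0 < (h - a) * L by rewrite mulr_gt0 // subr_gt0.
rewrite a3 in a1; lra.
Qed.

Theorem dim_ge : al < 1 -> entn S / lyapn S <= al.
Proof.
move=> al1; rewrite leNgt; apply/negP; set h := _ / _ => ah.
have [q [q2 gap2 gap1]] := exists_gap lam_alg.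
have [K [K0 hK]] := HU_double S.
have m0 : 0 < 8 * (m1%:R + 1) :> R by rewrite mulr_gt0 // ltr_wpDl ?ler0n.
(* The losses, e plus 3 e for each dimension and K / n0 for the doublings, then add up to at most
   half of h - al. *)
pose e := (h - al) / (8 * (m1%:R + 1)).
have e0 : 0 < e by rewrite divr_gt0 // subr_gt0.
have [n1 sup] := superexp_entropy al0 al1 hS_up hS_low q2 e0.
have [n2 low] := hS_low e0.
have [n3 h3] := arch_nat (lnb 2 / e).
have d8 : 0 < (h - al) / 8 by rewrite divr_gt0 // subr_gt0.
have [n4 h4] := arch_nat (K / ((h - al) / 8)).
pose n0 := (maxn n1 (maxn n2 (maxn n3 n4))).+1.
have [m1n m2n m3n m4n] : [/\ (n1 <= n0)%N, (n2 <= n0)%N, (n3 <= n0)%N & (n4 <= n0)%N].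
  by rewrite /n0; clear; split; lia.
(* Doubling the level makes the errors of [HU_double] add up to at most K 2^i, which is K / n0 times
   the level. *)
pose lev i := (n0 * 2 ^ i)%N.
have levn i : (n0 <= lev i)%N by rewrite leq_pmulr // expn_gt0.
have lev0 i : (0 < lev i)%N by apply: leq_trans (levn i).
have levS i : lev i.+1 = (lev i + lev i)%N by rewrite /lev expnS; clear; lia.
have levR i : (lev i.+1)%:R = (lev i)%:R + (lev i)%:R :> R by rewrite levS natrD.
pose U := Wcap q lev; pose rk i : R := (\rank (U i))%:R.
have rkm i : rk i <= m1%:R by rewrite ler_nat rank_leq_row.
have supW i : HU (lev i) (W S q (lev i)) <= (al + e) * (lev i)%:R.
  by apply: le_trans (HU_W _ _ _) _; apply: sup; apply: leq_trans (levn i).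
(* When the rank drops, submodularity with the sum of [U i] and the next [W], which nearly
   annihilates t, costs 3 e times the new level. When it does not, the space is unchanged and only
   the doubling costs. *)
have bound i : HU (lev i) (U i) <=
    (al + e) * (lev i)%:R + K * (2 ^+ i - 1) + 3 * e * (m1%:R - rk i) * (lev i)%:R.
  elim: i => [|i IH].
    rewrite expr0 subrr mulr0 addr0; apply: le_trans (supW 0%N) _; rewrite lerDl.
    apply: mulr_ge0 => //; apply: mulr_ge0; last by rewrite subr_ge0.
    by rewrite mulr_ge0 // ltW.
  have dbl : HU (lev i.+1) (U i) <= 2 * HU (lev i) (U i) + K by rewrite levS.
  have rle : (\rank (U i.+1) <= \rank (U i))%N by apply/mxrankS/capmxSl.
  rewrite levR exprS; case: (ltngtP (\rank (U i.+1)) (\rank (U i))) rle => // [rlt|req] _.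
    have sub := HU_submodular (lev i.+1) (U i) (W S q (lev i.+1)).
    have sW := supW i.+1; rewrite levR in sW.
    have r1 : rk i.+1 + 1 <= rk i by rewrite /rk natr1 ler_nat.
    have hge : hS S (E (lev i.+1)) <= HU (lev i.+1) (U i + W S q (lev i.+1))%MS + lnb 2.
      apply: HU_ge_dim => w w' ws ws' d; rewrite -dif_tv levS; apply: gap2 => //.
        by exists w, w'; rewrite -levS; split=> //; exact: Stop_size_le.
      apply: submx_trans d _; rewrite levS; apply: addsmxS => //; exact: Wcap_W.
    have hl := low _ (leq_trans m2n (levn i.+1)).
    have h3' := h3 _ (leq_trans m3n (levn i.+1)); rewrite ler_pdivrMr // in h3'.
    have sm : (al - 2 * e) * ((lev i)%:R + (lev i)%:R) <= HU (lev i.+1) (U i + W S q (lev i.+1))%MS.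
      by rewrite -levR; apply: arith_dim_low hge hl h3'.
    by apply: arith_drop sub dbl sW sm IH r1; rewrite mulr_ge0 // ltW.
  have mono : HU (lev i.+1) (U i.+1) <= HU (lev i.+1) (U i).
    by apply: HU_le; rewrite -(geq_leqif (mxrank_leqif_sup (capmxSl _ _))) req.
  by rewrite /rk req; apply: arith_same mono dbl IH.
have [i hi] := Wcap_stable q lev.
(* The stable space lies in every later [W], so a nonzero value, which is a fixed number, would have
   to be below e^-(lev j) for all large j. *)
have inj w w' : (cw w - cw w' <= U i)%MS -> trw S w = trw S w'.
  move=> ww; apply/eqP; rewrite -subr_eq0 -dif_tv; set y := _ 0 0; apply: contraT => y0.
  have yp : 0 < `|y| by rewrite normr_gt0.
  have [k1 hk1] := arch_nat (1 - ln `|y|).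
  have [k2 hk2] := lenb_unbounded S (maxn (size w) (size w')).
  pose j := maxn i (maxn k1 k2).
  have jl : (j <= lev j)%N.
    by apply: leq_trans (ltnW (ltn_expl j (ltnSn 1))) _; rewrite /lev leq_pmull.
  have [ij k1j k2j] : [/\ (i <= j)%N, (k1 <= lev j)%N & (k2 <= lev j)%N].
    by move: jl; rewrite /j; clear; split; lia.
  have := hk2 _ k2j; rewrite geq_max => /andP[s1 s2].
  have dw : dif (lenb S (lev j)) (cw w - cw w') by exists w, w'.
  have sw : (cw w - cw w' <= W S q (lev j))%MS.
    by apply: submx_trans ww _; apply: submx_trans (hi j ij) _; exact: Wcap_W.
  have hy := gap1 (lev j) _ (lev0 j) dw sw.
  have hy2 : ln `|y| <= - (lev j)%:R by rewrite -[leRHS]expRK ler_ln ?posrE ?expR_gt0.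
  move: (hk1 _ k1j) hy2; clear; move: (ln _) (_%:R) => *; lra.
have hid : Hent (Stop S (E (lev i))) id <= HU (lev i) (U i).
  apply: HU_ge_fun => w w' ws ws' /inj tt ll; exact: Stop_injective no_overlaps ws ws' tt ll.
have hlow := le_trans (H_words_ge S (lev i)) hid.
have h4' := h4 _ m4n; rewrite ler_pdivrMr // in h4'.
have e8 : e * (8 * (m1%:R + 1)) = h - al by rewrite /e divfK // gt_eqF.
apply: (arith_end (ltW e0) _ K0 _ ah e8 h4' _ _ hlow (bound i)) => //.
- by rewrite ltr0n.
- by rewrite /lev natrM natrX.
Qed.

End Rapaport.

(** * Power means *)

Section PowerMeans.
Variable R : realType.

(** The power x^h for x > 0; elsewhere ln is 0 and the value is 1. *)
Definition pw (h x : R) : R := expR (h * ln x).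

Lemma pw_gt0 h x : 0 < pw h x. Proof. exact: expR_gt0. Qed.

Lemma pwM h x y : 0 < x -> 0 < y -> pw h (x * y) = pw h x * pw h y.
Proof. by move=> x0 y0; rewrite /pw lnM ?posrE // mulrDr expRD. Qed.

(** Tangent at 1 / u of v^h, a convex function of 1 / v. *)
Lemma pw_tangent h u v : 0 <= h -> 0 < u -> 0 < v ->
  (1 + h) * pw h u - h * (pw h u * (u / v)) <= pw h v.
Proof.
move=> h0 u0 v0; pose z := ln (v / u).
have vu : 0 < v / u by rewrite divr_gt0.
have -> : pw h v = pw h u * expR (h * z).
  by rewrite -[X in pw h X = _](divfK (lt0r_neq0 u0)) mulrC pwM.
have -> : u / v = expR (- z) by rewrite expRN /z lnK ?posrE // invf_div.
rewrite mulrC -mulrCA -mulrBr ler_pM2l ?pw_gt0 //.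
have h1 := expR_ge1Dx (- z); have h2 := expR_ge1Dx (h * z).
have : h * (1 - z) <= h * expR (- z) by rewrite ler_wpM2l.
lra.
Qed.

(** The last hypothesis says that on each fibre of [X] the harmonic mean of [v] is at least the mass
    of the fibre. As v^h is convex in 1 / v, its mean is at least that of the power of the mass. *)
Lemma Power_Gibbs (T U : eqType) (d : fdist R T) (X : T -> U) (v : T -> R) (h : R) :
  0 <= h -> (forall w, supp d w -> 0 < v w) ->
  (forall w', supp d w' -> Ex d (fun w => (X w == X w')%:R / v w) <= 1) ->
  Ex d (fun w => pw h (pm d X (X w))) <= Ex d (fun w => pw h (v w)).
Proof.
move=> h0 v0 hv; pose u w := pm d X (X w).
have h1 : Ex d (fun w => pw h (u w) * (u w / v w)) <= Ex d (fun w => pw h (u w)).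
  have -> : Ex d (fun w => pw h (u w) * (u w / v w)) =
      Ex d (fun w' => pw h (u w') * Ex d (fun w => (X w == X w')%:R / v w)).
    transitivity (Ex d (fun w => Ex d (fun w' => pw h (u w) * ((X w' == X w)%:R / v w)))).
      apply: eq_Ex => w _; rewrite ExZ; congr (_ * _); rewrite ExZr; congr (_ * _).
    rewrite Ex_swap; apply: eq_Ex => w' _; rewrite -ExZ; apply: eq_Ex => w _.
    rewrite [X w == X w']eq_sym; case: eqP => e; last by rewrite !mul0r !mulr0.
    by rewrite /u -e.
  apply: le_Ex => w' w'S; rewrite -[leRHS]mulr1 ler_wpM2l ?(ltW (pw_gt0 _ _)) //.
  exact: hv.
have h2 : Ex d (fun w => (1 + h) * pw h (u w) - h * (pw h (u w) * (u w / v w))) <=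
    Ex d (fun w => pw h (v w)).
  by apply: le_Ex => w wS; apply: pw_tangent => //; [exact: pm_gt0|exact: v0].
rewrite ExB !ExZ in h2; have := ler_wpM2l h0 h1; rewrite /u in h1 h2 *; lra.
Qed.

Lemma Ex_pmV_list (T U : eqType) (d : fdist R T) (Y : T -> U) (P : T -> bool) (L : seq U)
    (K : nat) : (forall w, supp d w -> P w -> Y w \in L) -> (size L <= K)%N ->
  Ex d (fun w => (P w)%:R / pm d Y (Y w)) <= K%:R.
Proof.
move=> hL sL; apply: (@le_trans _ _ (size L)%:R); last by rewrite ler_nat.
apply: (@le_trans _ _ (Ex d (fun w => \sum_(y <- L) (Y w == y)%:R / pm d Y (Y w)))).
  apply: le_Ex => w wS; rewrite -mulr_suml ler_wpM2r ?invr_ge0 ?pm_ge0 //.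
  case: (boolP (P w)) => [/(hL w wS) yL|_]; last by rewrite sumr_ge0.
  by rewrite (big_rem _ yL) /= eqxx lerDl sumr_ge0.
rewrite Ex_sum -sum1_size natr_sum; apply: ler_sum => y _; exact: Ex_pmV.
Qed.

Lemma expRN_le (y : R) : 0 <= y -> expR (- y) <= 1 - y + y ^+ 2.
Proof.
move=> y0; have h := expR_ge1Dx y; have e0 := expR_gt0 y.
rewrite expRN -[leLHS]mul1r ler_pdivrMr //.
have h1 : 0 <= 1 - y + y ^+ 2 by nra.
have : (1 - y + y ^+ 2) * (1 + y) <= (1 - y + y ^+ 2) * expR y by rewrite ler_wpM2l.
have : 0 <= y ^+ 3 by rewrite exprn_ge0.
rewrite !expr2 !exprS expr0; lra.
Qed.

(** Second-order expansion in [h] of an exponential moment of the information, which [B] bounds. *)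
Lemma power_mean_le (T U : eqType) (d : fdist R T) (X : T -> U) (h B : R) : 0 <= h ->
  (forall w, supp d w -> - ln (pm d X (X w)) <= B) ->
  Ex d (fun w => pw h (pm d X (X w))) <= expR (- (h * Hent d X) + h ^+ 2 * B ^+ 2).
Proof.
move=> h0 hB; apply: (@le_trans _ _ (1 + (- (h * Hent d X) + h ^+ 2 * B ^+ 2))); last exact: expR_ge1Dx.
have -> : 1 + (- (h * Hent d X) + h ^+ 2 * B ^+ 2) =
  Ex d (fun w => 1 - h * (- ln (pm d X (X w))) + h ^+ 2 * B ^+ 2).
  by rewrite ExD ExB !Ex_cst ExZ addrA.
apply: le_Ex => w wS; set y := - ln _.
have y0 : 0 <= y by rewrite oppr_ge0 ln_le0 // pm_le1.
have yB := hB w wS; rewrite -/y in yB.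
have -> : pw h (pm d X (X w)) = expR (- (h * y)) by rewrite /pw /y mulrN opprK.
apply: le_trans (expRN_le (mulr_ge0 h0 y0)) _; rewrite lerD2l exprMn.
rewrite ler_wpM2l ?exprn_ge0 // lerXn2r ?nnegrE //; exact: le_trans yB.
Qed.
End PowerMeans.

(** * Decay of the power means of cell masses *)

Section LowerDimension.
Variables (R : realType) (S : wifs R).
Local Notation A := ('I_(wm S).+1).
Local Notation p := (@wp R S).
Local Notation E j := (expR (j%:R : R)).
Local Notation c := (cmin S).

Definition cellm (s : R) (i : int) : R := pm (Stop S s) (fun w => Q s (trw S w)) i.
Definition SM (h s : R) : R :=
  Ex (Stop S s) (fun w => pw h (cellm s (Q s (trw S w)))).

Lemma cellm_gt0 s w : supp (Stop S s) w -> 0 < cellm s (Q s (trw S w)).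
Proof. by move=> ws; apply: (@pm_gt0 _ _ _ _ (fun w => Q s (trw S w))). Qed.

(** [Power_Gibbs] compares the mass of a fine cell with the product of the cell masses of the two
    parts of a word. Given the fine cell, the cell of the first part has at most K1 candidates, then
    that of the second at most K2. K enters only as K^h, so large scales outweigh it; [b] covers all
    scales that the overshoot of the first part can leave. *)
Lemma SM_submul : exists2 K : R, 1 <= K & forall h s s' b, 0 <= h -> 1 <= s -> 1 <= s' ->
  (forall r, c * s' <= r -> r <= s' -> SM h r <= b) ->
  SM h (s * s') <= pw h K * (SM h s * b).
Proof.
ifs_bounds S; have C2 : 0 <= Ctr S + 2 by lra.
pose K1 := (2 * (Num.truncn (Ctr S + 2)).+1 + 2)%N; pose K2 := (2 * (Num.truncn (2 : R)).+1 + 2)%N.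
have K10 : 1 <= K1%:R :> R by rewrite ler1n /K1; clear; lia.
have K20 : 1 <= K2%:R :> R by rewrite ler1n /K2; clear; lia.
have [k1 k2] : 0 < K1%:R :> R /\ 0 < K2%:R :> R by split; apply: lt_le_trans ltr01 _.
exists (K1%:R * K2%:R); first by rewrite mulr_ege1.
move=> h s s' b h0 s1 s'1 hb; have s0 : 0 < s by lra.
have s'0 : 0 < s' by lra.
pose f w := Stop S (s * s' * `|lamw S w|).
pose D := fpair (Stop S s) f.
pose X (z : seq A * seq A) := Q (s * s') (trw S (z.1 ++ z.2)).
have ss : s <= s * s' by rewrite ler_peMr // ltW.
have exD F : Ex (Stop S (s * s')) F = Ex D (fun z => F (z.1 ++ z.2)).
  by rewrite (Stop_cat _ ss) Ex_pair.
have -> : SM h (s * s') = Ex D (fun z => pw h (pm D X (X z))).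
  by rewrite /SM exD; apply: eq_Ex => z _; congr (pw _ _); rewrite /cellm /pm exD.
pose v (z : seq A * seq A) := K1%:R * cellm s (Q s (trw S z.1)) *
  (K2%:R * cellm (s * s' * `|lamw S z.1|) (Q (s * s' * `|lamw S z.1|) (trw S z.2))).
have v0 z : supp D z -> 0 < v z.
  by move=> /supp_pair[z1 z2]; rewrite !mulr_gt0 // cellm_gt0.
apply: le_trans (Power_Gibbs h0 v0 _) _ => [z0 _|].
  move: (X z0) => x; rewrite Ex_pair.
  pose near1 w := (Q s (trw S w)) \in near_ints (x%:~R / s') (Ctr S + 2).
  apply: (@le_trans _ _ (Ex (Stop S s) (fun w =>
     (near1 w)%:R / cellm s (Q s (trw S w)) / K1%:R))); last first.
    rewrite ExZr ler_pdivrMr // mul1r.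
    apply: (@Ex_pmV_list _ _ _ _ (fun w => Q s (trw S w)) near1 (near_ints (x%:~R / s') (Ctr S + 2))) => //.
    by rewrite size_near_ints.
  apply: le_Ex => w ws; have cw0 := cellm_gt0 ws.
  pose L2 := near_ints (Num.sg (lamw S w) * (x%:~R - s * s' * trw S w)) 2.
  pose r := s * s' * `|lamw S w|.
  have hw := Stop_upper ws.
  have near1T u : X (w, u) = x -> near1 w.
    move=> ex; rewrite /near1 -ex; apply: mem_near_ints => //.
    have q1 := Q_near s (trw S w); have q2 := Q_near (s * s') (trw S (w ++ u)).
    have q3 := trw_cat_near u (ltW s0) hw.
    have -> : (Q s (trw S w))%:~R - (X (w, u))%:~R / s' =
      ((Q s (trw S w))%:~R - s * trw S w) - (s * trw S (w ++ u) - s * trw S w)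
      - ((X (w, u))%:~R - s * s' * trw S (w ++ u)) / s'.
      by move: (X (w, u))%:~R (Q s _)%:~R => y1 y2; field; rewrite gt_eqF.
    have q4 : `|((X (w, u))%:~R - s * s' * trw S (w ++ u)) / s'| <= 1.
      rewrite normrM normfV (ger0_norm (ltW s'0)) ler_pdivrMr // mul1r.
      by apply: le_trans q2 _.
    apply: le_trans (ler_normB _ _) _; apply: le_trans (lerD (ler_normB _ _) q4) _.
    by move: q1 q3; rewrite -/(Ctr S); clear; move: `|_| `|_| => *; lra.
  have near2T u : X (w, u) = x -> Q r (trw S u) \in L2.
    move=> ex; rewrite /L2 -ex; apply: mem_near_ints => //.
    have := H_affine_near (s * s') (trw S w) (lamw S w) (trw S u).
    rewrite -/r /X /= -trw_cat; set g := Num.sg _.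
    have gg : g * g = 1.
      by rewrite /g -expr2 sqr_sg lamw_neq0.
    have g1 : `|g| = 1 by rewrite /g normr_sg lamw_neq0.
    set q := (Q r (trw S u))%:~R; set y := (Q _ _)%:~R; set x0 := _ * trw S w => hx.
    have -> : q - g * (y - x0) = g * - (y - (x0 + g * q)).
      by transitivity (g * g * q - g * (y - x0)); [rewrite gg mul1r|ring].
    by rewrite normrM g1 mul1r normrN.
  have inner : Ex (f w) (fun u => (X (w, u) == x)%:R / cellm r (Q r (trw S u))) <= K2%:R.
    apply: (@Ex_pmV_list _ _ _ _ (fun u => Q r (trw S u)) (fun u => X (w, u) == x) L2).
      by move=> u _ /eqP; exact: near2T.
    by rewrite size_near_ints.
  have -> : Ex (f w) (fun u => (X (w, u) == x)%:R / v (w, u)) =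
    (near1 w)%:R / cellm s (Q s (trw S w)) / K1%:R *
      (Ex (f w) (fun u => (X (w, u) == x)%:R / cellm r (Q r (trw S u))) / K2%:R).
    rewrite -ExZr -ExZ; apply: eq_Ex => u us; rewrite /v /=.
    have cu0 : cellm r (Q r (trw S u)) != 0 by rewrite gt_eqF // cellm_gt0.
    case: eqP => [/near1T ->|_]; last by rewrite !mul0r mulr0.
    rewrite -[s * s' * _]/r; move: (cellm r _) cu0 (cellm s _) cw0 => y1 y10 y2 y20.
    move: (K1%:R) k1 (K2%:R) k2 => k1R k1p k2R k2p; rewrite /= mulr1n.
    by clear -y10 y20 k1p k2p; field; rewrite y10 !gt_eqF.
  rewrite -[leRHS]mulr1 ler_wpM2l ?ler_pdivrMr ?mul1r //.
  by rewrite !mulr_ge0 ?invr_ge0 ?(ltW cw0) ?(ltW k1).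
rewrite Ex_pair.
have -> : pw h (K1%:R * K2%:R) * (SM h s * b) =
  Ex (Stop S s) (fun w => pw h (K1%:R * K2%:R) * (pw h (cellm s (Q s (trw S w))) * b)).
  by rewrite ExZ ExZr.
apply: le_Ex => w ws; have cw0 := cellm_gt0 ws.
have -> : Ex (f w) (fun u => pw h (v (w, u))) =
  pw h (K1%:R * K2%:R) * (pw h (cellm s (Q s (trw S w))) * SM h (s * s' * `|lamw S w|)).
  rewrite -!ExZ; apply: eq_Ex => u us; rewrite /v /=.
  have cu0 := cellm_gt0 us.
  by rewrite !pwM ?mulr_gt0 //; ring.
rewrite !ler_wpM2l ?(ltW (pw_gt0 _ _)) //; apply: hb.
  rewrite [leRHS]mulrAC ler_wpM2r ?(ltW s'0) //.
  by apply: Stop_lower => //; lra.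
by rewrite mulrAC ler_piMl ?(ltW s'0) //; exact: Stop_upper.
Qed.

Lemma pw_le (h x y : R) : 0 <= h -> 0 < x -> x <= y -> pw h x <= pw h y.
Proof.
move=> h0 x0 xy; rewrite ler_expR ler_wpM2l // ler_ln ?posrE //; exact: lt_le_trans xy.
Qed.

Lemma pw_le1 (h x : R) : 0 <= h -> x <= 1 -> pw h x <= 1.
Proof. by move=> h0 x1; rewrite -expR0 ler_expR mulr_ge0_le0 // ln_le0. Qed.

(** Needed because balls meet neighbouring cells. Let a be the mass of the shifted cell and b that
    of the cell itself. If T < a <= b, then b^h is at least T^h; if a > b, then a a^h / b is, and
    its mean is at most [SM] after exchanging the two cells. *)
Lemma heavy_shift h s T j : 0 <= h -> 0 < T ->
  Ex (Stop S s) (fun w => (T < cellm s (Q s (trw S w) + j)%R)%R%:R) <= 2 * SM h s / pw h T.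
Proof.
move=> h0 T0; pose b w := cellm s (Q s (trw S w)); pose a w := cellm s (Q s (trw S w) + j).
have swap : Ex (Stop S s) (fun w => a w * pw h (a w) / b w) <= SM h s.
  have -> : Ex (Stop S s) (fun w => a w * pw h (a w) / b w) =
    Ex (Stop S s) (fun w' => pw h (b w') *
      Ex (Stop S s) (fun w => (Q s (trw S w) == Q s (trw S w') - j)%:R / b w)).
    transitivity (Ex (Stop S s) (fun w => Ex (Stop S s) (fun w' =>
       (Q s (trw S w') == Q s (trw S w) + j)%:R * (pw h (a w) / b w)))).
      by apply: eq_Ex => w _; rewrite ExZr mulrA.
    rewrite Ex_swap; apply: eq_Ex => w' _; rewrite -ExZ; apply: eq_Ex => w _.
    rewrite [_ == _ - j]eq_sym subr_eq; case: eqP => [e|_]; last by rewrite !mul0r mulr0.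
    by rewrite /a -e mul1r mulrCA mul1r.
  apply: le_Ex => w' _; rewrite -[leRHS]mulr1 ler_wpM2l ?(ltW (pw_gt0 _ _)) //.
  exact: (@Ex_pmV _ _ _ _ (fun w => Q s (trw S w))).
rewrite ler_pdivlMr ?pw_gt0 // -ExZr.
apply: (@le_trans _ _ (Ex (Stop S s) (fun w => pw h (b w) + a w * pw h (a w) / b w))).
  apply: le_Ex => w ws; have b0 : 0 < b w by exact: cellm_gt0.
  have a0 : 0 <= a w by exact: pm_ge0.
  have q0 : 0 <= a w * pw h (a w) / b w by rewrite !mulr_ge0 ?invr_ge0 ?(ltW b0) ?(ltW (pw_gt0 _ _)).
  have p0 := pw_gt0 h (b w).
  rewrite -/(a w); case: (ltrP T (a w)) => Ta; last by rewrite mul0r addr_ge0 // ltW.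
  rewrite mul1r; apply: (le_trans (pw_le h0 T0 (ltW Ta))).
  case: (lerP (a w) (b w)) => ab.
    by apply: (le_trans (pw_le h0 (lt_trans T0 Ta) ab)); rewrite lerDl.
  apply: (@le_trans _ _ (a w * pw h (a w) / b w)); last by rewrite lerDr ltW.
  by rewrite mulrAC ler_peMl ?(ltW (pw_gt0 _ _)) // ler_pdivlMr // mul1r ltW.
have -> : 2 * SM h s = SM h s + SM h s by ring.
by rewrite ExD lerD2l.
Qed.

Lemma cellm_info N : exists B : R, forall r w, r <= E N -> supp (Stop S r) w ->
  - ln (cellm r (Q r (trw S w))) <= B.
Proof.
have l0 := ln_rmax_lt0 S; set lr := - ln (rmax S) in l0.
pose Lp : R := \sum_j - ln (p j).
have lp0 j : 0 <= - ln (p j) by rewrite oppr_ge0 ln_le0 // p_le1.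
have Lp0 : 0 <= Lp by apply: sumr_ge0.
have Lpj j : - ln (p j) <= Lp by rewrite /Lp (bigD1 j) //= lerDl sumr_ge0.
have lc : 0 <= - ln c by rewrite oppr_ge0 ln_le0 // ltW // cmin_lt1.
exists ((N%:R - ln c) / lr * Lp) => r w rN ws.
case: (lerP r 1) => r1.
  have -> : cellm r (Q r (trw S w)) = 1.
    move: ws; rewrite /cellm /pm Stop_le1 // supp_ret => /eqP ->.
    by rewrite Ex_ret eqxx.
  by rewrite ln1 oppr0 !mulr_ge0 ?invr_ge0 ?(ltW l0) ?addr_ge0.
have p0 : 0 < \prod_(j <- w) p j by apply: prodr_gt0 => j _; exact: wp_gt0.
have h1 : \prod_(j <- w) p j <= cellm r (Q r (trw S w)).
  by rewrite -(pm_Stop ws); apply: le_pm => w' _ ->.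
apply: (@le_trans _ _ (- ln (\prod_(j <- w) p j))).
  by rewrite lerN2 ler_ln ?posrE // (lt_le_trans p0 h1).
have hsz := Stop_size (ltW r1) ws.
apply: (@le_trans _ _ ((size w)%:R * Lp)).
  rewrite ln_prod; last by exact: wp_gt0.
  elim: (w) => [|j u IH]; first by rewrite big_nil oppr0 mul0r.
  by rewrite big_cons opprD /= -natr1 mulrDl mul1r addrC lerD.
rewrite ler_wpM2r // ler_pdivlMr //; apply: le_trans hsz _; rewrite lerD2r.
by rewrite -[leRHS]expRK ler_ln ?posrE ?expR_gt0 // (lt_trans ltr01 r1).
Qed.

Variable al : R.
Hypothesis hS_low : forall e, 0 < e -> exists n0, forall n, (n0 <= n)%N ->
    (al - e) * n%:R <= hS S (E n).

Lemma arith_mean (h e a n lK k H B2 : R) : 0 <= h -> (a - e / 4) * n <= H + k ->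
  lK + k <= n * (e / 4) -> h * B2 <= e / 4 * n -> 0 <= e * n ->
  h * lK + (- (h * H) + h ^+ 2 * B2) <= - (h * ((a - e) * n)).
Proof.
move=> h0 h1 h2 h3 h4.
have : h * (lK + (h * B2) - H + (a - e) * n) <= 0.
  by apply: mulr_ge0_le0 => //; move: h3; move: (h * B2) => x *; lra.
rewrite expr2; lra.
Qed.

(** N is taken so large that the entropy at level N beats the constants, ln K included, then h so
    small that the quadratic term of [power_mean_le] is negligible. [SM_submul] carries the bound to
    all multiples of N. *)
Lemma power_mean_decay (e : R) : 0 < e -> exists N (h : R), [/\ (0 < N)%N, 0 < h &
  forall k, SM h (E (k * N)) <= expR (- (h * ((al - e) * (k * N)%:R)))].
Proof.
move=> e0; have [K K1 hK] := SM_submul.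
have c0 := cmin_gt0 S; have c1 := cmin_lt1 S.
have e4 : 0 < e / 4 by rewrite divr_gt0.
have [n1 h1] := hS_low e4.
have [n2 h2] := arch_nat ((ln K + KS2 S) / (e / 4)).
pose N := (maxn n1 n2).+1.
have [n1N n2N] : (n1 <= N)%N /\ (n2 <= N)%N by rewrite /N; clear; split; lia.
have N0 : (0 < N)%N by [].
have [B hB] := cellm_info N.
have NR : 0 < N%:R :> R by rewrite ltr0n.
have B2 : 0 < B ^+ 2 + 1 by rewrite ltr_wpDl // sqr_ge0.
pose h := e / 4 * N%:R / (B ^+ 2 + 1).
have h0 : 0 < h by rewrite divr_gt0 // mulr_gt0.
exists N, h; split=> // k.
have hB2 : h * B ^+ 2 <= e / 4 * N%:R.
  rewrite /h mulrAC ler_pdivrMr // ler_wpM2l ?(ltW (mulr_gt0 e4 NR)) //.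
  by rewrite lerDl.
have K0 : 0 < K by apply: lt_le_trans K1.
have base r : c * E N <= r -> r <= E N ->
    SM h r <= expR (- (h * ((al - e) * N%:R))) / pw h K.
  move=> r1 r2; have r0 : 0 < r by apply: lt_le_trans r1; rewrite mulr_gt0 ?E_gt0.
  rewrite ler_pdivlMr ?pw_gt0 //.
  have hb w : supp (Stop S r) w -> - ln (cellm r (Q r (trw S w))) <= B by exact: hB.
  have := power_mean_le (ltW h0) hb; rewrite -/(SM h r) -[Hent _ _]/(hS S r) => h3.
  apply: le_trans (ler_wpM2r (ltW (pw_gt0 h K)) h3) _.
  rewrite /pw -expRD ler_expR addrC.
  have h4 := hS_comparable r0 r2 r1.
  have h5 := h1 N n1N; have h6 := h2 N n2N; rewrite ler_pdivrMr // in h6.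
  apply: (arith_mean (ltW h0) (le_trans h5 h4) h6 hB2).
  by rewrite mulr_ge0 // ltW.
elim: k => [|k IH].
  rewrite mul0n mulr0 mulr0 oppr0 expR0; apply: Ex_le_cst => w _.
  by apply: pw_le1; [exact: ltW|exact: pm_le1].
rewrite mulSn addnC ED; apply: le_trans (hK h _ _ _ (ltW h0) (E_ge1 R _) (E_ge1 R _) base) _.
have cancel (x y z : R) : 0 < x -> x * (y * (z / x)) = y * z.
  by move=> x0; field; rewrite gt_eqF.
rewrite cancel ?pw_gt0 //.
apply: le_trans (ler_wpM2r (expR_ge0 _) IH) _.
by rewrite -expRD ler_expR natrD; move: (_ %:R) => *; lra.
Qed.

End LowerDimension.

(** * Local dimension *)

Section RealMass.
Variables (R : realType) (mu : probability (measurableTypeR R) R).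
Local Notation TR := (measurableTypeR R).
Implicit Types B : set TR.

Definition mr B : R := fine (mu B).

Lemma mrE B : measurable B -> mu B = (mr B)%:E.
Proof. by move=> mB; rewrite /mr fineK // fin_num_measure. Qed.

Lemma mr_ge0 B : 0 <= mr B. Proof. exact: fine_ge0. Qed.

Lemma mr_le B B' : measurable B -> measurable B' -> B `<=` B' -> mr B <= mr B'.
Proof. by move=> mB mB' BB; rewrite -lee_fin -!mrE // le_measure // inE. Qed.

Lemma mr_le1 B : measurable B -> mr B <= 1.
Proof. by move=> mB; rewrite -lee_fin -mrE // probability_le1. Qed.

Lemma mr0 : mr set0 = 0. Proof. by rewrite /mr measure0. Qed.

Lemma mrU B B' : measurable B -> measurable B' -> mr (B `|` B') <= mr B + mr B'.
Proof.
move=> mB mB'; rewrite -lee_fin EFinD -!mrE //; last exact: measurableU.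
exact: measureU2.
Qed.

Lemma mrC B : measurable B -> mr (~` B) = 1 - mr B.
Proof.
move=> mB; apply/eqP; rewrite -eqe EFinB -!mrE //; last exact: measurableC.
by rewrite probability_setC.
Qed.

Lemma mr_bigU (I : Type) (L : seq I) (P : pred I) (F : I -> set TR) (T : R) : 0 <= T ->
  (forall i, measurable (F i)) -> (forall i, P i -> mr (F i) <= T) ->
  measurable (\big[setU/set0]_(i <- L | P i) F i) /\
  mr (\big[setU/set0]_(i <- L | P i) F i) <= (size L)%:R * T.
Proof.
move=> T0 mF hF; elim: L => [|i L [IH1 IH2]].
  by rewrite big_nil mr0 mul0r; split=> //; exact: measurable0.
rewrite big_cons /= -natr1 mulrDl mul1r; case: ifP => [Pi|_]; split=> //.
- exact: measurableU.
- by apply: le_trans (mrU _ _) _ => //; rewrite addrC lerD // hF.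
- by apply: le_trans IH2 _; rewrite lerDl.
Qed.

Lemma in_bigU (I : eqType) (L : seq I) (P : pred I) (F : I -> set TR) x :
  (\big[setU/set0]_(i <- L | P i) F i) x <-> exists i, [/\ i \in L, P i & F i x].
Proof.
elim: L => [|i L IH]; first by rewrite big_nil; split=> // -[i []].
rewrite big_cons; case: ifP => Pi; split.
- case=> [Fi|/IH[k [kL Pk Fk]]]; first by exists i; rewrite mem_head.
  by exists k; rewrite inE kL orbT.
- move=> [k []]; rewrite inE => /orP[/eqP -> _ Fi|kL Pk Fk]; [by left|right].
  by apply/IH; exists k.
- by move=> /IH[k [kL Pk Fk]]; exists k; rewrite inE kL orbT.
- move=> [k []]; rewrite inE => /orP[/eqP ->|kL Pk Fk]; first by rewrite Pi.
  by apply/IH; exists k.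
Qed.

Lemma geometric_Borel_Cantelli (F : nat -> set TR) (c q : R) : 0 <= c -> 0 <= q -> q < 1 ->
  (forall k, measurable (F k)) -> (forall k, mr (F k) <= c * q ^+ k) ->
  {ae mu, forall x, exists n0, forall n, (n0 <= n)%N -> ~ F n x}.
Proof.
move=> c0 q0 q1 mF hF; exists (lim_sup_set F); split.
- apply: bigcap_measurable => [|k _]; first by exists 0%N.
  by apply: bigcup_measurable => j _; exact: mF.
- apply: lim_sup_set_cvg0 => //.
  apply: (@le_lt_trans _ _ (c / (1 - q))%:E); last exact: ltry.
  apply: lime_le; first exact: is_cvg_nneseries.
  apply: nearW => n.
  apply: (@le_trans _ _ (c * (1 - q ^+ n) / (1 - q))%:E).
    elim: n => [|n IH]; first by rewrite big_geq // expr0 subrr mulr0 mul0r.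
    rewrite big_nat_recr //= mrE //.
    apply: (@le_trans _ _ ((c * (1 - q ^+ n) / (1 - q))%:E + (c * q ^+ n)%:E)%E).
      by rewrite leeD // lee_fin.
    rewrite -EFinD lee_fin exprS.
    have -> : c * (1 - q ^+ n) / (1 - q) + c * q ^+ n = c * (1 - q * q ^+ n) / (1 - q).
      by field; rewrite gt_eqF // subr_gt0.
    exact: lexx.
  rewrite lee_fin ler_wpM2r ?invr_ge0 ?subr_ge0 ?(ltW q1) //.
  by rewrite ler_piMr // gerBl exprn_ge0.
- move=> x /= hx n _; apply: contrapT => h; apply: hx; exists n => k nk Fk; apply: h.
  by exists k.
Qed.

Lemma ae_null (B : set TR) : measurable B -> mr B = 0 -> {ae mu, forall x, ~ B x}.
Proof.
move=> mB B0; exists B; split=> //; first by rewrite mrE // B0.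
by move=> x /= /contrapT.
Qed.

End RealMass.

(** * Masses of cells and balls under a self-similar measure *)

Section SelfSimilar.
Variables (R : realType) (S : wifs R) (mu : probability (measurableTypeR R) R).
Local Notation TR := (measurableTypeR R).
Local Notation lam := (@wlam R S).
Local Notation t := (@wt R S).
Local Notation p := (@wp R S).
Local Notation A := ('I_(wm S).+1).
Local Notation E j := (expR (j%:R : R)).
Local Notation c := (cmin S).
Hypothesis mu_ss : is_self_similar_measure lam t p mu.
Implicit Types B : set TR.

Definition wpre (w : seq A) B : set TR := [set x | B (lamw S w * x + trw S w)].

Lemma measurable_wpre w B : measurable B -> measurable (wpre w B).
Proof.
move=> mB; have mf : measurable_fun [set: TR] (fun x : TR => lamw S w * x + trw S w : TR).
  by apply: measurable_funD => //; apply: measurable_funM.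
by have := mf measurableT _ mB; rewrite setTI.
Qed.

Lemma mr_letter B : measurable B ->
  mr mu B = \sum_j p j * mr mu (wpre [:: j] B).
Proof.
move=> mB; apply/eqP; rewrite -eqe -mrE // mu_ss // -sumEFin; apply/eqP; apply: eq_bigr => j _.
rewrite EFinM -mrE; last exact: measurable_wpre.
congr (_ * mu _)%E; apply/seteqP; split=> x; rewrite /wpre /= /ifs_map lamw_cons lamw_nil mulr1;
by rewrite /trw /= /ifs_map mulr0 add0r.
Qed.

(** Self-similarity iterated up to the stopping time. *)
Lemma mr_words s B : measurable B ->
  mr mu B = Ex (Stop S s) (fun w => mr mu (wpre w B)).
Proof.
elim/(@Stop_ind _ S): s B => s s1.
  move=> B _; rewrite Stop_le1 // Ex_ret; congr (mr mu _); apply/seteqP.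
  by split=> x; rewrite /wpre /= lamw_nil trw_nil mul1r addr0.
move=> IH B mB; rewrite Ex_Stop_gt1 // mr_letter //; apply: eq_bigr => j _; congr (_ * _).
rewrite (IH j); last exact: measurable_wpre.
apply: eq_Ex => w _; congr (mr mu _).
have e x : lamw S (j :: w) * x + trw S (j :: w) =
   lamw S [:: j] * (lamw S w * x + trw S w) + trw S [:: j].
  by rewrite -[j :: w]/([:: j] ++ w) lamw_cat trw_cat; ring.
by apply/seteqP; split=> x; rewrite /wpre /= e.
Qed.

Definition farset (r : R) : set TR := [set x | r < `|x|].

Lemma measurable_far r : measurable (farset r).
Proof.
have -> : farset r = ~` [set` `[- r, r]].
  by apply/seteqP; split=> x; rewrite /farset /= in_itv /= -ler_norml; [move=> h; apply/negP; rewrite -ltNge|move/negP; rewrite -ltNge].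
apply: measurableC; exact: measurable_itv.
Qed.

Definition Mr : R := Ctr S + 1.

Lemma Mr_ge2 : 2 <= Mr.
Proof. by have := Ctr_ge1 S; rewrite /Mr; lra. Qed.

(** A word map stopped at scale n + 1 reaches beyond Ctr + 1 only from points beyond n + 1. Hence
    the outer mass is at most that of arbitrarily remote sets, which tends to 0. *)
Lemma mr_far : mr mu (farset Mr) = 0.
Proof.
have step n : mr mu (farset Mr) <= mr mu (farset n.+1%:R).
  rewrite (@mr_words n.+1%:R); last exact: measurable_far.
  apply: Ex_le_cst => w ws.
  apply: mr_le; [apply: measurable_wpre; exact: measurable_far|exact: measurable_far|].
  move=> x; rewrite /wpre /farset /= => h1.
  have s0 : 0 < n.+1%:R :> R by rewrite ltr0n.
  have h2 := trw_le w; have h3 := Stop_upper ws.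
  have h4 : 1 < `|lamw S w| * `|x|.
    rewrite -normrM; move: h1 h2; have := ler_normD (lamw S w * x) (trw S w).
    by rewrite /Mr; lra.
  apply: lt_le_trans (_ : n.+1%:R * (`|lamw S w| * `|x|) <= _).
    by rewrite -[ltLHS]mulr1 ltr_pM2l.
  by rewrite mulrA -[leRHS]mul1r ler_wpM2r.
have hE r : mu (farset r) = (mr mu (farset r))%:E by apply: mrE; exact: measurable_far.
have le_n n : (mu (farset Mr) <= mu (farset n.+1%:R))%E by rewrite !hE lee_fin.
have cv : mu (farset n.+1%:R) @[n --> \oo] --> mu (\bigcap_n farset n.+1%:R).
  apply: nonincreasing_cvg_mu => //.
  - exact: le_lt_trans (probability_le1 mu (measurable_far _)) (ltry _).
  - by move=> n; exact: measurable_far.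
  - by apply: bigcap_measurable => // n _; exact: measurable_far.
  - move=> a b ab; apply/subsetPset => x; rewrite /farset /=; apply: le_lt_trans.
    by rewrite ler_nat.
have e0 : \bigcap_n farset n.+1%:R = set0.
  apply/seteqP; split=> // x hx; have [n0 h] := arch_nat `|x|.
  have := hx n0 I; rewrite /farset /= ltNge; apply/negP; rewrite negbK.
  by apply: le_trans (h n0 (leqnn _)) _; rewrite ler_nat.
rewrite e0 measure0 in cv.
have h0 : (mu (farset Mr) <= 0)%E.
  have <- := cvg_lim _ cv; last by [].
  apply: lime_ge; first by apply/cvg_ex; exists 0%E.
  by apply: nearW => n; exact: le_n.
by apply/eqP; rewrite eq_le mr_ge0 andbT -lee_fin -hE.
Qed.

Lemma mr_sub_far B : measurable B -> B `<=` farset Mr -> mr mu B = 0.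
Proof.
move=> mB BF; apply/eqP; rewrite eq_le mr_ge0 andbT -mr_far.
by apply: mr_le => //; exact: measurable_far.
Qed.

Lemma mr_pred_words s B (P : seq A -> bool) : measurable B ->
  (forall w x, supp (Stop S s) w -> `|x| <= Mr -> B (lamw S w * x + trw S w) -> P w) ->
  mr mu B <= Ex (Stop S s) (fun w => (P w)%:R).
Proof.
move=> mB h; rewrite (mr_words s mB); apply: le_Ex => w ws.
case: (boolP (P w)) => Pw; first by apply: mr_le1; exact: measurable_wpre.
rewrite mr_sub_far //; first exact: measurable_wpre.
move=> x Bx; rewrite /farset /= ltNge; apply/negP => xM; case/negP: Pw; exact: h Bx.
Qed.

Lemma mr_ge_word s B w : measurable B -> supp (Stop S s) w ->
  (forall x, `|x| <= Mr -> B (lamw S w * x + trw S w)) ->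
  \prod_(j <- w) p j <= mr mu B.
Proof.
move=> mB ws h; rewrite -(pm_Stop ws) (mr_words s mB); apply: le_Ex => w' _.
case: eqP => [->|_]; last exact: mr_ge0.
have -> : 1 = mr mu (~` farset Mr) by rewrite mrC ?mr_far ?subr0 //; exact: measurable_far.
apply: mr_le; [apply: measurableC; exact: measurable_far|exact: measurable_wpre|].
move=> x /= /negP; rewrite -leNgt; exact: h.
Qed.

Definition cellset (s : R) (i : int) : set TR := [set x | Q s x = i].
Definition ballset (x r : R) : set TR := `]x - r, x + r[%classic.

Lemma cellsetE s i x : cellset s i x <-> i%:~R <= s * x < i%:~R + 1.
Proof.
rewrite /cellset /Q /=; split=> [<-|h]; last by apply: floor_def; rewrite intrD.
by have := floor_itv (s * x); rewrite intrD.
Qed.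

Lemma measurable_cellset s i : 0 < s -> measurable (cellset s i).
Proof.
move=> s0; have -> : cellset s i = [set` `[i%:~R / s, (i%:~R + 1) / s[].
  apply/seteqP; split=> x; rewrite /= in_itv /=.
    by move=> /cellsetE; rewrite ler_pdivrMr // ltr_pdivlMr // mulrC.
  by move=> h; apply/cellsetE; move: h; rewrite ler_pdivrMr // ltr_pdivlMr // mulrC.
exact: measurable_itv.
Qed.

Lemma measurable_ballset x r : measurable (ballset x r).
Proof. exact: measurable_itv. Qed.

Lemma ballsetE x r y : ballset x r y <-> `|y - x| < r.
Proof.
by rewrite /ballset /= in_itv /= ltr_norml; split=> /andP[? ?]; apply/andP; split; lra.
Qed.

Lemma cell_sub_ball s x : 0 < s -> cellset s (Q s x) `<=` ballset x s^-1.
Proof.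
move=> s0 y yQ; apply/ballsetE.
have /cellsetE/andP[a1 a2] := yQ.
have /cellsetE/andP[b1 b2] : cellset s (Q s x) x by [].
rewrite -(ltr_pM2l s0) mulfV ?gt_eqF // -[X in X * _](ger0_norm (ltW s0)) -normrM mulrBr.
by rewrite ltr_norml; apply/andP; split; lra.
Qed.

(** The finite list contains every cell that meets [-Mr, Mr]; the rest of the line is null by
    [mr_far]. *)
Definition badcells (s : R) (P : pred int) : set TR :=
  \big[setU/set0]_(i <- near_ints 0 (s * Mr + 1) | P i) cellset s i.

Lemma badcells_in s P x : badcells s P x -> P (Q s x).
Proof. by move/in_bigU => [i [_ Pi xi]]; have -> : Q s x = i by []. Qed.

Lemma badcells_out s (P : pred int) x : 0 < s -> ~ farset Mr x -> ~ badcells s P x -> ~~ P (Q s x).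
Proof.
move=> s0 /negP; rewrite -leNgt => xM nb; apply/negP => PQ; apply: nb; apply/in_bigU.
exists (Q s x); split=> //; apply: mem_near_ints.
  by rewrite addr_ge0 // mulr_ge0 ?(ltW s0) //; have := Mr_ge2; lra.
rewrite subr0; have := Q_near s x => h1.
have h2 : `|s * x| <= s * Mr by rewrite normrM (ger0_norm (ltW s0)) ler_wpM2l // ltW.
rewrite -[X in `|X|](subrK (s * x)); apply: le_trans (ler_normD _ _) _; lra.
Qed.

(** Only O(e^n) cells matter, so those of mass below e^-((1 + e) n) have total mass O(e^-(e n)),
    which is summable. *)
Lemma mass_ge_scale (e : R) : 0 < e -> {ae mu, forall x, exists n0, forall n, (n0 <= n)%N ->
  expR (- ((1 + e) * n%:R)) <= mr mu (ballset x (expR (- n%:R)))}.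
Proof.
move=> e0; have M2 := Mr_ge2.
pose P n i := mr mu (cellset (E n) i) < expR (- ((1 + e) * n%:R)).
have mP n := @mr_bigU _ mu _ (near_ints 0 (E n * Mr + 1)) (P n) (cellset (E n))
  (expR (- ((1 + e) * n%:R))) (expR_ge0 _) (fun i => measurable_cellset i (E_gt0 R n)) (fun i => @ltW _ _ _ _).
have h1 : {ae mu, forall x, exists n0, forall n, (n0 <= n)%N -> ~ badcells (E n) (P n) x}.
  apply: (@geometric_Borel_Cantelli _ _ _ (2 * Mr + 6) (expR (- e))).
  - by rewrite addr_ge0 // mulr_ge0 //; lra.
  - exact: expR_ge0.
  - by rewrite expR_lt1 oppr_lt0.
  - by move=> n; have [] := mP n.
  - move=> n; have [_ h] := mP n; apply: le_trans h _; rewrite size_near_ints.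
    have E1 := E_ge1 R n.
    have hs : (2 * (Num.truncn (E n * Mr + 1)).+1 + 2)%:R <= (2 * Mr + 6) * E n.
      have K0 : 0 <= E n * Mr + 1 by rewrite addr_ge0 // mulr_ge0 ?(le_trans ler01) //; lra.
      have /andP[h1 _] := truncn_itv K0.
      rewrite natrD natrM -natr1; nra.
    apply: le_trans (ler_wpM2r (expR_ge0 _) hs) _.
    rewrite -mulrA -expRD -expRM_natl.
    by rewrite ler_wpM2l ?ler_expR //; [lra|lra].
have h2 := ae_null (measurable_far _) mr_far.
move: h1 h2; apply: filterS2 => x [n0 hx] nf; exists n0 => n /hx nb.
have := badcells_out (E_gt0 R n) nf nb; rewrite /P -leNgt => hP.
apply: le_trans hP _; apply: mr_le.
- apply: measurable_cellset; exact: E_gt0.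
- exact: measurable_ballset.
- by rewrite expRN; apply: cell_sub_ball; exact: E_gt0.
Qed.

Lemma expR_le2 (y : R) : y <= 2^-1 -> expR y <= 1 + y + 2 * y ^+ 2.
Proof.
move=> y2; have h := expR_ge1Dx (- y); have y1 : 0 < 1 - y by lra.
have e0 := expR_gt0 y.
have h1 : expR y * (1 - y) <= 1.
  apply: (@le_trans _ _ (expR y * expR (- y))); first by rewrite ler_wpM2l // ltW.
  by rewrite -expRD subrr expR0.
rewrite -(ler_pM2r y1); apply: le_trans h1 _.
have : 0 <= y ^+ 2 * (1 - 2 * y) by rewrite mulr_ge0 ?sqr_ge0 //; lra.
by rewrite !expr2; lra.
Qed.

(** The letter function f = -ln p + b ln |lam| has negative mean because b exceeds H(p) / chi. For
    small eta the product of exp (eta f) over the letters is a supermartingale, and Markov's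
    inequality applies. *)
Lemma word_Chernoff (e : R) : 0 < e -> exists C q : R, [/\ 0 <= C, 0 <= q, q < 1 &
  forall n, Ex (Stop S (E n)) (fun w =>
    (\prod_(j <- w) p j < expR (- ((entn S / lyapn S + e) * n%:R)))%R%:R) <= C * q ^+ n].
Proof.
move=> e0; have l0 := lyapn_gt0 S; set h := entn S / lyapn S.
have h0 : 0 <= h by rewrite divr_ge0 ?entn_ge0 // ltW.
pose b := h + e / 2.
have b0 : 0 <= b by rewrite /b; lra.
pose f j : R := - ln (p j) + b * ln `|lam j|.
have fsum : \sum_j p j * f j = - (e / 2 * lyapn S).
  rewrite /f; under eq_bigr do rewrite mulrDr mulrN mulrCA.
  rewrite big_split /= sumrN -mulr_sumr.
  have -> : \sum_j p j * ln `|lam j| = - lyapn S by rewrite /lyapn opprK.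
  rewrite -[- \sum_j _]/(entn S) /b /h mulrDl mulrN divfK ?gt_eqF //.
  by move: (entn S) => H; ring.
pose F : R := \sum_j `|f j|.
have F0 : 0 <= F by apply: sumr_ge0.
have fF j : `|f j| <= F by rewrite /F (bigD1 j) //= lerDl sumr_ge0.
(* Small enough for eta |f| <= 1 / 2, as [expR_le2] requires, and for the negative drift to beat the
   quadratic term. *)
pose eta := Num.min (2 * (F + 1))^-1 (e / 2 * lyapn S / (2 * (F ^+ 2 + 1))).
have F1 : 0 < F ^+ 2 + 1 by rewrite ltr_wpDl // sqr_ge0.
have eta0 : 0 < eta.
  rewrite lt_min invr_gt0 mulr_gt0 //; last by lra.
  by rewrite divr_gt0 ?mulr_gt0 // divr_gt0.
have eta1 : eta * F <= 2^-1.
  have : eta * (2 * (F + 1)) <= 1.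
    by rewrite -ler_pdivlMr ?mulr_gt0 ?mul1r ?ge_min ?lexx //; lra.
  by move=> h1; have := mulr_ge0 (ltW eta0) F0; lra.
have eta2 : 2 * (eta * F ^+ 2) <= e / 2 * lyapn S.
  have : eta * (2 * (F ^+ 2 + 1)) <= e / 2 * lyapn S.
    by rewrite -ler_pdivlMr ?mulr_gt0 // ge_min lexx orbT.
  by lra.
pose g j := expR (eta * f j).
have gsum : \sum_j p j * g j <= 1.
  apply: (@le_trans _ _ (\sum_j p j * (1 + eta * f j + 2 * (eta * F) ^+ 2))).
    apply: ler_sum => j _; rewrite ler_wpM2l ?(ltW (wp_gt0 j)) //.
    have ab : `|eta * f j| <= eta * F by rewrite normrM (gtr0_norm eta0) ler_wpM2l ?(ltW eta0).
    apply: le_trans (expR_le2 _) _; first by apply: le_trans (ler_norm _) _; lra.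
    rewrite lerD2l ler_wpM2l // -(real_normK (num_real (eta * f j))) lerXn2r ?nnegrE //.
    exact: le_trans ab.
  under eq_bigr do rewrite mulrDr mulrDr mulr1 mulrCA.
  rewrite !big_split /= -mulr_sumr fsum -mulr_suml wp_sum mul1r.
  have := ler_wpM2l (ltW eta0) eta2; rewrite exprMn !expr2; lra.
exists (expR (- (eta * (b * ln c)))), (expR (- (eta * (e / 2)))).
split; rewrite ?expR_ge0 //.
  by rewrite expR_lt1 oppr_lt0 mulr_gt0 // divr_gt0.
move=> n; rewrite -expRM_natl -expRD -[leRHS]mul1r.
apply: (@le_trans _ _ (Ex (Stop S (E n)) (fun w => \prod_(j <- w) g j *
   expR (- (eta * (b * ln c)) + n%:R * - (eta * (e / 2)))))); last first.
  rewrite ExZr ler_wpM2r ?expR_ge0 //; apply: Stop_expmart => // j; exact: expR_ge0.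
apply: le_Ex => w ws; case: ltP => hw; last first.
  by rewrite mulr_ge0 ?expR_ge0 // prodr_ge0 // => j _; exact: expR_ge0.
have p0 : 0 < \prod_(j <- w) p j by apply: prodr_gt0 => j _; exact: wp_gt0.
have gE : \prod_(j <- w) g j = expR (eta * (- ln (\prod_(j <- w) p j) + b * ln `|lamw S w|)).
  rewrite /lamw normr_prod !ln_prod; [|by move=> j; exact: lam_norm_gt0|by move=> j; exact: wp_gt0].
  rewrite -sumrN mulr_sumr -big_split /= mulr_sumr.
  by elim: (w) => [|j u IH]; rewrite ?big_nil ?expR0 // !big_cons IH expRD.
rewrite gE -expRD -[true%:R]expR0 ler_expR.
have lw : ln (\prod_(j <- w) p j) < - ((h + e) * n%:R).
  by rewrite -[ltRHS]expRK ltr_ln ?posrE ?expR_gt0.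
have cw : ln c - n%:R <= ln `|lamw S w|.
  have := Stop_lower (le_trans (ltW (cmin_lt1 S)) (E_ge1 R n)) ws.
  rewrite -ler_ln ?posrE ?cmin_gt0 ?mulr_gt0 ?expR_gt0 ?lamw_gt0 //.
  rewrite lnM ?posrE ?expR_gt0 ?lamw_gt0 // expRK; lra.
have h1 : 0 <= - ln (\prod_(j <- w) p j) + b * ln `|lamw S w| - b * ln c - e / 2 * n%:R.
  have := ler_wpM2l b0 cw; move: lw; rewrite /b; clear.
  by move: (ln _) (ln _) (ln _) (n%:R) => *; lra.
have := mulr_ge0 (ltW eta0) h1; lra.
Qed.

Definition wordset (w : seq A) : set TR := [set x | `|x - trw S w| <= `|lamw S w| * Mr].

Lemma measurable_wordset w : measurable (wordset w).
Proof.
have -> : wordset w = [set` `[trw S w - `|lamw S w| * Mr, trw S w + `|lamw S w| * Mr]].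
  apply/seteqP; split=> x; rewrite /wordset /= in_itv /= ler_norml => /andP[? ?];
  by apply/andP; split; lra.
exact: measurable_itv.
Qed.

(** Outside sets of summable mass, x lies in the image of [-Mr, Mr] under a word of probability at
    least [T n], and the ball around x contains that image. *)
Lemma mass_ge_words (e : R) : 0 < e -> {ae mu, forall x, exists n0, forall n, (n0 <= n)%N ->
  expR (- ((entn S / lyapn S + e) * n%:R)) <=
  mr mu (ballset x ((2 * Mr + 1) * expR (- n%:R)))}.
Proof.
move=> e0; have M2 := Mr_ge2; have [C [q [C0 q0 q1 hC]]] := word_Chernoff e0.
pose T n := expR (- ((entn S / lyapn S + e) * n%:R)).
pose G n : set TR := \big[setU/set0]_(w <- unzip2 (fdl (Stop S (E n))) |
   T n <= \prod_(j <- w) p j) wordset w.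
have mG n : measurable (G n).
  by have [] := @mr_bigU _ mu _ (unzip2 (fdl (Stop S (E n)))) (fun w => T n <= \prod_(j <- w) p j)
    wordset 1 ler01 measurable_wordset (fun w _ => mr_le1 mu (measurable_wordset w)).
have h1 : {ae mu, forall x, exists n0, forall n, (n0 <= n)%N -> ~ (~` G n) x}.
  apply: (@geometric_Borel_Cantelli _ _ _ C q) => // n; first exact: measurableC.
  apply: le_trans (hC n); apply: mr_pred_words; first exact: measurableC.
  move=> w x ws xM nG; rewrite ltNge; apply/negP => hT; apply: nG; apply/in_bigU.
  by exists w; split=> //; rewrite /wordset /= addrK normrM ler_wpM2l.
move: h1; apply: filterS => x [n0 hx]; exists n0 => n /hx /contrapT.
move=> /in_bigU[w [ws hT wx]]; apply: le_trans hT _.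
apply: (@mr_ge_word (E n)) => //; first exact: measurable_ballset.
move=> y yM; apply/ballsetE; have hw := Stop_upper ws; have s0 := E_gt0 R n.
have lw : `|lamw S w| <= expR (- n%:R) by rewrite expRN -[leRHS]mul1r ler_pdivlMr // mulrC.
have a1 : `|lamw S w * y| <= expR (- n%:R) * Mr by rewrite normrM ler_pM.
have a2 : `|x - trw S w| <= expR (- n%:R) * Mr.
  by apply: le_trans wx _; rewrite ler_wpM2r //; lra.
have -> : lamw S w * y + trw S w - x = lamw S w * y - (x - trw S w) by ring.
apply: le_lt_trans (ler_normB _ _) _; have := expR_gt0 (- n%:R : R); lra.
Qed.

Lemma Ex_has (T I : eqType) (d : fdist R T) (L : seq I) (P : I -> T -> bool) (b : R) :
  (forall j, j \in L -> Ex d (fun w => (P j w)%:R) <= b) ->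
  Ex d (fun w => (has (P^~ w) L)%:R) <= (size L)%:R * b.
Proof.
move=> hb; apply: (@le_trans _ _ (Ex d (fun w => \sum_(j <- L) (P j w)%:R))).
  apply: le_Ex => w _; elim: L {hb} => [|j L IH]; first by rewrite big_nil.
  rewrite big_cons /=; case: (P j w) => /=; last by rewrite add0r.
  by rewrite lerDl sumr_ge0.
rewrite Ex_sum; elim: L hb => [|j L IH] hb; first by rewrite big_nil mul0r.
rewrite big_cons /= -natr1 mulrDl mul1r addrC lerD ?hb ?mem_head // IH // => k kL.
by apply: hb; rewrite inE kL orbT.
Qed.

Variable al : R.
Hypothesis hS_low : forall e, 0 < e -> exists n0, forall n, (n0 <= n)%N ->
    (al - e) * n%:R <= hS S (E n).

(** Markov's inequality in the form of [heavy_shift], then Borel-Cantelli along multiples of N. A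
    ball around x only meets words whose cells are shifted by an element of [J] from the cell of x,
    and almost surely none of these cells is heavy in the end. *)
Lemma mass_le (e : R) : 0 < e -> exists N : nat, (0 < N)%N /\ exists2 C : R, 0 < C &
  {ae mu, forall x, exists k0, forall k, (k0 <= k)%N ->
  mr mu (ballset x (expR (- (k * N)%:R))) <= C * expR (- ((al - 2 * e) * (k * N)%:R))}.
Proof.
move=> e0; have M2 := Mr_ge2.
have [N [h [N0 h0 hSM]]] := power_mean_decay hS_low e0.
exists N; split=> //.
(* [J] covers the shift from the cell of x to that of a word whose image comes within e^-(k N) of x,
   [J1] the shift between a word and a point of its image; [J2] adds the two. *)
pose J := near_ints (0 : R) (Mr + 3); pose J1 := near_ints (0 : R) (Mr + 2).
pose J2 := [seq j1 + j2 | j1 <- J1, j2 <- J].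
have JP : 0 < (size J)%:R :> R by rewrite ltr0n size_near_ints; clear; lia.
exists (size J)%:R => //.
pose T k := expR (- ((al - 2 * e) * (k * N)%:R)).
pose P k (i : int) := has (fun j => T k < cellm S (E (k * N)) (i + j)) J.
have h1 : {ae mu, forall x, exists n0, forall k, (n0 <= k)%N -> ~ badcells (E (k * N)) (P k) x}.
  have mB k : measurable (badcells (E (k * N)) (P k)).
    have [] // := @mr_bigU _ mu _ (near_ints 0 (E (k * N) * Mr + 1)) (P k) (cellset (E (k * N))) 1 ler01
      (fun i => measurable_cellset i (E_gt0 R _)).
    by move=> i _; apply: mr_le1; apply: measurable_cellset; exact: E_gt0.
  apply: (@geometric_Borel_Cantelli _ _ _ ((size J2)%:R * 2) (expR (- (h * e * N%:R)))) => //.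
  - by rewrite expR_lt1 oppr_lt0 !mulr_gt0 // ltr0n.
  - move=> k; set s := E (k * N); have s0 : 0 < s by exact: E_gt0.
    pose PP j w := T k < cellm S s (Q s (trw S w) + j).
    apply: (@le_trans _ _ (Ex (Stop S s) (fun w => (has (PP^~ w) J2)%:R))).
      apply: mr_pred_words; first exact: mB.
      move=> w y ws yM /badcells_in /hasP[j jJ hj].
      apply/hasP; exists ((Q s (lamw S w * y + trw S w) - Q s (trw S w)) + j).
        apply/allpairsP; exists (Q s (lamw S w * y + trw S w) - Q s (trw S w), j); split=> //=.
        apply: mem_near_ints; first by lra.
        rewrite subr0 intrB; have q1 := Q_near s (lamw S w * y + trw S w).
        have q2 := Q_near s (trw S w); have q3 := Stop_upper ws.
        have q4 : `|s * lamw S w * y| <= Mr.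
          rewrite normrM normrM (gtr0_norm s0); apply: le_trans yM.
          by rewrite ler_piMl.
        move: (Q s _)%:~R (Q s _)%:~R q1 q2 q4 => z1 z2; rewrite !ler_norml mulrDr mulrA.
        by move=> /andP[? ?] /andP[? ?] /andP[? ?]; apply/andP; split; lra.
      by rewrite /PP addrA [Q s (trw S w) + (_ - _)]addrC subrK.
    have hX j : j \in J2 -> Ex (Stop S s) (fun w => (PP j w)%:R) <= 2 * SM S h s / pw h (T k).
      by move=> _; apply: (@heavy_shift _ S h s (T k) j (ltW h0)); exact: expR_gt0.
    apply: le_trans (Ex_has hX) _.
    rewrite -!mulrA ler_wpM2l // ler_wpM2l // ler_pdivrMr ?pw_gt0 //.
    apply: le_trans (hSM k) _; rewrite -expRM_natl -expRD ler_expR expRK natrM.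
    by move: (N%:R) (k%:R) => a b; lra.
have h2 := ae_null (measurable_far _) mr_far.
move: h1 h2; apply: filterS2 => x [k0 hx] nf; exists k0 => k /hx nb.
have s0 := E_gt0 R (k * N); set s := E (k * N) in s0 nb *.
have := badcells_out s0 nf nb => /hasPn hJ.
apply: (@le_trans _ _ (Ex (Stop S s) (fun w => (has (fun j => Q s (trw S w) == Q s x + j) J)%:R))).
  apply: mr_pred_words; first exact: measurable_ballset.
  move=> w y ws yM /ballsetE hy; apply/hasP; exists (Q s (trw S w) - Q s x); last first.
    by rewrite addrC subrK.
  apply: mem_near_ints; first by lra.
  rewrite subr0 intrB; have q1 := Q_near s x; have q2 := Q_near s (trw S w).
  have q3 := Stop_upper ws.
  have q4 : `|s * lamw S w * y| <= Mr.
    rewrite normrM normrM (gtr0_norm s0); apply: le_trans yM.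
    by rewrite ler_piMl.
  have q5 : `|s * (lamw S w * y + trw S w - x)| <= 1.
    rewrite normrM (gtr0_norm s0) -(mulfV (lt0r_neq0 s0)) ler_wpM2l ?(ltW s0) //.
    by rewrite -expRN ltW.
  move: (Q s _)%:~R (Q s _)%:~R q1 q2 q4 q5 => z1 z2; rewrite !ler_norml mulrBr mulrDr mulrA.
  by move=> /andP[? ?] /andP[? ?] /andP[? ?] /andP[? ?]; apply/andP; split; lra.
apply: Ex_has => j /hJ; rewrite -leNgt; exact.
Qed.

End SelfSimilar.

(** * Passage from discrete radii to the local dimension *)

Section LocalDimension.
Variables (R : realType) (g : R -> R) (b K : R).
Local Notation ei i := ((i.+1)%:R^-1 : R).
Hypothesis b0 : 0 <= b.
Hypothesis K1 : 1 <= K.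
Hypothesis g_mono : forall r r', r <= r' -> g r <= g r'.
Hypothesis g_low : forall i : nat, exists n0, forall n, (n0 <= n)%N ->
  expR (- ((b + ei i) * n%:R)) <= g (K * expR (- n%:R)).
Hypothesis g_up : forall i : nat, exists N : nat, exists2 C : R, (0 < N)%N /\ 0 < C &
  exists k0, forall k, (k0 <= k)%N ->
  g (expR (- (k * N)%:R)) <= C * expR (- ((b - ei i) * (k * N)%:R)).

Lemma arith_up (y n e k : R) : 0 <= e -> n <= k + y + 1 -> (b + e) * n <= (b + e) * (k + y + 1).
Proof. by move=> e0 h; rewrite ler_wpM2l // addr_ge0. Qed.

(** The bounds hold at radii K e^-n and e^-(k N) only. Monotonicity fills the gaps at the bounded
    costs [D1] and [D2], which disappear after division by ln d. *)
Lemma local_dim : ln (g d) / ln d @[d --> 0^'+] --> b.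
Proof.
apply/cvgrPdist_le => eps eps0.
have [i0 hi0] := arch_nat (2 / eps).
pose e := ei i0; have e0 : 0 < e by rewrite invr_gt0.
have e2 : e <= eps / 2.
  have h : 2 / eps <= i0.+1%:R by apply: hi0.
  by rewrite -[eps / 2]invrK invf_div lef_pV2 ?posrE ?divr_gt0.
have [n0 hlow] := g_low i0; have [N [C [N0 C0] [k0 hup]]] := g_up i0.
have lK : 0 <= ln K by apply: ln_ge0.
pose D1 := (b + e) * (ln K + 1); pose D2 := b * N%:R + ln C.
pose Y0 := n0%:R + k0%:R * N%:R + 2 * (`|D1| + `|D2|) / eps + 1.
near=> d.
have d0 : 0 < d by near: d; exact: nbhs_right_gt.
have dY : d < expR (- Y0) by near: d; apply: nbhs_right_lt; exact: expR_gt0.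
pose y := - ln d.
have dE : d = expR (- y) by rewrite /y opprK lnK // posrE.
have yY : Y0 < y by rewrite dE ltr_expR ltrN2 in dY.
have q0 : 0 <= 2 * (`|D1| + `|D2|) / eps by rewrite !mulr_ge0 ?addr_ge0 // invr_ge0 ltW.
have kN0 : 0 <= k0%:R * N%:R :> R by rewrite mulr_ge0.
have n00 : 0 <= n0%:R :> R by [].
have y0 : 0 < y by rewrite /Y0 in yY; lra.
have yn : n0%:R <= y by rewrite /Y0 in yY; lra.
have yk : k0%:R * N%:R <= y by rewrite /Y0 in yY; lra.
have yD : 2 * (`|D1| + `|D2|) <= eps * y.
  rewrite [leRHS]mulrC -ler_pdivrMr //; move: yY n00 kN0; rewrite /Y0.
  by clear; move: (_ / eps) (k0%:R * _) => *; lra.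
have NR : 0 < N%:R :> R by rewrite ltr0n.
have ky0 : 0 <= ln K + y by lra.
have /andP[a1 a2] := truncn_itv ky0.
set n1 := Num.truncn _ in a1 a2.
have nn : (n0 <= n1.+1)%N by rewrite -(ler_nat R); lra.
have l1 : expR (- ((b + e) * n1.+1%:R)) <= g d.
  apply: le_trans (hlow _ nn) _; apply: g_mono; rewrite -[K]lnK ?posrE ?(lt_le_trans ltr01) //.
  by rewrite -expRD [X in _ <= X]dE ler_expR; lra.
have g0 : 0 < g d by apply: lt_le_trans l1; exact: expR_gt0.
have l2 : - ln (g d) <= (b + e) * (ln K + y + 1).
  rewrite lerNl; apply: le_trans (_ : - ((b + e) * n1.+1%:R) <= _).
    rewrite lerN2; apply: arith_up; first exact: ltW.
    by rewrite -natr1; lra.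
  by rewrite -[leLHS]expRK ler_ln ?posrE ?expR_gt0.
have yN0 : 0 <= y / N%:R by rewrite divr_ge0 // ltW.
have /andP[b1 b2] := truncn_itv yN0.
set k1 := Num.truncn _ in b1 b2; rewrite ler_pdivlMr // in b1.
rewrite ltr_pdivrMr // in b2.
have kk : (k0 <= k1)%N.
  by rewrite -ltnS -(ltr_nat R) -(ltr_pM2r NR); apply: le_lt_trans yk b2.
have u1 : g d <= C * expR (- ((b - e) * (k1 * N)%:R)).
  apply: le_trans (hup _ kk); apply: g_mono; rewrite [X in X <= _]dE ler_expR lerN2 natrM.
  exact: b1.
have u2 : (b - e) * (k1 * N)%:R - ln C <= - ln (g d).
  rewrite lerNr; apply: le_trans (_ : ln (C * expR (- ((b - e) * (k1 * N)%:R))) <= _).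
    by rewrite ler_ln ?posrE ?mulr_gt0 ?expR_gt0.
  by rewrite lnM ?posrE ?expR_gt0 // expRK; lra.
have u3 : b * y - b * N%:R - e * y <= (b - e) * (k1 * N)%:R.
  rewrite natrM mulrBl; apply: lerB; last by rewrite ler_wpM2l // ltW.
  rewrite -mulrBr ler_wpM2l //.
  by move: b2; rewrite -natr1 mulrDl mul1r; lra.
have ey : e * y <= eps / 2 * y by rewrite ler_wpM2r // ltW.
have -> : ln (g d) / ln d = - ln (g d) / y by rewrite /y mulNr invrN mulrN opprK.
have n1D := ler_norm D1; have n2D := ler_norm D2.
have n1D' := normr_ge0 D1; have n2D' := normr_ge0 D2.
have -> : b - - ln (g d) / y = (b * y - - ln (g d)) / y by field; rewrite gt_eqF.
rewrite normrM normfV (gtr0_norm y0) ler_pdivrMr //.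
rewrite ler_norml; apply/andP; split.
  move: l2 n1D n1D' n2D' yD ey; rewrite /D1; clear; move: (ln (g d)) `|_| `|_| => *; lra.
move: u2 u3 n2D n1D' n2D' yD ey; rewrite /D2; clear; move: (_ * (k1 * N)%:R) (ln (g d)) `|_| `|_| => *; lra.
Unshelve. all: by end_near.
Qed.
End LocalDimension.

Section AlmostEverywhere.
Variables (R : realType) (mu : probability (measurableTypeR R) R).
Let F := ae_filter_ringOfSetsType mu.

Lemma ae_imp (P P' : R -> Prop) : (forall x, P x -> P' x) ->
  {ae mu, forall x, P x} -> {ae mu, forall x, P' x}.
Proof. exact: (@filterS _ _ F). Qed.

Lemma ae_imp2 (P P' P2 : R -> Prop) : (forall x, P x -> P' x -> P2 x) ->
  {ae mu, forall x, P x} -> {ae mu, forall x, P' x} -> {ae mu, forall x, P2 x}.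
Proof. exact: (@filterS2 _ _ F). Qed.
End AlmostEverywhere.

(** * The dimension formula *)

Section Main.
Variables (R : realType) (S : wifs R) (mu : probability (measurableTypeR R) R).
Hypothesis lam_alg : forall j, algebraicOver (@ratr R) (@wlam R S j).
Hypothesis no_overlaps : ~ has_exact_overlaps (@wlam R S) (@wt R S).
Hypothesis mu_ss : is_self_similar_measure (@wlam R S) (@wt R S) (@wp R S) mu.
Local Notation E j := (expR (j%:R : R)).
Local Notation b := (Num.min 1 (entn S / lyapn S)).

Lemma ball_mono x r r' : r <= r' -> mr mu (ballset x r) <= mr mu (ballset x r').
Proof.
move=> rr; apply: mr_le; [exact: measurable_ballset|exact: measurable_ballset|].
by move=> y /ballsetE h; apply/ballsetE; apply: lt_le_trans rr.
Qed.

Lemma mass_lower (e : R) : 0 < e -> {ae mu, forall x : R, exists n0, forall n, (n0 <= n)%N ->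
  expR (- ((b + e) * n%:R)) <= mr mu (ballset x ((2 * Mr S + 1) * expR (- n%:R)))}.
Proof.
move=> e0; case: (leP 1 (entn S / lyapn S)) => h.
  apply: ae_imp (mass_ge_scale mu_ss e0) => x [n0 hx]; exists n0 => n /hx h1.
  apply: le_trans h1 _; apply: ball_mono; rewrite ler_peMl ?expR_ge0 //.
  by have := Mr_ge2 S; lra.
by have := mass_ge_words mu_ss e0.
Qed.

Lemma mass_upper (e : R) : 0 < e -> exists N : nat, exists2 C : R, (0 < N)%N /\ 0 < C &
  {ae mu, forall x : R, exists k0, forall k, (k0 <= k)%N ->
  mr mu (ballset x (expR (- (k * N)%:R))) <= C * expR (- ((b - e) * (k * N)%:R))}.
Proof.
move=> e0; have [al [C [/andP[al0 al1] C0 up low]]] := entropy_dim_exists S.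
have b_al : b <= al.
  case: (ltP al 1) => al1'; last by apply: le_trans al1'; rewrite ge_min lexx.
  have := dim_ge lam_alg no_overlaps al0 up low al1'.
  by apply: le_trans; rewrite ge_min lexx orbT.
have e2 : 0 < e / 2 by rewrite divr_gt0.
have [N [N0 [C' C'0 h]]] := mass_le mu_ss low e2.
exists N, C' => //; apply: ae_imp h => x [k0 hx]; exists k0 => k /hx h.
apply: le_trans h _; rewrite ler_wpM2l ?(ltW C'0) // ler_expR lerN2.
by rewrite ler_wpM2r // mulrCA divff // mulr1 lerD2r.
Qed.

Lemma dimension_formula : {ae mu, forall x : R,
  ln (mr mu (ballset x d)) / ln d @[d --> 0^'+] --> b}.
Proof.
have b0 : 0 <= b by rewrite le_min ler01 divr_ge0 ?entn_ge0 // ltW // lyapn_gt0.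
have K1 : 1 <= 2 * Mr S + 1 by have := Mr_ge2 S; lra.
have ei i : 0 < (i.+1)%:R^-1 :> R by rewrite invr_gt0.
(* The errors 1 / (i + 1) reduce all positive errors to countably many exceptional null sets. *)
have h1 : {ae mu, forall x : R, forall i : nat, exists n0, forall n, (n0 <= n)%N ->
  expR (- ((b + i.+1%:R^-1) * n%:R)) <= mr mu (ballset x ((2 * Mr S + 1) * expR (- n%:R)))}.
  by apply: ae_foralln => i; apply: mass_lower.
have h2 : {ae mu, forall x : R, forall i : nat, exists N : nat, exists2 C : R, (0 < N)%N /\ 0 < C &
  exists k0, forall k, (k0 <= k)%N ->
  mr mu (ballset x (expR (- (k * N)%:R))) <= C * expR (- ((b - i.+1%:R^-1) * (k * N)%:R))}.
  apply: ae_foralln => i; have [N [C NC h]] := mass_upper (ei i).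
  by apply: ae_imp h => x hx; exists N, C.
apply: ae_imp2 h1 h2 => x h1 h2.
exact: (@local_dim R (fun r => mr mu (ballset x r)) b (2 * Mr S + 1) b0 K1 (ball_mono x) h1 h2).
Qed.
End Main.

Theorem theorem2 (R : realType) (m : nat) (lam t p : 'I_m.+1 -> R)
    (lam_neq0 : forall j, lam j != 0)
    (lam_contr : forall j, -1 < lam j < 1)
    (lam_alg : forall j, algebraicOver (@ratr R) (lam j))
    (no_overlaps : ~ has_exact_overlaps lam t)
    (p_gt0 : forall j, 0 < p j)
    (p_sum : \sum_(j < m.+1) p j = 1)
    (mu : probability (measurableTypeR R) R)
    (mu_selfsim : is_self_similar_measure lam t p mu) :
  has_dimension mu (Num.min 1 (entropy p / lyapunov_exponent lam p)).
Proof.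
pose S := @Wifs R m lam t p lam_neq0 lam_contr p_gt0 p_sum.
have l2 : ln 2 != 0 :> R by rewrite gt_eqF // ln_gt0 // ltr1n.
(* Passing between base 2 and base e multiplies entropy and Lyapunov exponent by the same factor. *)
have eqd : entropy p / lyapunov_exponent lam p = entn S / lyapn S.
  have -> : entropy p = entn S / ln 2.
    rewrite /entropy /entn mulNr mulr_suml; congr (- _).
    by apply: eq_bigr => j _; rewrite mulrA.
  have -> : lyapunov_exponent lam p = lyapn S / ln 2.
    rewrite /lyapunov_exponent /lyapn mulNr mulr_suml; congr (- _).
    by apply: eq_bigr => j _; rewrite mulrA.
  by field; rewrite l2 gt_eqF // lyapn_gt0.
rewrite eqd; split.
  by rewrite le_min ler01 ge_min lexx /= andbT divr_ge0 ?entn_ge0 // ltW // lyapn_gt0.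
apply: ae_imp (@dimension_formula R S mu lam_alg no_overlaps mu_selfsim) => x; set f := fun d : R => _; set g := fun d : R => _.
suff -> : f = g by [].
apply/funext => d; rewrite /f /g /log2 -[fine _]/(mr mu (ballset x d)).
(* If ln d = 0, both quotients are 0 by the convention for division by 0. *)
have [d0|d0] := eqVneq (ln d) 0; first by rewrite d0 mul0r invr0 !mulr0.
by field; rewrite l2 d0.
Qed.
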